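(* Let $\mathscr P_1,\mathscr P_2$ be circular-arc polygons with $m$ and $n$ edges, $l$ the number of related edges and $k$ the number of intersection points of their boundaries. Given the sequence lists $S_1,S_2$, the two new linked lists $\mathscr P_1^*,\mathscr P_2^*$ can be constructed in $O(m+n+l+k)$ time.
   Context: A circular-arc polygon has boundary consisting of circular arcs, or arcs and line segments, and is stored as a doubly linked list of its vertices in counterclockwise order with one appendix point (interior point determining the arc) inserted for each arc edge. Related edges: with $I$ the intersection of the two polygons' axis-parallel bounding rectangles, the effective axis is the y-axis if $I$'s horizontal extent is at least its vertical extent and the x-axis otherwise; with $[a,b]$ the projection of $I$ on the effective axis, the related edges are the edges of either polygon lying in, or intersecting the boundary of, the slab of points whose effective-axis coordinate is in $[a,b]$. Processed related edges: related edges with each non-x-monotone arc (an arc met twice by some vertical line) replaced by its pieces cut by the horizontal line through its circle's center. $S_i$ is the counterclockwise list of processed related edges of $\mathscr P_i$, each item storing the edge, the intersection points with the other polygon's boundary ordered along the edge, and a tag ($0$ for non-decomposed edges, alternately $1$ and $2$ for pieces of successive decomposed arcs). The new linked list $\mathscr P_i^*$ is the linked list of $\mathscr P_i$ in which every related edge carrying intersection points is replaced by its subdivision at those intersection points, with new appendix points inserted so that every resulting sub-arc has an appendix point, and with pieces of decomposed arcs merged back into single arcs. *)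

(* Defs.v *)
From Stdlib Require Import Reals Lra Lia List Sorted ZArith.
Import ListNotations.
Open Scope R_scope.

(** * Plane geometry *)

Definition point : Type := (R * R)%type.

Definition cross (u v : point) : R := fst u * snd v - snd u * fst v.
Definition sub (p q : point) : point := (fst p - fst q, snd p - snd q).
Definition dist2 (p q : point) : R :=
  (fst p - fst q) * (fst p - fst q) + (snd p - snd q) * (snd p - snd q).

(** Positive exactly when [a], [b], [c] make a left turn; for three points of
    one circle, exactly when they occur in counterclockwise cyclic order. *)
Definition orient (a b c : point) : R := cross (sub b a) (sub c a).

Definition circumcenter (a b c : point) : point :=
  let u := sub b a in
  let v := sub c a in
  let u2 := fst u * fst u + snd u * snd u in
  let v2 := fst v * fst v + snd v * snd v in
  (fst a + (snd v * u2 - snd u * v2) / (2 * orient a b c),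
   snd a + (fst u * v2 - fst v * u2) / (2 * orient a b c)).

Lemma circumcenter_spec (a b c : point) :
  orient a b c <> 0 ->
  dist2 (circumcenter a b c) a = dist2 (circumcenter a b c) b /\
  dist2 (circumcenter a b c) a = dist2 (circumcenter a b c) c.
Proof.
unfold circumcenter, dist2, orient, cross, sub.
destruct a as [ax ay], b as [bx by'], c as [cx cy]; simpl; intros H.
split; field; lra.
Qed.

(** A directed edge; [app] is the appendix point of an arc and [None] for a
    line segment. *)
Record edge : Type := Edge { src : point; app : option point; dst : point }.

Definition valid_edge (e : edge) : Prop :=
  match app e with
  | None => src e <> dst e
  | Some c => orient (src e) c (dst e) <> 0
  end.

Definition at_param (a b : point) (t : R) : point :=
  (fst a + t * (fst b - fst a), snd a + t * (snd b - snd a)).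

(** The closed arc consists of its endpoints and of the points of the circle
    on the same side of the chord as the appendix point. *)
Definition on_edge (e : edge) (x : point) : Prop :=
  match app e with
  | None => exists t, 0 <= t <= 1 /\ x = at_param (src e) (dst e) t
  | Some c =>
      let o := circumcenter (src e) c (dst e) in
      dist2 o x = dist2 o (src e) /\
      (x = src e \/ x = dst e \/
       0 < orient (src e) x (dst e) * orient (src e) c (dst e))
  end.

Definition inside_edge (e : edge) (x : point) : Prop :=
  on_edge e x /\ x <> src e /\ x <> dst e.

(** [x] is met strictly before [y] when the edge is travelled from [src e] to
    [dst e]. *)
Definition before (e : edge) (x y : point) : Prop :=
  on_edge e x /\ on_edge e y /\
  match app e with
  | None => exists s t, s < t /\ x = at_param (src e) (dst e) s /\
                        y = at_param (src e) (dst e) t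
  | Some c =>
      x <> y /\
      (x = src e \/ y = dst e \/
       0 < orient (src e) x y * orient (src e) c (dst e))
  end.

(** [l] lists the points satisfying [A], without repetition, in their order
    along [e]. *)
Definition listed_along (e : edge) (A : point -> Prop) (l : list point) : Prop :=
  StronglySorted (before e) l /\ forall x, In x l <-> A x.

(** [e'] is the part of [e] from [u] to [v], with any appendix point that lies
    strictly between [u] and [v] if [e] is an arc. *)
Definition subedge (e : edge) (u v : point) (e' : edge) : Prop :=
  src e' = u /\ dst e' = v /\
  match app e, app e' with
  | None, None => True
  | Some _, Some c' => before e u c' /\ before e c' v
  | _, _ => False
  end.

Fixpoint subdivision_from (e : edge) (u : point) (l : list point)
    (es : list edge) : Prop :=
  match l, es with
  | [], [e'] => subedge e u (dst e) e'
  | v :: l', e' :: es' => subedge e u v e' /\ subdivision_from e v l' es'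
  | _, _ => False
  end.

Definition subdivision (e : edge) (l : list point) (es : list edge) : Prop :=
  subdivision_from e (src e) l es.

Definition has_card {T : Type} (A : T -> Prop) (n : nat) : Prop :=
  exists l : list T, NoDup l /\ (forall x, In x l <-> A x) /\ length l = n.

(** * Circular-arc polygons *)

(** The vertices in order, each with the appendix point, if any, of the edge
    that leaves it. *)
Definition polygon : Type := list (point * option point).

Fixpoint edges_until (z : point) (P : polygon) : list edge :=
  match P with
  | [] => []
  | (v, c) :: P' =>
      Edge v c (match P' with [] => z | (w, _) :: _ => w end)
        :: edges_until z P'
  end.

Definition edges (P : polygon) : list edge :=
  match P with [] => [] | (v, _) :: _ => edges_until v P end.

Definition on_boundary (P : polygon) (x : point) : Prop :=
  exists e, In e (edges P) /\ on_edge e x.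

(** The value of (1/2) * (integral of x dy - y dx) along the edge: on the arc
    of centre [o] and radius [r] that starts at angle [th] and sweeps the
    signed angle [d], it is (cross o (dst - src) + r^2 d) / 2. *)
Definition edge_area (e : edge) (w : R) : Prop :=
  match app e with
  | None => w = cross (src e) (dst e) / 2
  | Some c =>
      exists (o : point) (r th d : R),
        let at_angle t := (fst o + r * cos t, snd o + r * sin t) in
        0 < r /\ 0 < Rabs d < 2 * PI /\
        src e = at_angle th /\ dst e = at_angle (th + d) /\
        (exists t, 0 < t < 1 /\ c = at_angle (th + t * d)) /\
        w = (cross o (sub (dst e) (src e)) + r * r * d) / 2
  end.

Definition counterclockwise (P : polygon) : Prop :=
  exists ws, Forall2 edge_area (edges P) ws /\ 0 < fold_right Rplus 0 ws.

(** The boundary is a simple closed curve: distinct edges meet only where one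
    ends and the other starts. *)
Definition simple_boundary (P : polygon) : Prop :=
  NoDup (map fst P) /\
  forall e f x, In e (edges P) -> In f (edges P) -> e <> f ->
    on_edge e x -> on_edge f x ->
    (x = dst e /\ x = src f) \/ (x = src e /\ x = dst f).

Definition circular_arc_polygon (P : polygon) : Prop :=
  (2 <= length P)%nat /\
  Forall valid_edge (edges P) /\
  Exists (fun e => app e <> None) (edges P) /\
  simple_boundary P /\
  counterclockwise P.

(** * Related edges *)

Record box : Type := Box { xlo : R; xhi : R; ylo : R; yhi : R }.

Definition least_on (P : polygon) (f : point -> R) (a : R) : Prop :=
  (exists x, on_boundary P x /\ f x = a) /\
  (forall x, on_boundary P x -> a <= f x).

Definition greatest_on (P : polygon) (f : point -> R) (a : R) : Prop :=
  (exists x, on_boundary P x /\ f x = a) /\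
  (forall x, on_boundary P x -> f x <= a).

Definition bounding_box (P : polygon) (b : box) : Prop :=
  least_on P fst (xlo b) /\ greatest_on P fst (xhi b) /\
  least_on P snd (ylo b) /\ greatest_on P snd (yhi b).

Definition box_meet (b c : box) : box :=
  Box (Rmax (xlo b) (xlo c)) (Rmin (xhi b) (xhi c))
      (Rmax (ylo b) (ylo c)) (Rmin (yhi b) (yhi c)).

(** [f] is the coordinate along the effective axis. *)
Definition meets_slab (f : point -> R) (a b : R) (e : edge) : Prop :=
  (forall x, on_edge e x -> a <= f x <= b) \/
  (exists x, on_edge e x /\ (f x = a \/ f x = b)).

(** If the bounding boxes are disjoint the slab is empty and no edge is
    related. *)
Definition related (P Q : polygon) (e : edge) : Prop :=
  exists b c, bounding_box P b /\ bounding_box Q c /\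
    let I := box_meet b c in
    xlo I <= xhi I /\ ylo I <= yhi I /\
    (yhi I - ylo I <= xhi I - xlo I -> meets_slab snd (ylo I) (yhi I) e) /\
    (xhi I - xlo I < yhi I - ylo I -> meets_slab fst (xlo I) (xhi I) e).

Definition related_edge (P Q : polygon) (e : edge) : Prop :=
  (In e (edges P) \/ In e (edges Q)) /\ related P Q e.

Definition boundary_intersection (P Q : polygon) (x : point) : Prop :=
  on_boundary P x /\ on_boundary Q x.

(** * Sequence lists *)

Definition non_x_monotone (e : edge) : Prop :=
  app e <> None /\
  exists x y, on_edge e x /\ on_edge e y /\ x <> y /\ fst x = fst y.

Definition on_center_line (e : edge) (x : point) : Prop :=
  match app e with
  | None => False
  | Some c => snd x = snd (circumcenter (src e) c (dst e))
  end.

Definition decomposition (e : edge) (es : list edge) : Prop :=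
  exists l,
    listed_along e (fun x => inside_edge e x /\ on_center_line e x) l /\
    subdivision e l es.

Record item : Type :=
  Item { item_edge : edge; item_points : list point; item_tag : nat }.

Definition item_for (Q : polygon) (t : nat) (e : edge) (it : item) : Prop :=
  item_edge it = e /\ item_tag it = t /\
  listed_along e (fun x => on_edge e x /\ on_boundary Q x) (item_points it).

(** The [nat] index is the tag of the next decomposed arc. *)
Inductive sequence_items (P Q : polygon) :
    nat -> list edge -> list item -> Prop :=
| seq_nil t : sequence_items P Q t [] []
| seq_unrelated t e es S :
    ~ related P Q e -> sequence_items P Q t es S ->
    sequence_items P Q t (e :: es) S
| seq_whole t e es it S :
    related P Q e -> ~ non_x_monotone e -> item_for Q 0 e it ->
    sequence_items P Q t es S ->
    sequence_items P Q t (e :: es) (it :: S)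
| seq_decomposed t e es pieces its S :
    related P Q e -> non_x_monotone e -> decomposition e pieces ->
    Forall2 (item_for Q t) pieces its ->
    sequence_items P Q (3 - t) es S ->
    sequence_items P Q t (e :: es) (its ++ S).

(** The list may start at any edge of [P]. *)
Definition sequence_list (P Q : polygon) (S : list item) : Prop :=
  exists xs ys, edges P = xs ++ ys /\ sequence_items P Q 1 (ys ++ xs) S.

(** * New linked lists *)

Definition carries_points (P Q : polygon) (e : edge) : Prop :=
  related P Q e /\ exists x, on_edge e x /\ on_boundary Q x.

Definition refined_edge (P Q : polygon) (e : edge) (es : list edge) : Prop :=
  (carries_points P Q e ->
     exists l, listed_along e (fun x => inside_edge e x /\ on_boundary Q x) l /\
               subdivision e l es) /\
  (~ carries_points P Q e -> es = [e]).

Definition new_polygon (P Q P' : polygon) : Prop :=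
  exists ess, Forall2 (refined_edge P Q) (edges P) ess /\
              edges P' = concat ess.

(** * Machine model: a pointer machine with unit-cost real arithmetic *)

(** Memory consists of records with word and real fields, addressed by nonzero
    words below [free].  Words can only be copied and compared, and field
    numbers and constants are fixed by the program, so every instruction is a
    constant-time operation of a real RAM. *)
Record state : Type := State {
  wreg : nat -> nat;
  rreg : nat -> R;
  wmem : nat -> nat -> nat;
  rmem : nat -> nat -> R;
  free : nat
}.

Definition upd {T : Type} (f : nat -> T) (i : nat) (v : T) : nat -> T :=
  fun j => if Nat.eqb j i then v else f j.

Definition set_wreg (s : state) (x v : nat) : state :=
  State (upd (wreg s) x v) (rreg s) (wmem s) (rmem s) (free s).
Definition set_rreg (s : state) (u : nat) (v : R) : state :=
  State (wreg s) (upd (rreg s) u v) (wmem s) (rmem s) (free s).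
Definition set_wmem (s : state) (a i v : nat) : state :=
  State (wreg s) (rreg s) (upd (wmem s) a (upd (wmem s a) i v)) (rmem s) (free s).
Definition set_rmem (s : state) (a i : nat) (v : R) : state :=
  State (wreg s) (rreg s) (wmem s) (upd (rmem s) a (upd (rmem s a) i v)) (free s).
Definition grow (s : state) : state :=
  State (wreg s) (rreg s) (wmem s) (rmem s) (S (free s)).

Definition allocated (s : state) (a : nat) : Prop := (0 < a < free s)%nat.

Inductive rop : Type := OpAdd | OpSub | OpMul | OpDiv.

Definition eval_rop (o : rop) (a b : R) : R :=
  match o with
  | OpAdd => a + b | OpSub => a - b | OpMul => a * b | OpDiv => a / b
  end.

Inductive instr : Type :=
| WConst (x c : nat)
| WMove (x y : nat)
| WLoad (x y i : nat)
| WStore (x i y : nat)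
| New (x : nat)
| RConst (u : nat) (c : Z)
| RMove (u v : nat)
| ROp (o : rop) (u v w : nat)
| RLoad (u y i : nat)
| RStore (x i u : nat).

Inductive step : instr -> state -> state -> Prop :=
| step_wconst s x c : step (WConst x c) s (set_wreg s x c)
| step_wmove s x y : step (WMove x y) s (set_wreg s x (wreg s y))
| step_wload s x y i : allocated s (wreg s y) ->
    step (WLoad x y i) s (set_wreg s x (wmem s (wreg s y) i))
| step_wstore s x i y : allocated s (wreg s x) ->
    step (WStore x i y) s (set_wmem s (wreg s x) i (wreg s y))
| step_new s x : step (New x) s (grow (set_wreg s x (free s)))
| step_rconst s u c : step (RConst u c) s (set_rreg s u (IZR c))
| step_rmove s u v : step (RMove u v) s (set_rreg s u (rreg s v))
| step_rop s o u v w : (o = OpDiv -> rreg s w <> 0) ->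
    step (ROp o u v w) s (set_rreg s u (eval_rop o (rreg s v) (rreg s w)))
| step_rload s u y i : allocated s (wreg s y) ->
    step (RLoad u y i) s (set_rreg s u (rmem s (wreg s y) i))
| step_rstore s x i u : allocated s (wreg s x) ->
    step (RStore x i u) s (set_rmem s (wreg s x) i (rreg s u)).

Inductive test : Type :=
| WEq (x y : nat)
| REq (u v : nat)
| RLt (u v : nat)
| TNot (b : test).

Fixpoint holds (s : state) (b : test) : Prop :=
  match b with
  | WEq x y => wreg s x = wreg s y
  | REq u v => rreg s u = rreg s v
  | RLt u v => rreg s u < rreg s v
  | TNot b' => ~ holds s b'
  end.

Inductive cmd : Type :=
| Skip
| Do (i : instr)
| Seq (p q : cmd)
| If (b : test) (p q : cmd)
| While (b : test) (p : cmd).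

(** [exec p s t s']: started in [s], [p] halts in [s'] after [t] steps. *)
Inductive exec : cmd -> state -> nat -> state -> Prop :=
| exec_skip s : exec Skip s 1 s
| exec_do i s s' : step i s s' -> exec (Do i) s 1 s'
| exec_seq p q s t s' t' s'' :
    exec p s t s' -> exec q s' t' s'' -> exec (Seq p q) s (t + t') s''
| exec_if_true b p q s t s' :
    holds s b -> exec p s t s' -> exec (If b p q) s (S t) s'
| exec_if_false b p q s t s' :
    ~ holds s b -> exec q s t s' -> exec (If b p q) s (S t) s'
| exec_while_false b p s : ~ holds s b -> exec (While b p) s 1 s
| exec_while_true b p s t s' t' s'' :
    holds s b -> exec p s t s' -> exec (While b p) s' t' s'' ->
    exec (While b p) s (S (t + t')) s''.

(** * Data layout; the word 0 is the null pointer *)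

(** Linked-list nodes of a polygon: kind 0 for a vertex, 1 for an appendix
    point. *)
Definition nodes (P : polygon) : list (nat * point) :=
  flat_map (fun vc => (0%nat, fst vc) ::
              match snd vc with Some c => [(1%nat, c)] | None => [] end) P.

(** Word fields of a node: 0 kind, 1 next, 2 prev.  Real fields: 0 and 1, the
    coordinates.  The doubly linked list is circular, [h] is its first node
    and [ads] lists the addresses of its nodes in order. *)
Definition stores_polygon (s : state) (h : nat) (P : polygon) (ads : list nat) :
    Prop :=
  let ns := nodes P in
  length ads = length ns /\ NoDup ads /\ hd 0%nat ads = h /\
  forall i, (i < length ns)%nat ->
    let a := nth i ads 0%nat in
    let a' := nth (Nat.modulo (S i) (length ns)) ads 0%nat in
    let nd := nth i ns (0%nat, (0, 0)) in
    allocated s a /\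
    wmem s a 0 = fst nd /\
    rmem s a 0 = fst (snd nd) /\ rmem s a 1 = snd (snd nd) /\
    wmem s a 1 = a' /\ wmem s a' 2 = a.

(** Null-terminated list of points: word field 0 is next, real fields 0 and 1
    are the coordinates. *)
Fixpoint stores_points (s : state) (h : nat) (l : list point) (ads : list nat) :
    Prop :=
  match l, ads with
  | [], [] => h = 0%nat
  | x :: l', a :: ads' =>
      h = a /\ allocated s a /\
      rmem s a 0 = fst x /\ rmem s a 1 = snd x /\
      stores_points s (wmem s a 0) l' ads'
  | _, _ => False
  end.

(** Null-terminated list of items.  Word fields: 0 next, 1 tag, 2 kind of edge
    (0 segment, 1 arc), 3 list of intersection points.  Real fields: 0-1
    source, 2-3 target, 4-5 appendix point of an arc. *)
Fixpoint stores_items (s : state) (h : nat) (S : list item) (ads : list nat) :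
    Prop :=
  match S with
  | [] => ads = [] /\ h = 0%nat
  | it :: S' =>
      exists ads1 ads2, ads = h :: ads1 ++ ads2 /\ allocated s h /\
        wmem s h 1 = item_tag it /\
        rmem s h 0 = fst (src (item_edge it)) /\
        rmem s h 1 = snd (src (item_edge it)) /\
        rmem s h 2 = fst (dst (item_edge it)) /\
        rmem s h 3 = snd (dst (item_edge it)) /\
        match app (item_edge it) with
        | None => wmem s h 2 = 0%nat
        | Some c =>
            wmem s h 2 = 1%nat /\ rmem s h 4 = fst c /\ rmem s h 5 = snd c
        end /\
        stores_points s (wmem s h 3) (item_points it) ads1 /\
        stores_items s (wmem s h 0) S' ads2
  end.

Definition initial_state (s : state) (P1 P2 : polygon) (S1 S2 : list item) :
    Prop :=
  exists f1 f2 g1 g2,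
    stores_polygon s (wreg s 0) P1 f1 /\ stores_polygon s (wreg s 1) P2 f2 /\
    stores_items s (wreg s 2) S1 g1 /\ stores_items s (wreg s 3) S2 g2 /\
    NoDup (f1 ++ f2 ++ g1 ++ g2).

Definition final_state (s : state) (P1' P2' : polygon) : Prop :=
  exists f1 f2,
    stores_polygon s (wreg s 0) P1' f1 /\ stores_polygon s (wreg s 1) P2' f2 /\
    NoDup (f1 ++ f2).

(* Main.v *)
Require Import Defs.
From Stdlib Require Import Reals List.
From Stdlib Require Import Lra Lia Sorted ZArith Permutation.
Import ListNotations Defs.
Open Scope R_scope.

(** Every edge carries an injective real key on its line or circle (the parameter
    of a segment; for an arc, an exponential of the tangent of the angle between
    the radius at its source and the chord) that increases along the edge.  All subedges of an edge
    share its key, so the points listed for the pieces of a decomposed arc, read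
    one piece after the other, are weakly sorted along the whole arc, with
    repetitions only where two pieces meet.

    Such a list is inserted greedily: each point different from both ends of the
    last subedge splits it in two.  The two new appendix points need no square
    root: the line through an end of the arc along the sum of the tangent there
    and the chord to the new point meets the circle again strictly between them,
    at a point rational in the data.

    The program walks once around the list to find the source of the first item
    and once more to perform the insertions; a last round restores the backward
    links.  Its cost is linear in the number of edges, items and listed points.
    There are at most three items per edge, because a circle meets the horizontal
    line through its centre twice, and at most three occurrences of each
    intersection point interior to an edge; such points are counted once over
    all edges because the boundary is simple. *)

(** * Keys on segments and circles *)

(** Betweenness on an arc is given by signs of orientations, hence by a cyclic order, whereas
    sorting, concatenating and splitting lists of points need a linear one. Cutting the circle at
    the source of the arc provides it: seen from there the circle is parametrized rationally by a
    single slope, orientations become Vandermonde products, and no angle has to be handled. The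
    exponential moves all slopes into the positive reals, which leaves the key 0 for the base point
    itself. The key belongs to the whole circle, so it survives repeated splitting with changing
    appendix points.

    For the program, the obstacle is that the pieces of a decomposed arc meet on the horizontal line
    through the centre, at points that need not become vertices. The source of an item therefore
    identifies its edge only for the first piece; from then on a flag keeps the program on the arc
    until the target of an item is the target of the edge. *)

Definition cyclic3 (p q r : R) : Prop :=
  p < q < r \/ q < r < p \/ r < p < q.

(** The product is invariant under cyclic shifts of its arguments and changes sign under a swap, so
    its sign is the cyclic orientation of three reals. *)
Lemma vandermonde3_pos (p q r : R) :
  0 < (q - p) * (r - q) * (r - p) <-> cyclic3 p q r.
Proof.
unfold cyclic3; split.
- intros H.
  destruct (Rtotal_order p q) as [h|[h|h]];
  destruct (Rtotal_order q r) as [h'|[h'|h']];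
  destruct (Rtotal_order p r) as [h''|[h''|h'']];
  try (subst; exfalso; lra);
  try (first [left; lra | right; left; lra | right; right; lra]); exfalso.
  + assert (0 < (q - p) * (q - r)) by nra; nra.
  + assert (0 < (p - q) * (r - q)) by nra; nra.
  + assert (0 < (p - q) * (q - r)) by nra; nra.
- intros [H|[H|H]].
  + apply Rmult_lt_0_compat; [apply Rmult_lt_0_compat|]; lra.
  + replace ((q - p) * (r - q) * (r - p)) with ((p - q) * (r - q) * (p - r)) by ring.
    apply Rmult_lt_0_compat; [apply Rmult_lt_0_compat|]; lra.
  + replace ((q - p) * (r - q) * (r - p)) with ((q - p) * (q - r) * (p - r)) by ring.
    apply Rmult_lt_0_compat; [apply Rmult_lt_0_compat|]; lra.
Qed.

Ltac cyclic :=
  unfold cyclic3 in *; intuition (try lra);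
  first [left; lra | right; left; lra | right; right; lra].

Lemma cyclic3_rot (p q r : R) : cyclic3 p q r <-> cyclic3 q r p.
Proof. unfold cyclic3; tauto. Qed.

Lemma orient_rot (a b c : point) : orient a b c = orient b c a.
Proof. unfold orient, cross, sub; simpl; ring. Qed.

Lemma dist2_eq0 (p q : point) : dist2 p q = 0 <-> p = q.
Proof.
unfold dist2; destruct p as [a b], q as [c d]; simpl; split.
- intros H. pose proof (Rle_0_sqr (a - c)) as H1.
  pose proof (Rle_0_sqr (b - d)) as H2. unfold Rsqr in *.
  assert (h1 : (a - c) * (a - c) = 0) by lra.
  assert (h2 : (b - d) * (b - d) = 0) by lra.
  apply Rmult_integral in h1; apply Rmult_integral in h2.
  f_equal; lra.
- intros [= -> ->]; ring.
Qed.

Lemma dist2_nonneg (p q : point) : 0 <= dist2 p q.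
Proof.
unfold dist2; pose proof (Rle_0_sqr (fst p - fst q)).
pose proof (Rle_0_sqr (snd p - snd q)); unfold Rsqr in *; lra.
Qed.

(** The tangent of the angle from [o - a] to [x - a]; on the circle of centre [o]
    through [a] that angle stays strictly between [- PI / 2] and [PI / 2]. *)
Definition slope (o a x : point) : R :=
  cross (sub o a) (sub x a) /
  ((fst o - fst a) * (fst x - fst a) + (snd o - snd a) * (snd x - snd a)).

(** With N = o - a and X = x - a the circle condition reads |X|^2 = 2 N.X. If D and E are the dot
    and cross products of N and X, and N' is N turned by a right angle, then |N|^2 X = D N + E N'.
    Lagrange's identity D^2 + E^2 = |N|^2 |X|^2 turns D / |N|^2 into 2 / (1 + g^2) for g = E / D. *)
Lemma circle_param (o a x : point) :
  dist2 o x = dist2 o a -> x <> a ->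
  let g := slope o a x in
  fst x = fst a + 2 / (1 + g * g) * (fst (sub o a) - g * snd (sub o a)) /\
  snd x = snd a + 2 / (1 + g * g) * (snd (sub o a) + g * fst (sub o a)).
Proof.
intros Hc Hx.
assert (Hd : 0 < dist2 x a).
{ destruct (dist2_nonneg x a) as [h|h]; [exact h|].
  exfalso; apply Hx, dist2_eq0; auto. }
unfold slope, dist2, cross, sub in *; cbn -[Rmult Rplus Rminus Rdiv].
destruct o as [o1 o2], a as [a1 a2], x as [x1 x2]; cbn [fst snd] in *.
assert (HN : exists N1 N2, o1 = a1 + N1 /\ o2 = a2 + N2)
  by (exists (o1 - a1), (o2 - a2); lra).
assert (HX : exists X1 X2, x1 = a1 + X1 /\ x2 = a2 + X2)
  by (exists (x1 - a1), (x2 - a2); lra).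
destruct HN as (N1 & N2 & -> & ->), HX as (X1 & X2 & -> & ->).
replace (a1 + N1 - a1) with N1 by ring.
replace (a2 + N2 - a2) with N2 by ring.
replace (a1 + X1 - a1) with X1 in * by ring.
replace (a2 + X2 - a2) with X2 in * by ring.
set (D := N1 * X1 + N2 * X2).
set (E := N1 * X2 - N2 * X1).
assert (HD : X1 * X1 + X2 * X2 = 2 * D) by (unfold D; lra).
assert (HD0 : 0 < D) by lra.
assert (HL : D * D + E * E = (N1 * N1 + N2 * N2) * (2 * D))
  by (rewrite <- HD; unfold D, E; ring).
assert (Hn : 0 < N1 * N1 + N2 * N2) by nra.
assert (Hg : 2 / (1 + E / D * (E / D)) = D / (N1 * N1 + N2 * N2)).
{ replace (1 + E / D * (E / D)) with ((D * D + E * E) / (D * D)) by (field; lra).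
  rewrite HL. field. split; lra. }
rewrite Hg.
split.
- replace (D / (N1 * N1 + N2 * N2) * (N1 - E / D * N2))
    with ((D * N1 - E * N2) / (N1 * N1 + N2 * N2)) by (field; split; lra).
  replace (D * N1 - E * N2) with (X1 * (N1 * N1 + N2 * N2))
    by (unfold D, E; ring).
  field; lra.
- replace (D / (N1 * N1 + N2 * N2) * (N2 + E / D * N1))
    with ((D * N2 + E * N1) / (N1 * N1 + N2 * N2)) by (field; split; lra).
  replace (D * N2 + E * N1) with (X2 * (N1 * N1 + N2 * N2))
    by (unfold D, E; ring).
  field; lra.
Qed.

(** Over the denominators 1 + g^2 the coordinates are quadratic in the slopes, and the determinant
    left is that of the rows (1, g, g^2). The weight is 4 r^2 divided by the three denominators. *)
Lemma orient_slope3 (o a x y z : point) :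
  dist2 o x = dist2 o a -> dist2 o y = dist2 o a -> dist2 o z = dist2 o a ->
  x <> a -> y <> a -> z <> a ->
  exists w, 0 <= w /\ (dist2 o a <> 0 -> 0 < w) /\
    orient x y z = w * ((slope o a y - slope o a x) * (slope o a z - slope o a y)
                        * (slope o a z - slope o a x)).
Proof.
intros Hx Hy Hz nx ny nz.
destruct (circle_param _ _ _ Hx nx) as [x1 x2].
destruct (circle_param _ _ _ Hy ny) as [y1 y2].
destruct (circle_param _ _ _ Hz nz) as [z1 z2].
revert x1 x2 y1 y2 z1 z2.
generalize (slope o a x) as g1, (slope o a y) as g2, (slope o a z) as g3.
intros g1 g2 g3 x1 x2 y1 y2 z1 z2.
assert (0 < 1 + g1 * g1) by nra.
assert (0 < 1 + g2 * g2) by nra.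
assert (0 < 1 + g3 * g3) by nra.
pose proof (dist2_nonneg o a).
exists (4 * dist2 o a / ((1 + g1 * g1) * (1 + g2 * g2) * (1 + g3 * g3))).
assert (0 < (1 + g1 * g1) * (1 + g2 * g2) * (1 + g3 * g3))
  by (apply Rmult_lt_0_compat; [apply Rmult_lt_0_compat|]; lra).
split; [|split].
- apply Rle_mult_inv_pos; lra.
- intros h; apply Rdiv_lt_0_compat; lra.
- unfold orient, cross, sub, dist2 in *; cbn [fst snd] in *.
  rewrite x1, x2, y1, y2, z1, z2. field. repeat split; lra.
Qed.

(** The base point is the limit of infinite slope; two of the three Vandermonde factors disappear
    there and one difference remains. *)
Lemma orient_slope2 (o a y z : point) :
  dist2 o y = dist2 o a -> dist2 o z = dist2 o a -> y <> a -> z <> a ->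
  exists w, 0 <= w /\ (dist2 o a <> 0 -> 0 < w) /\
    orient a y z = w * (slope o a z - slope o a y).
Proof.
intros Hy Hz ny nz.
destruct (circle_param _ _ _ Hy ny) as [y1 y2].
destruct (circle_param _ _ _ Hz nz) as [z1 z2].
revert y1 y2 z1 z2.
generalize (slope o a y) as g2, (slope o a z) as g3.
intros g2 g3 y1 y2 z1 z2.
assert (0 < 1 + g2 * g2) by nra.
assert (0 < 1 + g3 * g3) by nra.
pose proof (dist2_nonneg o a).
exists (4 * dist2 o a / ((1 + g2 * g2) * (1 + g3 * g3))).
assert (0 < (1 + g2 * g2) * (1 + g3 * g3))
  by (apply Rmult_lt_0_compat; lra).
split; [|split].
- apply Rle_mult_inv_pos; lra.
- intros h; apply Rdiv_lt_0_compat; lra.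
- unfold orient, cross, sub, dist2 in *; cbn [fst snd] in *.
  rewrite y1, y2, z1, z2. field. repeat split; lra.
Qed.

(** The circle cut open at [a] and traversed in the direction given by the sign
    of [sg]; [a] receives the least key. *)
Definition circle_key (o a : point) (sg : R) (x : point) : R :=
  if Req_dec_T (dist2 x a) 0 then 0 else exp (sg * slope o a x).

Lemma circle_key_base (o a : point) (sg : R) : circle_key o a sg a = 0.
Proof.
unfold circle_key; destruct (Req_dec_T _ _) as [h|h]; auto.
exfalso; apply h, dist2_eq0; auto.
Qed.

Lemma circle_key_other (o a x : point) (sg : R) :
  x <> a -> circle_key o a sg x = exp (sg * slope o a x).
Proof.
intros hx; unfold circle_key; destruct (Req_dec_T _ _) as [h|h]; auto.
apply dist2_eq0 in h; contradiction.
Qed.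

Lemma point_dec (x y : point) : {x = y} + {x <> y}.
Proof.
destruct (Req_dec_T (dist2 x y) 0) as [h|h].
- left; apply dist2_eq0; auto.
- right; intros ->; apply h, dist2_eq0; auto.
Qed.

Lemma circle_key_least (o a x : point) (sg : R) :
  x <> a -> circle_key o a sg a < circle_key o a sg x.
Proof.
intros hx; rewrite circle_key_base, circle_key_other; auto; apply exp_pos.
Qed.

Lemma circle_key_inj (o a x y : point) (sg : R) :
  sg <> 0 -> dist2 o x = dist2 o a -> dist2 o y = dist2 o a ->
  circle_key o a sg x = circle_key o a sg y -> x = y.
Proof.
intros hs hx hy h.
destruct (point_dec x a) as [->|nx]; destruct (point_dec y a) as [->|ny]; auto.
- pose proof (circle_key_least o a y sg ny); lra.
- pose proof (circle_key_least o a x sg nx); lra.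
- rewrite !circle_key_other in h by auto.
  apply exp_inv, Rmult_eq_reg_l in h; auto.
  destruct (circle_param _ _ _ hx nx) as [x1 x2].
  destruct (circle_param _ _ _ hy ny) as [y1 y2].
  destruct x, y; cbn [fst snd] in *; rewrite h in x1, x2; f_equal; congruence.
Qed.

Lemma exp_lt_iff (x y : R) : exp x < exp y <-> x < y.
Proof. split; [apply exp_lt_inv | apply exp_increasing]. Qed.

Lemma pos_scaled (w v : R) : 0 < w -> 0 < w * v <-> 0 < v.
Proof. intros hw; split; intros h; [|nra]. destruct (Rlt_le_dec 0 v); nra. Qed.

(** As the base has the least key, the cyclic order is just [circle_key o a sg y < circle_key o a sg
    z]. If [y] or [z] is the base, both sides are false. *)
Lemma orient_circle_key_base (o a y z : point) (sg : R) :
  dist2 o a <> 0 -> sg <> 0 ->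
  dist2 o y = dist2 o a -> dist2 o z = dist2 o a ->
  0 < orient a y z * sg <->
  cyclic3 (circle_key o a sg a) (circle_key o a sg y) (circle_key o a sg z).
Proof.
intros hr hs hy hz.
destruct (point_dec y a) as [->|ny].
{ split; [unfold orient, cross, sub; simpl; intros; exfalso; nra
         | unfold cyclic3; intuition lra]. }
destruct (point_dec z a) as [->|nz].
{ split; [unfold orient, cross, sub; simpl; intros; exfalso; nra
         | unfold cyclic3; intuition lra]. }
destruct (orient_slope2 _ _ _ _ hy hz ny nz) as (w & _ & hw & ->).
specialize (hw hr).
pose proof (circle_key_least o a y sg ny) as ly.
pose proof (circle_key_least o a z sg nz) as lz.
transitivity (circle_key o a sg y < circle_key o a sg z);
  [|cyclic].
rewrite !circle_key_other, exp_lt_iff by auto.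
replace (w * (slope o a z - slope o a y) * sg)
  with (w * (sg * slope o a z - sg * slope o a y)) by ring.
rewrite pos_scaled by auto; lra.
Qed.

Lemma orient_circle_key (o a x y z : point) (sg : R) :
  dist2 o a <> 0 -> sg <> 0 ->
  dist2 o x = dist2 o a -> dist2 o y = dist2 o a -> dist2 o z = dist2 o a ->
  0 < orient x y z * sg <->
  cyclic3 (circle_key o a sg x) (circle_key o a sg y) (circle_key o a sg z).
Proof.
intros hr hs hx hy hz.
destruct (point_dec x a) as [->|nx]; [apply orient_circle_key_base; auto|].
destruct (point_dec y a) as [->|ny].
{ rewrite orient_rot, cyclic3_rot; apply orient_circle_key_base; auto. }
destruct (point_dec z a) as [->|nz].
{ rewrite orient_rot, orient_rot, cyclic3_rot, cyclic3_rot.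
  apply orient_circle_key_base; auto. }
destruct (orient_slope3 _ _ _ _ _ hx hy hz nx ny nz) as (w & _ & hw & ->).
specialize (hw hr).
transitivity (cyclic3 (sg * slope o a x) (sg * slope o a y) (sg * slope o a z)).
- rewrite <- vandermonde3_pos.
  rewrite Rmult_assoc, pos_scaled by auto.
  (* Scaling the slopes by [sg] scales the Vandermonde product by the cube of [sg], whose sign is
     that of [sg]; the square makes up the difference. *)
  rewrite <- (pos_scaled (sg * sg)) by nra.
  match goal with |- 0 < ?u <-> 0 < ?v => replace v with u by ring end; tauto.
- unfold cyclic3; rewrite !circle_key_other, !exp_lt_iff by auto; tauto.
Qed.

(** The two equidistance conditions are linear in [o] with determinant twice the orientation; [e1]
    and [e2] are Cramer's rule. *)
Lemma circumcenter_unique (o a b c : point) :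
  orient a b c <> 0 -> dist2 o b = dist2 o a -> dist2 o c = dist2 o a ->
  circumcenter a b c = o.
Proof.
intros h hb hc.
assert (e1 : 2 * orient a b c * (fst o - fst a) =
  snd (sub c a) * (fst (sub b a) * fst (sub b a) + snd (sub b a) * snd (sub b a))
  - snd (sub b a) * (fst (sub c a) * fst (sub c a) + snd (sub c a) * snd (sub c a))).
{ destruct o as [o1 o2], a as [a1 a2], b as [b1 b2], c as [c1 c2].
  unfold dist2, orient, cross, sub in *; cbn [fst snd] in *.
  transitivity (2 * ((b1 - a1) * (c2 - a2) - (b2 - a2) * (c1 - a1)) * (o1 - a1)
    + (c2 - a2) * ((o1 - b1) * (o1 - b1) + (o2 - b2) * (o2 - b2)
                   - ((o1 - a1) * (o1 - a1) + (o2 - a2) * (o2 - a2)))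
    - (b2 - a2) * ((o1 - c1) * (o1 - c1) + (o2 - c2) * (o2 - c2)
                   - ((o1 - a1) * (o1 - a1) + (o2 - a2) * (o2 - a2))));
    [rewrite hb, hc; ring | ring]. }
assert (e2 : 2 * orient a b c * (snd o - snd a) =
  fst (sub b a) * (fst (sub c a) * fst (sub c a) + snd (sub c a) * snd (sub c a))
  - fst (sub c a) * (fst (sub b a) * fst (sub b a) + snd (sub b a) * snd (sub b a))).
{ destruct o as [o1 o2], a as [a1 a2], b as [b1 b2], c as [c1 c2].
  unfold dist2, orient, cross, sub in *; cbn [fst snd] in *.
  transitivity (2 * ((b1 - a1) * (c2 - a2) - (b2 - a2) * (c1 - a1)) * (o2 - a2)
    - (c1 - a1) * ((o1 - b1) * (o1 - b1) + (o2 - b2) * (o2 - b2)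
                   - ((o1 - a1) * (o1 - a1) + (o2 - a2) * (o2 - a2)))
    + (b1 - a1) * ((o1 - c1) * (o1 - c1) + (o2 - c2) * (o2 - c2)
                   - ((o1 - a1) * (o1 - a1) + (o2 - a2) * (o2 - a2))));
    [rewrite hb, hc; ring | ring]. }
unfold circumcenter; cbv zeta; rewrite <- e1, <- e2.
destruct o as [o1 o2]; cbn [fst snd]; f_equal; field; auto.
Qed.

(** * Keys of arcs and segments *)

(** [k] is injective on the carrier [M] (the line or circle of [e]) and orders
    the points of [e] as they are met. *)
Definition keyed (e : edge) (M : point -> Prop) (k : point -> R) : Prop :=
  (forall x y, M x -> M y -> k x = k y -> x = y) /\
  M (src e) /\ M (dst e) /\ k (src e) < k (dst e) /\
  (forall x, on_edge e x <-> M x /\ k (src e) <= k x <= k (dst e)) /\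
  (forall x y, before e x y <-> on_edge e x /\ on_edge e y /\ k x < k y).

(** Base [a] and direction [sg] may differ from those of the arc, which lets a subarc inherit the
    key of the whole. The orientation of [u], [c], [v] has the sign of [sg], so comparing sides with
    the appendix point amounts to testing the cyclic order of keys; between the keys of [u] and [v]
    that order becomes linear. *)
Lemma keyed_arc (o a : point) (sg : R) (u c v : point) :
  let M x := dist2 o x = dist2 o a in
  let k := circle_key o a sg in
  dist2 o a <> 0 -> sg <> 0 -> M u -> M c -> M v -> k u < k c < k v ->
  0 < orient u c v * sg /\ keyed (Edge u (Some c) v) M k.
Proof.
intros M k hr hs hu hc hv hk.
assert (hcyc : forall x y z, M x -> M y -> M z ->
          (0 < orient x y z * sg <-> cyclic3 (k x) (k y) (k z)))
  by (intros; apply orient_circle_key; auto).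
assert (hinj : forall x y, M x -> M y -> k x = k y -> x = y)
  by (intros x y; apply circle_key_inj; auto).
assert (ho : 0 < orient u c v * sg) by (apply hcyc; auto; left; auto).
split; [exact ho|].
assert (ho' : orient u c v <> 0) by (intros h; rewrite h in ho; lra).
assert (hcyc' : forall x y z, M x -> M y -> M z ->
          (0 < orient x y z * orient u c v <-> cyclic3 (k x) (k y) (k z))).
{ intros x y z hx hy hz; rewrite <- hcyc by auto.
  rewrite <- (pos_scaled (sg * sg)) by nra.
  replace (sg * sg * (orient x y z * orient u c v))
    with (orient u c v * sg * (orient x y z * sg)) by ring.
  apply pos_scaled; auto. }
assert (hcc : circumcenter u c v = o).
{ apply circumcenter_unique; auto; unfold M in *; congruence. }
assert (hon : forall x, on_edge (Edge u (Some c) v) x <->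
                M x /\ k u <= k x <= k v).
{ intros x; unfold on_edge; cbn [app src dst]; cbv zeta; rewrite hcc.
  split.
  - intros [h1 h2]. assert (hx : M x) by (unfold M in *; congruence).
    split; auto. destruct h2 as [->|[->|h2]]; [lra|lra|].
    apply hcyc' in h2; auto; unfold cyclic3 in h2; lra.
  - intros [hx h]. split; [unfold M in *; congruence|].
    destruct (Req_dec_T (k x) (k u)) as [h1|h1]; [left; auto|].
    destruct (Req_dec_T (k x) (k v)) as [h2|h2]; [right; left; auto|].
    right; right; apply hcyc'; auto; cyclic. }
split; [exact hinj|]. cbn [src dst].
split; [exact hu|]. split; [exact hv|]. split; [lra|]. split; [exact hon|].
intros x y; unfold before; cbn [app src dst].
split.
- intros (hx & hy & n & h). split; [auto|]; split; [auto|].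
  apply hon in hx; apply hon in hy. destruct hx as [mx hx], hy as [my hy].
  assert (k x <> k y) by (intros h'; apply n; auto).
  destruct h as [->|[->|h]]; [lra|lra|].
  apply hcyc' in h; auto; unfold cyclic3 in h; lra.
- intros (hx & hy & h). split; [auto|]; split; [auto|].
  split; [intros ->; lra|].
  apply hon in hx; apply hon in hy. destruct hx as [mx hx], hy as [my hy].
  destruct (Req_dec_T (k x) (k u)) as [h1|h1]; [left; auto|].
  destruct (Req_dec_T (k y) (k v)) as [h2|h2]; [right; left; auto|].
  right; right; apply hcyc'; auto; cyclic.
Qed.

Definition line_key (a b x : point) : R :=
  ((fst x - fst a) * (fst b - fst a) + (snd x - snd a) * (snd b - snd a))
  / dist2 a b.

Lemma line_key_at_param (a b : point) (t : R) :
  a <> b -> line_key a b (at_param a b t) = t.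
Proof.
intros h; assert (dist2 a b <> 0) by (rewrite dist2_eq0; auto).
unfold line_key, at_param, dist2 in *; cbn [fst snd]; field; auto.
Qed.

Lemma at_param_nested (a b : point) (s t r : R) :
  at_param (at_param a b s) (at_param a b t) r = at_param a b (s + r * (t - s)).
Proof. unfold at_param; cbn [fst snd]; f_equal; ring. Qed.

Lemma at_param_ends (a b : point) : at_param a b 0 = a /\ at_param a b 1 = b.
Proof.
destruct a, b; unfold at_param; cbn [fst snd]; split; f_equal; ring.
Qed.

Lemma keyed_segment (a b u v : point) :
  let M x := exists t, x = at_param a b t in
  let k := line_key a b in
  a <> b -> M u -> M v -> k u < k v -> keyed (Edge u None v) M k.
Proof.
intros M k hab [s ->] [t ->] hk; unfold k in hk.
rewrite !line_key_at_param in hk by auto.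
assert (hinj : forall x y, M x -> M y -> k x = k y -> x = y).
{ intros x y [p ->] [q ->]; unfold k; rewrite !line_key_at_param by auto.
  congruence. }
assert (hM : forall r, M (at_param a b r)) by (intros r; exists r; auto).
assert (hon : forall x, on_edge (Edge (at_param a b s) None (at_param a b t)) x <->
                M x /\ s <= k x <= t).
{ intros x; unfold on_edge; cbn [app src dst]; split.
  - intros (r & h & ->); rewrite at_param_nested; split; auto.
    unfold k; rewrite line_key_at_param by auto; nra.
  - intros [[r ->] h]; unfold k in h; rewrite line_key_at_param in h by auto.
    exists ((r - s) / (t - s)); split.
    + split; [apply Rle_mult_inv_pos; lra|].
      apply Rmult_le_reg_r with (t - s); [lra|].
      unfold Rdiv; rewrite Rmult_assoc, Rinv_l by lra; lra.
    + rewrite at_param_nested; f_equal; field; lra. }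
split; [exact hinj|]; cbn [src dst].
assert (hk' : forall r, k (at_param a b r) = r)
  by (intros r; apply line_key_at_param; auto).
rewrite !hk'.
split; [auto|]; split; [auto|]; split; [auto|]; split; [exact hon|].
intros x y; unfold before; cbn [app src dst]; split.
- intros (hx & hy & p & q & hpq & -> & ->); split; [auto|]; split; [auto|].
  rewrite !at_param_nested; unfold k; rewrite !line_key_at_param by auto; nra.
- intros (hx & hy & h); split; [auto|]; split; [auto|].
  destruct hx as (p & hp & ->), hy as (q & hq & ->); exists p, q.
  cbn [app src dst] in *.
  rewrite !at_param_nested in h; unfold k in h.
  rewrite !line_key_at_param in h by auto.
  split; [nra|auto].
Qed.

(** With the orientation of the arc as direction, the product of the two is a square, so source,
    appendix point and target are in cyclic order; the least key at the source makes this order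
    linear. *)
Lemma arc_key (a c b : point) :
  orient a c b <> 0 ->
  let o := circumcenter a c b in
  let k := circle_key o a (orient a c b) in
  dist2 o c = dist2 o a /\ dist2 o b = dist2 o a /\ dist2 o a <> 0 /\
  k a < k c < k b.
Proof.
intros hv o k.
destruct (circumcenter_spec a c b hv) as [h1 h2]; fold o in h1, h2.
assert (nc : c <> a)
  by (intros ->; apply hv; unfold orient, cross, sub; simpl; ring).
assert (hr : dist2 o a <> 0).
{ intros h; apply nc; transitivity o; [symmetry|]; apply dist2_eq0; congruence. }
repeat split; auto; [apply circle_key_least; auto|].
pose proof (circle_key_least o a c (orient a c b) nc).
assert (h : cyclic3 (k a) (k c) (k b)) by (apply orient_circle_key; auto; nra).
unfold cyclic3 in h.
destruct (point_dec b a) as [->|nb]; [unfold k in *; lra|].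
pose proof (circle_key_least o a b (orient a c b) nb); unfold k in *; lra.
Qed.

Lemma valid_keyed (e : edge) :
  valid_edge e ->
  exists M k, keyed e M k /\
    forall u v e', on_edge e u -> on_edge e v -> k u < k v -> subedge e u v e' ->
      valid_edge e' /\ keyed e' M k.
Proof.
destruct e as [a [c|] b]; unfold valid_edge; cbn [app src dst]; intros hv.
- destruct (arc_key a c b hv) as (h1 & h2 & hr & hk).
  set (o := circumcenter a c b) in *. set (sg := orient a c b) in *.
  exists (fun x => dist2 o x = dist2 o a), (circle_key o a sg).
  destruct (keyed_arc o a sg a c b hr hv eq_refl h1 h2 hk) as [_ K].
  split; [exact K|].
  destruct K as (_ & _ & _ & _ & hon & hbef).
  intros u v [u' [c'|] v'] hu hv' hlt; unfold subedge; cbn [app src dst]; [|tauto].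
  intros (-> & -> & b1 & b2).
  apply hbef in b1; apply hbef in b2.
  destruct b1 as (_ & hc' & b1), b2 as (_ & _ & b2).
  apply hon in hu; apply hon in hv'; apply hon in hc'.
  destruct hu as [mu _], hv' as [mv _], hc' as [mc _].
  destruct (keyed_arc o a sg u c' v hr hv mu mc mv (conj b1 b2)) as [q K].
  split; [|exact K]. intros h; rewrite h in q; lra.
- exists (fun x => exists t, x = at_param a b t), (line_key a b).
  destruct (at_param_ends a b) as [e0 e1].
  assert (K : keyed (Edge a None b) (fun x => exists t, x = at_param a b t) (line_key a b)).
  { apply keyed_segment; auto; [exists 0; auto | exists 1; auto |].
    rewrite <- e0 at 2. rewrite <- e1 at 4.
    rewrite !line_key_at_param by auto; lra. }
  split; [exact K|].
  destruct K as (_ & _ & _ & _ & hon & _).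
  intros u v [u' [c'|] v'] hu hv' hlt; unfold subedge; cbn [app src dst]; [tauto|].
  intros (-> & -> & _).
  apply hon in hu; apply hon in hv'. cbn [src dst] in *.
  split; [unfold valid_edge; cbn; intros ->; lra|].
  apply keyed_segment; tauto.
Qed.

(** * Splitting an edge *)

(** Strictly between [u] and [p] on the arc from [u] through [c] to [z]: the
    direction [A |B|^2 - B |A|^2], with [A = c - u] and [B = z - u], is tangent
    to the arc at [u]; adding the chord [p - u] gives a direction [d] strictly
    between tangent and chord, and the line from [u] along [d] meets the circle
    again at [u + (|p - u|^2 / |d|^2) d]. *)
Definition appendix_dir (u c z p : point) : point :=
  let A := sub c u in
  let B := sub z u in
  let P := sub p u in
  let A2 := fst A * fst A + snd A * snd A in
  let B2 := fst B * fst B + snd B * snd B in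
  (fst P + (fst A * B2 - fst B * A2), snd P + (snd A * B2 - snd B * A2)).

Definition appendix (u c z p : point) : point :=
  let d := appendix_dir u c z p in
  let P := sub p u in
  let t := (fst P * fst P + snd P * snd P) / (fst d * fst d + snd d * snd d) in
  (fst u + t * fst d, snd u + t * snd d).

Lemma sum_sqr_pos (x y : R) : x <> 0 \/ y <> 0 -> 0 < x * x + y * y.
Proof.
intros [h|h]; pose proof (Rle_0_sqr x); pose proof (Rle_0_sqr y);
  unfold Rsqr in *; pose proof (Rsqr_pos_lt _ h); unfold Rsqr in *; lra.
Qed.

(** Write N = o - u and q = |P|^2. Every chord X from [u] satisfies |X|^2 = 2 N.X. Hence the tangent
    part of [d] is orthogonal to N, giving d.N = q / 2, which is the condition for the chosen
    multiple of [d] to lie on the circle. The same relation gives d x P = (A x B) q, so [d] is on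
    the correct side of the chord P. *)
Lemma appendix_on_circle (o u c z p : point) :
  orient u c z <> 0 ->
  dist2 o c = dist2 o u -> dist2 o z = dist2 o u -> dist2 o p = dist2 o u ->
  p <> u ->
  dist2 o (appendix u c z p) = dist2 o u /\
  0 < orient u (appendix u c z p) p * orient u c z.
Proof.
intros hs hc hz hp np.
destruct (appendix_dir u c z p) as [d1 d2] eqn:hd.
unfold appendix; rewrite hd; cbv zeta; cbn [fst snd].
unfold appendix_dir in hd; cbv zeta in hd; injection hd; clear hd.
assert (hP : 0 < (fst p - fst u) * (fst p - fst u) + (snd p - snd u) * (snd p - snd u)).
{ destruct (dist2_nonneg p u) as [h|h]; [exact h|].
  exfalso; apply np, dist2_eq0; auto. }
destruct o as [o1 o2], u as [u1 u2], c as [c1 c2], z as [z1 z2], p as [p1 p2].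
unfold orient, cross, sub, dist2 in *; cbn [fst snd] in *.
assert (HN : exists N1 N2, o1 = u1 + N1 /\ o2 = u2 + N2)
  by (exists (o1 - u1), (o2 - u2); lra).
assert (HA : exists A1 A2, c1 = u1 + A1 /\ c2 = u2 + A2)
  by (exists (c1 - u1), (c2 - u2); lra).
assert (HB : exists B1 B2, z1 = u1 + B1 /\ z2 = u2 + B2)
  by (exists (z1 - u1), (z2 - u2); lra).
assert (HP : exists P1 P2, p1 = u1 + P1 /\ p2 = u2 + P2)
  by (exists (p1 - u1), (p2 - u2); lra).
destruct HN as (N1 & N2 & -> & ->), HA as (A1 & A2 & -> & ->),
  HB as (B1 & B2 & -> & ->), HP as (P1 & P2 & -> & ->).
assert (S : forall x y : R, x + y - x = y) by (intros; ring).
rewrite !S in *.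
intros e2 e1.
set (q := P1 * P1 + P2 * P2) in *.
assert (hA : A1 * A1 + A2 * A2 = 2 * (N1 * A1 + N2 * A2)) by lra.
assert (hB : B1 * B1 + B2 * B2 = 2 * (N1 * B1 + N2 * B2)) by lra.
assert (hq : q = 2 * (N1 * P1 + N2 * P2)) by (unfold q; lra).
assert (hx : d1 * P2 - d2 * P1 = (A1 * B2 - A2 * B1) * q).
{ rewrite <- e1, <- e2, hA, hB, hq; ring. }
assert (hn : d1 * N1 + d2 * N2 = q / 2).
{ rewrite <- e1, <- e2.
  transitivity (N1 * P1 + N2 * P2 + ((N1 * A1 + N2 * A2) * (B1 * B1 + B2 * B2)
     - (N1 * B1 + N2 * B2) * (A1 * A1 + A2 * A2))); [ring|].
  rewrite hA, hB, hq; field. }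
(* If [d] vanished, [hx] would equate to zero the product of the nonzero orientation and the squared
   chord. *)
assert (hd : 0 < d1 * d1 + d2 * d2).
{ apply sum_sqr_pos.
  destruct (Req_dec_T d1 0) as [->|h]; [right; intros ->|left; exact h].
  rewrite !Rmult_0_l, Rminus_0_r in hx. symmetry in hx.
  apply Rmult_integral in hx; destruct hx; lra. }
set (n := d1 * d1 + d2 * d2) in *.
split.
- transitivity (N1 * N1 + N2 * N2 + (q / n) * (q / n * n - 2 * (d1 * N1 + d2 * N2)));
    [unfold n; field; fold n; lra|].
  rewrite hn; field; lra.
- replace ((q / n * d1 * P2 - q / n * d2 * P1) * (A1 * B2 - A2 * B1))
    with ((q / n) * ((d1 * P2 - d2 * P1) * (A1 * B2 - A2 * B1))) by ring.
  rewrite hx.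
  apply Rmult_lt_0_compat; [apply Rdiv_lt_0_compat; lra|].
  replace ((A1 * B2 - A2 * B1) * q * (A1 * B2 - A2 * B1))
    with (q * ((A1 * B2 - A2 * B1) * (A1 * B2 - A2 * B1))) by ring.
  apply Rmult_lt_0_compat; auto. pose proof (Rsqr_pos_lt _ hs); auto.
Qed.

Definition left_part (e : edge) (p : point) : edge :=
  Edge (src e) (option_map (fun c => appendix (src e) c (dst e) p) (app e)) p.

(** The appendix point is found by travelling backwards from [dst e]. *)
Definition right_part (e : edge) (p : point) : edge :=
  Edge p (option_map (fun c => appendix (dst e) c (src e) p) (app e)) (dst e).

Lemma parts_subedge (e : edge) (p : point) :
  valid_edge e -> inside_edge e p ->
  subedge e (src e) p (left_part e p) /\ subedge e p (dst e) (right_part e p).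
Proof.
destruct e as [a [c|] b]; unfold valid_edge, left_part, right_part, subedge;
  cbn [app src dst option_map]; [|repeat split].
intros hv (hp & na & nb); cbn [src dst] in *.
destruct (arc_key a c b hv) as (h1 & h2 & hr & hk).
assert (hv' : orient b c a <> 0).
{ replace (orient b c a) with (- orient a c b)
    by (unfold orient, cross, sub; simpl; ring); lra. }
set (o := circumcenter a c b) in *.
assert (hpc : dist2 o p = dist2 o a) by apply hp.
destruct (appendix_on_circle o a c b p) as [m1 c1]; auto.
destruct (appendix_on_circle o b c a p) as [m2 c2]; auto; try congruence.
set (w1 := appendix a c b p) in *; set (w2 := appendix b c a p) in *.
set (sg := orient a c b) in *.
(* Travelling backwards changes the sign of both orientations and leaves their product alone. *)
assert (c2' : 0 < orient p w2 b * sg).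
{ replace (orient p w2 b * sg) with (orient b w2 p * orient b c a); auto.
  unfold sg, orient, cross, sub; simpl; ring. }
clearbody w1 w2.
set (k := circle_key o a sg) in *.
assert (hcyc : forall x y z, dist2 o x = dist2 o a -> dist2 o y = dist2 o a ->
          dist2 o z = dist2 o a ->
          (0 < orient x y z * sg <-> cyclic3 (k x) (k y) (k z)))
  by (intros; apply orient_circle_key; auto).
destruct (keyed_arc o a sg a c b hr hv eq_refl h1 h2 hk) as [_ K].
destruct K as (hinj & _ & _ & _ & hon & hbef); fold k in hinj, hon, hbef.
cbn [src dst] in *.
assert (hp' := hp); apply hon in hp'; destruct hp' as [_ hp'].
assert (k p <> k a) by (intros h; apply na, hinj; auto).
assert (k p <> k b) by (intros h; apply nb, hinj; auto; congruence).
apply hcyc in c1; auto; try congruence.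
apply hcyc in c2'; auto; try congruence.
(* A cyclic order whose first member has the least key is linear. *)
assert (k1 : k a < k w1 < k p).
{ destruct (point_dec w1 a) as [->|n]; [unfold cyclic3 in c1; lra|].
  pose proof (circle_key_least o a w1 sg n); fold k in H1.
  unfold cyclic3 in c1; lra. }
assert (k2 : k p < k w2 < k b).
{ destruct (point_dec w2 a) as [->|n]; [unfold cyclic3 in c2'; lra|].
  pose proof (circle_key_least o a w2 sg n); fold k in H1.
  unfold cyclic3 in c2'; lra. }
assert (m2' : dist2 o w2 = dist2 o a) by congruence.
assert (hb : forall x y, dist2 o x = dist2 o a -> dist2 o y = dist2 o a ->
          k a <= k x -> k x < k y -> k y <= k b ->
          before {| src := a; app := Some c; dst := b |} x y).
{ intros x y mx my ? ? ?; apply hbef; repeat split; try apply hon; try split; auto;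
  lra. }
split; (split; [reflexivity|]; split; [reflexivity|]);
  split; apply hb; auto; lra.
Qed.

Lemma keyed_inside (e : edge) (M : point -> Prop) (k : point -> R) (x : point) :
  keyed e M k -> inside_edge e x <-> M x /\ k (src e) < k x < k (dst e).
Proof.
intros (hinj & ms & md & hsd & hon & _); unfold inside_edge; rewrite hon; split.
- intros ([m h] & n1 & n2); split; auto.
  assert (k x <> k (src e)) by (intros h'; apply n1, hinj; auto).
  assert (k x <> k (dst e)) by (intros h'; apply n2, hinj; auto). lra.
- intros [m h]; split; [split; auto; lra|]; split; intros ->; lra.
Qed.

Lemma keyed_ends (e : edge) (M : point -> Prop) (k : point -> R) :
  keyed e M k -> on_edge e (src e) /\ on_edge e (dst e).
Proof.
intros (_ & ms & md & h & hon & _); split; apply hon; split; auto; lra.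
Qed.

Lemma subedge_refl (e : edge) : valid_edge e -> subedge e (src e) (dst e) e.
Proof.
intros hv; unfold subedge; split; [auto|]; split; [auto|].
destruct e as [a [c|] b]; cbn [app src dst]; auto.
destruct (arc_key a c b hv) as (h1 & h2 & hr & hk).
destruct (keyed_arc _ _ _ a c b hr hv eq_refl h1 h2 hk)
  as [_ (hinj & _ & _ & _ & hon & hbef)]; cbn [src dst] in *.
split; apply hbef; repeat split; try (apply hon; split; auto; lra); lra.
Qed.

(** The last edge is kept apart because only it can be split by further points. This makes [cut]
    compose over concatenated lists, as is needed when the points of one arc arrive in several
    items. *)
Fixpoint cut (e : edge) (pts : list point) : list edge * edge :=
  match pts with
  | [] => ([], e)
  | p :: pts' =>
      if point_dec p (src e) then cut e pts'
      else if point_dec p (dst e) then cut e pts'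
      else let r := cut (right_part e p) pts' in (left_part e p :: fst r, snd r)
  end.

Definition cut_all (e : edge) (pts : list point) : list edge :=
  fst (cut e pts) ++ [snd (cut e pts)].

(** Under a common key, [before] on [f] is the restriction of [before] on [e] to a subinterval of
    keys. *)
Lemma subedge_trans (e f f' : edge) (M : point -> Prop) (k : point -> R) (u v : point) :
  keyed e M k -> keyed f M k -> (app e = None <-> app f = None) ->
  k (src e) <= k (src f) -> k (dst f) <= k (dst e) ->
  subedge f u v f' -> subedge e u v f'.
Proof.
intros (_ & _ & _ & _ & hon & hb) (_ & _ & _ & _ & hon' & hb') ha h1 h2.
assert (hbb : forall x y, before f x y -> before e x y).
{ intros x y h; apply hb' in h; destruct h as (hx & hy & h).
  apply hon' in hx; apply hon' in hy; apply hb; rewrite !hon.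
  intuition lra. }
unfold subedge; intros (s & d & h); split; [auto|]; split; [auto|].
destruct (app e), (app f), (app f'); auto;
  try (exfalso; destruct ha as [ha ha']; (discriminate (ha eq_refl) || discriminate (ha' eq_refl)));
  destruct h; auto.
Qed.

(** The induction runs over a tail [e] of [e0] with the same target. Weak sorting puts all later
    points on the right part. The last clause is stronger than subdivision at no points, which would
    allow another appendix point; an edge without points has to come back unchanged. *)
Lemma cut_all_subdivision (e0 : edge) (M : point -> Prop) (k : point -> R) :
  keyed e0 M k ->
  (forall u v e', on_edge e0 u -> on_edge e0 v -> k u < k v -> subedge e0 u v e' ->
     valid_edge e' /\ keyed e' M k) ->
  forall pts e,
  on_edge e0 (src e) -> k (src e) < k (dst e0) -> subedge e0 (src e) (dst e0) e ->
  Forall (on_edge e) pts -> StronglySorted (fun x y => k x <= k y) pts ->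
  exists l, StronglySorted (before e0) l /\
    subdivision_from e0 (src e) l (cut_all e pts) /\
    (forall x, In x l <-> In x pts /\ inside_edge e x) /\
    (l = [] -> cut_all e pts = [e]).
Proof.
intros K0 hsub; induction pts as [|p pts IH]; intros e hs hlt hse hon hsort.
- exists []; unfold cut_all; cbn; split; [constructor|]; split; [auto|].
  split; [tauto|auto].
- inversion hon as [|? ? onp hon']; subst; inversion hsort as [|? ? hsort' hp]; subst.
  unfold cut_all; cbn [cut].
  destruct (point_dec p (src e)) as [ep|np].
  { destruct (IH e hs hlt hse hon' hsort') as (l & l1 & l2 & l3 & l4).
    exists l; split; [auto|]; split; [auto|]; split; [|auto].
    intros x; rewrite l3; cbn; split; [tauto|].
    intros [[<-|h] hi]; [exfalso; destruct hi as (_ & h & _); auto|auto]. }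
  destruct (point_dec p (dst e)) as [ep|np'].
  { destruct (IH e hs hlt hse hon' hsort') as (l & l1 & l2 & l3 & l4).
    exists l; split; [auto|]; split; [auto|]; split; [|auto].
    intros x; rewrite l3; cbn; split; [tauto|].
    intros [[<-|h] hi]; [exfalso; destruct hi as (_ & _ & h); auto|auto]. }
  assert (ed : dst e = dst e0) by apply hse.
  destruct (keyed_ends _ _ _ K0) as [_ ond].
  destruct (hsub _ _ _ hs ond hlt hse) as [hv K].
  assert (hin : inside_edge e p) by (repeat split; auto).
  destruct (parts_subedge e p hv hin) as [sl sr].
  assert (ha : app e0 = None <-> app e = None).
  { destruct hse as (_ & _ & h); destruct (app e0), (app e); try tauto;
    split; intros; discriminate. }
  assert (hks : k (src e0) <= k (src e)) by (apply K0 in hs; tauto).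
  assert (sl0 := subedge_trans e0 e _ M k _ _ K0 K ha hks (Req_le _ _ (f_equal k ed)) sl).
  assert (sr0 := subedge_trans e0 e _ M k _ _ K0 K ha hks (Req_le _ _ (f_equal k ed)) sr).
  rewrite ed in sr0.
  assert (hin' := proj1 (keyed_inside _ _ _ _ K) hin). rewrite ed in hin'.
  assert (onp0 : on_edge e0 p) by (apply K0; split; [tauto|lra]).
  assert (hlp : k p < k (dst e0)) by lra.
  destruct (hsub _ _ _ onp0 ond hlp sr0) as [hvr Kr].
  assert (honr : forall x, M x -> k p <= k x -> k x <= k (dst e0) ->
                   on_edge (right_part e p) x).
  { intros x mx h1 h2; apply Kr; cbn [right_part src dst]; rewrite ed; auto. }
  destruct (IH (right_part e p)) as (l & l1 & l2 & l3 & l4); auto.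
  { rewrite Forall_forall in *; intros x hx.
    pose proof (hp x hx); pose proof (hon' x hx) as ox. apply K in ox.
    rewrite ed in ox; destruct ox as [mx ox]; apply honr; auto; lra. }
  cbn [right_part src] in l2.
  assert (hl : forall x, In x l -> In x pts /\ M x /\ k p < k x < k (dst e0)).
  { intros x hx; apply l3 in hx; destruct hx as [hx1 hx2].
    rewrite (keyed_inside _ _ _ _ Kr) in hx2; cbn [right_part src dst] in hx2.
    rewrite ed in hx2; auto. }
  exists (p :: l); split; [|split; [|split]].
  + constructor; auto. apply Forall_forall; intros x hx.
    destruct (hl x hx) as (_ & mx & h). apply K0; repeat split; auto; try lra.
    apply K0; split; auto; lra.
  + cbn; split; auto.
  + intros x; split.
    * intros [<-|hx]; [split; [left; auto|auto]|].
      destruct (hl x hx) as (hx1 & mx & h); split; [right; auto|].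
      apply (keyed_inside _ _ _ _ K); rewrite ed; split; auto; lra.
    * intros [[<-|hx] hi]; [left; auto|].
      apply (keyed_inside _ _ _ _ K) in hi; rewrite ed in hi.
      rewrite Forall_forall in hp; specialize (hp x hx).
      (* By injectivity a later point with the key of [p] is [p] again: it is the source of the
         right part and causes no second cut. *)
      destruct (Req_dec_T (k x) (k p)) as [h|h];
        [left; apply K0; [tauto|tauto|auto]|].
      right; apply l3; split; auto.
      apply (keyed_inside _ _ _ _ Kr); cbn [right_part src dst]; rewrite ed.
      split; [tauto|lra].
  + discriminate.
Qed.

(** * Points listed for the pieces of one edge *)

Lemma listed_along_keys (e : edge) (M : point -> Prop) (k : point -> R)
    (A : point -> Prop) (l : list point) :
  keyed e M k -> listed_along e A l ->
  StronglySorted (fun x y => k x < k y) l.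
Proof.
intros (_ & _ & _ & _ & _ & hb) [hl _].
induction hl as [|x l hs IH hf]; constructor; auto.
rewrite Forall_forall in *; intros y hy; apply hb; auto.
Qed.

Lemma sorted_keys_NoDup (k : point -> R) (l : list point) :
  StronglySorted (fun x y => k x < k y) l -> NoDup l.
Proof.
induction 1 as [|x l hs IH hf]; constructor; auto.
intros h; rewrite Forall_forall in hf; specialize (hf x h); lra.
Qed.

Lemma StronglySorted_app {T : Type} (r : T -> T -> Prop) (l1 l2 : list T) :
  StronglySorted r l1 -> StronglySorted r l2 ->
  (forall x y, In x l1 -> In y l2 -> r x y) -> StronglySorted r (l1 ++ l2).
Proof.
intros h1 h2 h; induction h1 as [|x l hs IH hf]; cbn; auto.
constructor; [apply IH; intros; apply h; cbn; auto|].
apply Forall_app; split; auto.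
apply Forall_forall; intros y hy; apply h; cbn; auto.
Qed.

Lemma StronglySorted_impl {T : Type} (r r' : T -> T -> Prop) (l : list T) :
  (forall x y, r x y -> r' x y) -> StronglySorted r l -> StronglySorted r' l.
Proof.
intros h; induction 1 as [|x l hs IH hf]; constructor; auto.
eapply Forall_impl; [|exact hf]; auto.
Qed.

(** The first item with target [z] is also the last item: this is how the program recognises the end
    of the pieces of an edge. *)
Fixpoint ends_at (z : point) (its : list item) : Prop :=
  match its with
  | [] => False
  | it :: its' =>
      (its' = [] /\ dst (item_edge it) = z) \/
      (its' <> [] /\ dst (item_edge it) <> z /\ ends_at z its')
  end.

Definition starts_at (a : point) (its : list item) : Prop :=
  match its with [] => False | it :: _ => src (item_edge it) = a end.

(** Each piece has the key of [e], so its list consists of the boundary points of [Q] whose keys lie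
    between those of its ends, and these intervals are adjacent. Cut points have keys below that of
    [dst e], which is why no earlier piece ends there. *)
Lemma pieces_points (Q : polygon) (t : nat) (e : edge) (M : point -> Prop) (k : point -> R) :
  keyed e M k ->
  (forall u v e', on_edge e u -> on_edge e v -> k u < k v -> subedge e u v e' ->
     valid_edge e' /\ keyed e' M k) ->
  forall l q pieces its,
  on_edge e q -> k q < k (dst e) ->
  StronglySorted (fun x y => k x < k y) l ->
  (forall x, In x l -> on_edge e x /\ k q < k x < k (dst e)) ->
  subdivision_from e q l pieces -> Forall2 (item_for Q t) pieces its ->
  length its = S (length l) /\ starts_at q its /\ ends_at (dst e) its /\
  StronglySorted (fun x y => k x <= k y) (concat (map item_points its)) /\
  (forall x, In x (concat (map item_points its)) <->
     on_edge e x /\ k q <= k x /\ on_boundary Q x) /\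
  Forall (fun it => NoDup (item_points it)) its.
Proof.
intros K hsub.
assert (piece : forall u v e' it, on_edge e u -> on_edge e v -> k u < k v ->
  subedge e u v e' -> item_for Q t e' it ->
  src (item_edge it) = u /\ dst (item_edge it) = v /\
  StronglySorted (fun x y => k x < k y) (item_points it) /\
  (forall x, In x (item_points it) <->
     on_edge e x /\ k u <= k x <= k v /\ on_boundary Q x)).
{ intros u v e' it hu hv hlt hs (i1 & i2 & i3).
  destruct (hsub _ _ _ hu hv hlt hs) as [_ K'].
  destruct hs as (s1 & s2 & _). rewrite i1.
  split; [auto|]; split; [auto|].
  split; [eapply listed_along_keys; eauto|].
  intros x; rewrite (proj2 i3 x).
  destruct K' as (_ & _ & _ & _ & hon' & _); rewrite hon', s1, s2.
  destruct K as (_ & _ & _ & _ & hon & _).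
  apply hon in hu; apply hon in hv; rewrite hon; intuition lra. }
destruct (keyed_ends _ _ _ K) as [_ ond].
induction l as [|v l IH]; intros q pieces its hq hlt hsort hl hdiv hits.
- destruct pieces as [|e' [|? ?]]; cbn in hdiv; try tauto.
  inversion hits as [|? it ? ? hit hnil]; subst; inversion hnil; subst.
  destruct (piece q (dst e) e' it hq ond hlt hdiv hit) as (i1 & i2 & i3 & i4).
  cbn; rewrite app_nil_r.
  split; [auto|]; split; [auto|]; split; [auto|].
  split; [eapply StronglySorted_impl; [|exact i3]; intros; cbn in *; lra|].
  split; [|constructor; [eapply sorted_keys_NoDup; eauto|constructor]].
  intros x; rewrite i4; destruct K as (_ & _ & _ & _ & hon & _); rewrite hon.
  intuition lra.
- destruct pieces as [|e' pieces]; cbn in hdiv; [tauto|]; destruct hdiv as [hd hdiv].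
  inversion hits as [|? it ? its' hit hits']; subst.
  inversion hsort as [|? ? hsort' hf]; subst; rewrite Forall_forall in hf.
  destruct (hl v (or_introl eq_refl)) as [onv hv].
  destruct (piece q v e' it hq onv (proj1 hv) hd hit) as (i1 & i2 & i3 & i4).
  destruct (IH v pieces its' onv (proj2 hv) hsort') as (j1 & j2 & j3 & j4 & j5 & j6); auto.
  { intros x hx; split; [apply hl; cbn; auto|].
    split; [apply hf; auto|apply hl; cbn; auto]. }
  cbn [length map concat starts_at ends_at]. cbn.
  split; [lia|]; split; [auto|]; split.
  { right; split; [destruct its'; [cbn in j2; tauto|discriminate]|].
    split; auto. rewrite i2; intros ->; lra. }
  split; [|split].
  + apply StronglySorted_app; auto.
    * eapply StronglySorted_impl; [|exact i3]; intros; cbn in *; lra.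
    * intros x y hx hy; apply i4 in hx; apply j5 in hy; lra.
  + intros x; rewrite in_app_iff, i4, j5.
    destruct (Rle_lt_dec (k x) (k v)); intuition lra.
  + constructor; auto; eapply sorted_keys_NoDup; eauto.
Qed.

(** Two different points of the circle at the height of its centre are opposite to each other; three
    cannot be pairwise opposite. *)
Lemma center_line_points (e : edge) (l : list point) :
  NoDup l -> (forall x, In x l -> inside_edge e x /\ on_center_line e x) ->
  (length l <= 2)%nat.
Proof.
intros hd hl.
destruct l as [|x [|y [|z l]]]; cbn; try lia; exfalso.
pose proof (hl x (or_introl eq_refl)) as hx.
pose proof (hl y (or_intror (or_introl eq_refl))) as hy.
pose proof (hl z (or_intror (or_intror (or_introl eq_refl)))) as hz.
inversion hd as [|? ? n1 hd1]; subst; inversion hd1 as [|? ? n2 _]; subst.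
cbn in n1, n2.
unfold inside_edge, on_edge, on_center_line in *.
destruct (app e) as [c|]; [|tauto].
destruct hx as [[[hx _] _] hx'], hy as [[[hy _] _] hy'], hz as [[[hz _] _] hz'].
set (o := circumcenter (src e) c (dst e)) in *.
assert (E : forall a b : point, dist2 o a = dist2 o (src e) -> dist2 o b = dist2 o (src e) ->
  snd a = snd o -> snd b = snd o -> a <> b -> fst a - fst o = - (fst b - fst o)).
{ intros [a1 a2] [b1 b2] ha hb h1 h2 n; cbn [fst snd] in *; subst.
  rewrite <- hb in ha; unfold dist2 in ha; cbn [fst snd] in ha.
  assert (h : (a1 - b1) * (a1 + b1 - 2 * fst o) = 0) by lra.
  apply Rmult_integral in h; destruct h; [exfalso; apply n; f_equal; lra|lra]. }
assert (exy := E x y hx hy hx' hy').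
assert (exz := E x z hx hz hx' hz').
assert (x <> y) by (intros ->; tauto). assert (x <> z) by (intros ->; tauto).
apply n2; left; destruct y, z; cbn [fst snd] in *; f_equal; try congruence.
specialize (exy H); specialize (exz H0); lra.
Qed.

(** Measures the running time of the item loop: one unit for each item and one for each listed
    point. *)
Definition weight (S : list item) : nat :=
  list_sum (map (fun it => 1 + length (item_points it))%nat S).

Lemma weight_bound (its : list item) (L : list point) :
  Forall (fun it => NoDup (item_points it)) its ->
  (forall x, In x (concat (map item_points its)) -> In x L) ->
  (weight its <= length its * (1 + length L))%nat.
Proof.
intros hn; induction hn as [|it its h _ IH]; intros hin; [cbn; auto|].
change (weight (it :: its)) with (1 + length (item_points it) + weight its)%nat.
assert (length (item_points it) <= length L)%nat.
{ apply NoDup_incl_length; auto; intros x hx; apply hin; cbn.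
  apply in_or_app; auto. }
assert (weight its <= length its * (1 + length L))%nat.
{ apply IH; intros x hx; apply hin; cbn; apply in_or_app; auto. }
cbn [length]; lia.
Qed.

Lemma weight_app (S S' : list item) : weight (S ++ S') = (weight S + weight S')%nat.
Proof. unfold weight; rewrite map_app, list_sum_app; auto. Qed.

(** At most two cut points leave at most three items, each listing a point at most once. Besides the
    points of [l'] only the two ends of [e] can be listed, whence the bound 3 (1 + 2 + |l'|). An
    edge that is not decomposed is the case of an empty [l]. *)
Lemma related_edge_cut (Q : polygon) (t : nat) (e : edge) (l : list point)
    (pieces : list edge) (its : list item) :
  valid_edge e -> StronglySorted (before e) l ->
  (forall x, In x l -> inside_edge e x) -> (length l <= 2)%nat ->
  subdivision e l pieces -> Forall2 (item_for Q t) pieces its ->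
  let pts := concat (map item_points its) in
  starts_at (src e) its /\ ends_at (dst e) its /\
  exists l', listed_along e (fun x => inside_edge e x /\ on_boundary Q x) l' /\
    subdivision e l' (cut_all e pts) /\ (l' = [] -> cut_all e pts = [e]) /\
    NoDup l' /\ (weight its <= 3 * length l' + 9)%nat.
Proof.
intros hv hl hin hlen hdiv hits; set (pts := concat (map item_points its)).
destruct (valid_keyed e hv) as (M & k & K & hsub).
destruct (keyed_ends _ _ _ K) as [ons ond].
assert (hsd : k (src e) < k (dst e)) by (destruct K as (_ & _ & _ & h & _); exact h).
destruct (pieces_points Q t e M k K hsub l (src e) pieces its)
  as (j1 & j2 & j3 & j4 & j5 & j6); auto.
{ apply (listed_along_keys e M k (fun x => In x l)); [auto|split; tauto]. }
{ intros x hx; split; [apply hin; auto|].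
  apply (keyed_inside _ _ _ _ K); auto. }
split; [auto|]; split; [auto|]; fold pts in j4, j5.
destruct (cut_all_subdivision e M k K hsub pts e) as (l' & l1 & l2 & l3 & l4); auto.
{ apply subedge_refl; auto. }
{ apply Forall_forall; intros x hx; apply j5; auto. }
assert (hl' : listed_along e (fun x => inside_edge e x /\ on_boundary Q x) l').
{ split; auto; intros x; rewrite l3, j5; split; [tauto|].
  intros [h1 h2]; repeat split; auto; try apply h1.
  apply (keyed_inside _ _ _ _ K) in h1; lra. }
assert (hnd : NoDup l')
  by (eapply sorted_keys_NoDup, listed_along_keys; eauto).
exists l'; split; [auto|]; split; [auto|]; split; [auto|]; split; [auto|].
assert (weight its <= length its * (1 + length (src e :: dst e :: l')))%nat.
{ apply weight_bound; auto; intros x hx. fold pts in hx.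
  destruct (point_dec x (src e)) as [->|n1]; [left; auto|].
  destruct (point_dec x (dst e)) as [->|n2]; [right; left; auto|].
  right; right; apply l3; split; auto; repeat split; auto; apply j5; auto. }
cbn [length] in *; nia.
Qed.

(** The interface between geometry and program: it mentions only the comparisons that the program
    makes, namely the source of the next item with the current vertex and the target of an item with
    the next vertex. The third argument holds the group of edges that replaces each edge. *)
Inductive aligned : list edge -> list item -> list (list edge) -> Prop :=
| aligned_nil : aligned [] [] []
| aligned_skip e es S G :
    ~ starts_at (src e) S -> aligned es S G -> aligned (e :: es) S ([e] :: G)
| aligned_edge e es its S G :
    starts_at (src e) its -> ends_at (dst e) its -> aligned es S G ->
    aligned (e :: es) (its ++ S)
      (cut_all e (concat (map item_points its)) :: G).

Fixpoint edge_chain (a : point) (es : list edge) (b : point) : Prop :=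
  match es with
  | [] => a = b
  | e :: es' => src e = a /\ edge_chain (dst e) es' b
  end.

Lemma subdivision_chain (e : edge) (l : list point) :
  forall u es, subdivision_from e u l es -> edge_chain u es (dst e).
Proof.
induction l as [|v l IH]; intros u [|e' es]; cbn; try tauto.
- destruct es; [|tauto]. intros (-> & -> & _); cbn; auto.
- intros [(-> & -> & _) h]; auto.
Qed.

Lemma edge_chain_app (es1 es2 : list edge) (a b : point) :
  edge_chain a (es1 ++ es2) b <->
  exists c, edge_chain a es1 c /\ edge_chain c es2 b.
Proof.
revert a; induction es1 as [|e es1 IH]; intros a; cbn.
- split; [intros h; exists a; auto|intros (c & -> & h); auto].
- rewrite IH; split.
  + intros (h & c & h1 & h2); exists c; auto.
  + intros (c & (h & h1) & h2); split; auto; exists c; auto.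
Qed.

Lemma edge_chain_concat (es : list edge) (G : list (list edge)) (b : point) :
  Forall2 (fun e g => edge_chain (src e) g (dst e)) es G ->
  forall a, edge_chain a es b -> edge_chain a (concat G) b.
Proof.
induction 1 as [|e g es G h _ IH]; cbn; auto.
intros a [<- h']; apply edge_chain_app; exists (dst e); auto.
Qed.

(** Together with the distinctness of vertices this shows that the source test skips an unrelated
    edge: an item starting at its source would come from another edge with that source. *)
Lemma sequence_starts (P Q : polygon) (t : nat) (es : list edge) (S : list item)
    (a : point) :
  Forall valid_edge es ->
  sequence_items P Q t es S -> starts_at a S ->
  exists e, In e es /\ related P Q e /\ a = src e.
Proof.
intros hv; induction 1 as [|t e es S h hs IH|t e es it S h1 h2 h3 hs IH
                  |t e es pieces its S h1 h2 h3 h4 hs IH]; cbn; try tauto.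
- inversion hv; subst; intros hst; destruct IH as (f & hf & h'); auto.
  exists f; auto.
- intros <-; exists e; destruct h3 as (-> & _); auto.
- destruct h3 as (l & _ & hd).
  destruct pieces as [|p pieces]; [destruct l; cbn in hd; tauto|].
  inversion h4 as [|? it ? its' hit hits]; subst; cbn.
  intros <-; exists e; destruct hit as (-> & _); split; auto; split; auto.
  destruct l; cbn in hd; [destruct pieces; [|tauto]|]; apply hd.
Qed.

(** [L] gathers the intersection points interior to edges, which are the points charged to the total
    number of intersections. Occurrences at vertices are charged to the edges, inside the
    coefficient 9. *)
Lemma sequence_aligned (P Q : polygon) :
  circular_arc_polygon P ->
  forall t es S, sequence_items P Q t es S ->
  incl es (edges P) -> NoDup (map src es) ->
  exists G L, aligned es S G /\ Forall2 (refined_edge P Q) es G /\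
    Forall2 (fun e g => edge_chain (src e) g (dst e)) es G /\
    NoDup L /\
    (forall x, In x L -> exists e, In e es /\ inside_edge e x /\ on_boundary Q x) /\
    (weight S <= 3 * length L + 9 * length es)%nat.
Proof.
intros (_ & hval & _ & (_ & hsimple) & _) t es S hs.
(* Whole and decomposed edges differ only in how their items arise; this step adds either kind in
   front. *)
assert (hrel : forall e es S its, incl (e :: es) (edges P) ->
  NoDup (map src (e :: es)) -> related P Q e ->
  (exists l', starts_at (src e) its /\ ends_at (dst e) its /\
    listed_along e (fun x => inside_edge e x /\ on_boundary Q x) l' /\
    subdivision e l' (cut_all e (concat (map item_points its))) /\
    (l' = [] -> cut_all e (concat (map item_points its)) = [e]) /\
    NoDup l' /\ (weight its <= 3 * length l' + 9)%nat) ->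
  (exists G L, aligned es S G /\ Forall2 (refined_edge P Q) es G /\
    Forall2 (fun e g => edge_chain (src e) g (dst e)) es G /\
    NoDup L /\
    (forall x, In x L -> exists e, In e es /\ inside_edge e x /\ on_boundary Q x) /\
    (weight S <= 3 * length L + 9 * length es)%nat) ->
  exists G L, aligned (e :: es) (its ++ S) G /\ Forall2 (refined_edge P Q) (e :: es) G /\
    Forall2 (fun e g => edge_chain (src e) g (dst e)) (e :: es) G /\
    NoDup L /\
    (forall x, In x L -> exists f, In f (e :: es) /\ inside_edge f x /\ on_boundary Q x) /\
    (weight (its ++ S) <= 3 * length L + 9 * length (e :: es))%nat).
{ clear t es S hs.
  intros e es S its hin hnd hr (l' & i1 & i2 & i3 & i4 & i5 & i6 & i7)
    (G & L & g1 & g2 & g3 & g4 & g5 & g6).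
  exists (cut_all e (concat (map item_points its)) :: G), (l' ++ L).
  split; [constructor; auto|]. split.
  { constructor; auto; split.
    - intros _; exists l'; auto.
    (* A point of [l'] would be carried by the edge, so [l'] is empty and the edge keeps its own
       appendix point. *)
    - intros nc; apply i5. destruct l' as [|x l']; auto; exfalso; apply nc.
      split; auto; exists x.
      destruct (proj1 (proj2 i3 x) (or_introl eq_refl)) as [[h _] h']; auto. }
  split; [constructor; auto; eapply subdivision_chain; exact i4|].
  split.
  (* By simplicity a point interior to [e] that also lies on another edge would be an end of [e]; so
     no point is counted for two edges. *)
  { apply NoDup_app; auto. intros x hx hx'.
    apply (proj2 i3) in hx; destruct hx as [(hx & n1 & n2) _].
    destruct (g5 x hx') as (f & hf & (hfx & _ & _) & _).
    assert (nef : e <> f).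
    { intros <-; inversion hnd as [|? ? hn _]; subst; apply hn, in_map; auto. }
    destruct (hsimple e f x) as [h|h]; auto; try tauto; apply hin; cbn; auto. }
  split.
  { intros x hx; apply in_app_or in hx; destruct hx as [hx|hx].
    - exists e; split; [cbn; auto|]; apply (proj2 i3); auto.
    - destruct (g5 x hx) as (f & hf & h); exists f; cbn; auto. }
  rewrite weight_app, length_app; cbn [length]; lia. }
assert (hval' : forall e, In e (edges P) -> valid_edge e)
  by (apply Forall_forall; auto).
induction hs as [|t e es S h hs IH|t e es it S h1 h2 h3 hs IH
                  |t e es pieces its S h1 h2 h3 h4 hs IH]; intros hin hnd.
- exists [], []; repeat split; try constructor; cbn; tauto.
- inversion hnd as [|? ? hn hnd']; subst.
  destruct IH as (G & L & g1 & g2 & g3 & g4 & g5 & g6); auto.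
  { intros f hf; apply hin; cbn; auto. }
  exists ([e] :: G), L; split; [constructor; auto|].
  { intros hst. assert (hv : Forall valid_edge es).
    { apply Forall_forall; intros f hf; apply hval', hin; cbn; auto. }
    destruct (sequence_starts P Q t es S (src e) hv hs hst) as (f & hf & _ & hef).
    apply hn; rewrite hef; apply in_map; auto. }
  split; [constructor; auto; split; auto; intros [hr _]; contradiction|].
  split; [constructor; cbn; auto|]. split; [auto|]. split; [|cbn [length]; lia].
  intros x hx; destruct (g5 x hx) as (f & hf & h'); exists f; cbn; auto.
- apply (hrel e es S [it]); auto.
  + assert (hv : valid_edge e) by (apply hval', hin; cbn; auto).
    destruct (related_edge_cut Q 0 e [] [e] [it]) as (c1 & c2 & l' & c3); auto.
    * constructor.
    * cbn; tauto.
    * cbn; apply subedge_refl; auto.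
    * exists l'; tauto.
  + apply IH; [intros f hf; apply hin; cbn; auto|].
    inversion hnd; auto.
- apply (hrel e es S its); auto.
  + assert (hv : valid_edge e) by (apply hval', hin; cbn; auto).
    destruct h3 as (l & hl & hd).
    destruct (related_edge_cut Q t e l pieces its) as (c1 & c2 & l' & c3); auto.
    * apply hl.
    * intros x hx; apply hl; auto.
    * destruct (valid_keyed e hv) as (M & k & K & _).
      apply (center_line_points e); [|intros x hx; apply hl; auto].
      eapply sorted_keys_NoDup, listed_along_keys; eauto.
    * exists l'; tauto.
  + apply IH; [intros f hf; apply hin; cbn; auto|].
    inversion hnd; auto.
Qed.

(** * Reasoning about programs and linked lists *)

(** Total correctness with a time budget. An upper bound rather than an exact count lets branches of
    different length share one statement. *)
Definition reach (p : cmd) (s : state) (n : nat) (Q : state -> Prop) : Prop :=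
  exists t s', exec p s t s' /\ (t <= n)%nat /\ Q s'.

Lemma reach_mono (p : cmd) (s : state) (n m : nat) (Q R : state -> Prop) :
  reach p s n Q -> (n <= m)%nat -> (forall s', Q s' -> R s') -> reach p s m R.
Proof.
intros (t & s' & h & hn & hq) hm hr; exists t, s'; split; [auto|]; split; [lia|auto].
Qed.

Lemma reach_seq (p q : cmd) (s : state) (n1 n2 n : nat) (R Q : state -> Prop) :
  reach p s n1 R -> (forall s', R s' -> reach q s' n2 Q) -> (n1 + n2 <= n)%nat ->
  reach (Seq p q) s n Q.
Proof.
intros (t & s' & h & hn & hr) hq hm.
destruct (hq s' hr) as (t' & s'' & h' & hn' & hq').
exists (t + t')%nat, s''; split; [econstructor; eauto|]; split; [lia|auto].
Qed.

Lemma holds_dec (s : state) (b : test) : holds s b \/ ~ holds s b.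
Proof.
induction b as [x y|u v|u v|b IH]; cbn.
- destruct (Nat.eq_dec (wreg s x) (wreg s y)); auto.
- destruct (Req_dec (rreg s u) (rreg s v)); auto.
- destruct (Rlt_dec (rreg s u) (rreg s v)); auto.
- tauto.
Qed.

Lemma reach_if (b : test) (p q : cmd) (s : state) (m n : nat) (Q : state -> Prop) :
  (holds s b -> reach p s m Q) -> (~ holds s b -> reach q s m Q) ->
  (S m <= n)%nat -> reach (If b p q) s n Q.
Proof.
intros h1 h2 hm; destruct (holds_dec s b) as [h|h].
- destruct (h1 h) as (t & s' & he & hn & hq).
  exists (S t), s'; split; [apply exec_if_true; auto|]; split; [lia|auto].
- destruct (h2 h) as (t & s' & he & hn & hq).
  exists (S t), s'; split; [apply exec_if_false; auto|]; split; [lia|auto].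
Qed.

Lemma reach_while_end (b : test) (p : cmd) (s : state) (n : nat) (Q : state -> Prop) :
  ~ holds s b -> Q s -> (1 <= n)%nat -> reach (While b p) s n Q.
Proof. intros; exists 1%nat, s; split; [constructor; auto|auto]. Qed.

Lemma reach_while_step (b : test) (p : cmd) (s : state) (n1 n2 n : nat)
    (R Q : state -> Prop) :
  holds s b -> reach p s n1 R -> (forall s', R s' -> reach (While b p) s' n2 Q) ->
  (1 + n1 + n2 <= n)%nat -> reach (While b p) s n Q.
Proof.
intros hb (t & s' & h & hn & hr) hq hm.
destruct (hq s' hr) as (t' & s'' & h' & hn' & hq').
exists (S (t + t')), s''; split; [econstructor; eauto|]; split; [lia|auto].
Qed.

Lemma reach_skip (s : state) (n : nat) (Q : state -> Prop) :
  Q s -> (1 <= n)%nat -> reach Skip s n Q.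
Proof. intros; exists 1%nat, s; split; [constructor|auto]. Qed.

(** A functional version of [step]: straight-line code is verified by evaluation, with the side
    conditions collected in [safe_block]. *)
Definition run_instr (i : instr) (s : state) : state :=
  match i with
  | WConst x c => set_wreg s x c
  | WMove x y => set_wreg s x (wreg s y)
  | WLoad x y i => set_wreg s x (wmem s (wreg s y) i)
  | WStore x i y => set_wmem s (wreg s x) i (wreg s y)
  | New x => grow (set_wreg s x (free s))
  | RConst u c => set_rreg s u (IZR c)
  | RMove u v => set_rreg s u (rreg s v)
  | ROp o u v w => set_rreg s u (eval_rop o (rreg s v) (rreg s w))
  | RLoad u y i => set_rreg s u (rmem s (wreg s y) i)
  | RStore x i u => set_rmem s (wreg s x) i (rreg s u)
  end.

Definition safe_instr (i : instr) (s : state) : Prop :=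
  match i with
  | WLoad _ y _ | RLoad _ y _ => allocated s (wreg s y)
  | WStore x _ _ | RStore x _ _ => allocated s (wreg s x)
  | ROp OpDiv _ _ w => rreg s w <> 0
  | _ => True
  end.

Fixpoint block (l : list instr) : cmd :=
  match l with [] => Skip | i :: l' => Seq (Do i) (block l') end.

Fixpoint run_block (l : list instr) (s : state) : state :=
  match l with [] => s | i :: l' => run_block l' (run_instr i s) end.

Fixpoint safe_block (l : list instr) (s : state) : Prop :=
  match l with
  | [] => True
  | i :: l' => safe_instr i s /\ safe_block l' (run_instr i s)
  end.

Lemma reach_block (l : list instr) (s : state) (n : nat) (Q : state -> Prop) :
  safe_block l s -> Q (run_block l s) -> (1 + length l <= n)%nat ->
  reach (block l) s n Q.
Proof.
revert s n; induction l as [|i l IH]; intros s n; cbn.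
- intros _ hq hn; apply reach_skip; auto; lia.
- intros [h1 h2] hq hn.
  eapply (reach_seq _ _ _ 1 (n - 1)) with (R := fun s' => s' = run_instr i s); [| |lia].
  + exists 1%nat, (run_instr i s); split; [|auto]. constructor.
    destruct i; cbn in *; try (constructor; auto; fail).
    constructor; intros ->; auto.
  + intros s' ->; apply IH; auto; lia.
Qed.

(** * Lists of edges in memory and their evolution *)

Definition node (s : state) (a kind : nat) (p : point) : Prop :=
  allocated s a /\ wmem s a 0 = kind /\ rmem s a 0 = fst p /\ rmem s a 1 = snd p.

(** The edges [es] are stored from node [a] on, and the last of them leads to
    node [z]; [ads] lists the nodes used. Backward links are ignored. *)
Fixpoint seg (s : state) (a : nat) (es : list edge) (z : nat) (ads : list nat) : Prop :=
  match es with
  | [] => a = z /\ ads = []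
  | e :: es' =>
      node s a 0 (src e) /\
      match app e with
      | None => exists ads', ads = a :: ads' /\ seg s (wmem s a 1) es' z ads'
      | Some c =>
          let b := wmem s a 1 in
          node s b 1 c /\
          exists ads', ads = a :: b :: ads' /\ seg s (wmem s b 1) es' z ads'
      end
  end.

Definition mem_eq_at (s s' : state) (x : nat) : Prop :=
  forall i, wmem s' x i = wmem s x i /\ rmem s' x i = rmem s x i.

Definition same_mem (s s' : state) : Prop :=
  wmem s' = wmem s /\ rmem s' = rmem s /\ free s' = free s.

Definition keeps_except (bad : list nat) (s s' : state) : Prop :=
  forall j, ~ In j bad -> wreg s' j = wreg s j.

(** The nodes [ads] of [s] have turned into the nodes [ads'] of [s']; vertices
    stay where they are and everything else is untouched. *)
Definition evolves (s : state) (ads : list nat) (s' : state) (ads' : list nat) : Prop :=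
  (free s <= free s')%nat /\
  (forall x, allocated s x -> ~ In x ads -> mem_eq_at s s' x) /\
  (forall x p, node s x 0 p -> node s' x 0 p) /\
  (forall x, In x ads' -> In x ads \/ (free s <= x)%nat).

Lemma node_eq (s s' : state) (x kind : nat) (p : point) :
  node s x kind p -> (free s <= free s')%nat -> mem_eq_at s s' x -> node s' x kind p.
Proof.
intros ([h1 h1'] & h2 & h3 & h4) hf hm; unfold node, allocated.
rewrite (proj1 (hm 0%nat)), (proj2 (hm 0%nat)), (proj2 (hm 1%nat)).
repeat split; auto; lia.
Qed.

Lemma seg_allocated (s : state) (es : list edge) (z : nat) :
  forall a ads, seg s a es z ads -> forall x, In x ads -> allocated s x.
Proof.
induction es as [|e es IH]; intros a ads; cbn.
- intros [_ ->]; cbn; tauto.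
- intros [hn h]; destruct (app e).
  + destruct h as (hb & ads' & -> & h); intros x [<-|[<-|hx]];
      [apply hn|apply hb|eapply IH; eauto].
  + destruct h as (ads' & -> & h); intros x [<-|hx]; [apply hn|eapply IH; eauto].
Qed.

Lemma seg_eq (s s' : state) (es : list edge) (z : nat) :
  (free s <= free s')%nat -> forall a ads, seg s a es z ads ->
  (forall x, In x ads -> mem_eq_at s s' x) -> seg s' a es z ads.
Proof.
intros hf; induction es as [|e es IH]; intros a ads; cbn; [auto|].
intros [hn h]; destruct (app e).
- destruct h as (hb & ads' & -> & h); intros hm.
  assert (ha := hm a (or_introl eq_refl)).
  assert (hb' := hm _ (or_intror (or_introl eq_refl))).
  rewrite (proj1 (ha 1%nat)), (proj1 (hb' 1%nat)).
  split; [eapply node_eq; eauto|]; split; [eapply node_eq; eauto|].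
  exists ads'; split; auto; apply IH; auto; intros; apply hm; cbn; auto.
- destruct h as (ads' & -> & h); intros hm.
  assert (ha := hm a (or_introl eq_refl)).
  rewrite (proj1 (ha 1%nat)).
  split; [eapply node_eq; eauto|].
  exists ads'; split; auto; apply IH; auto; intros; apply hm; cbn; auto.
Qed.

Lemma seg_app (s : state) (es1 es2 : list edge) (z : nat) :
  forall a ads, seg s a (es1 ++ es2) z ads <->
  exists y ads1 ads2, ads = ads1 ++ ads2 /\ seg s a es1 y ads1 /\ seg s y es2 z ads2.
Proof.
induction es1 as [|e es1 IH]; intros a ads.
- cbn; split.
  + intros h; exists a, [], ads; auto.
  + intros (y & ads1 & ads2 & -> & (-> & ->) & h); auto.
- cbn [List.app seg]; destruct (app e); cbv zeta.
  + split.
    * intros (hn & hb & ads' & -> & h); apply IH in h.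
      destruct h as (y & ads1 & ads2 & -> & h1 & h2).
      exists y, (a :: wmem s a 1 :: ads1), ads2; repeat split; auto; try apply hn; try apply hb.
      exists ads1; auto.
    * intros (y & ads1 & ads2 & -> & (hn & hb & ads' & -> & h1) & h2).
      split; auto; split; auto; exists (ads' ++ ads2); split; auto.
      apply IH; exists y, ads', ads2; auto.
  + split.
    * intros (hn & ads' & -> & h); apply IH in h.
      destruct h as (y & ads1 & ads2 & -> & h1 & h2).
      exists y, (a :: ads1), ads2; repeat split; auto; try apply hn.
      exists ads1; auto.
    * intros (y & ads1 & ads2 & -> & (hn & ads' & -> & h1) & h2).
      split; auto; exists (ads' ++ ads2); split; auto.
      apply IH; exists y, ads', ads2; auto.
Qed.

Lemma seg_evolves (s s' : state) (es : list edge) (a z : nat) (l ads ads' : list nat) :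
  seg s a es z l -> evolves s ads s' ads' -> (forall x, In x l -> ~ In x ads) ->
  seg s' a es z l.
Proof.
intros h (hf & hm & _) hd; eapply seg_eq; eauto.
intros x hx; apply hm; auto; eapply seg_allocated; eauto.
Qed.

(** The second change may touch only nodes [m1] left by the first. These come from [ads] or are
    fresh, so an old node outside [ads] is safe from both. *)
Lemma evolves_trans (s s1 s' : state) (ads m m1 m1' m' : list nat) :
  evolves s ads s1 m -> evolves s1 m1 s' m1' ->
  (forall x, In x m1 -> In x m) ->
  (forall x, In x m' -> In x m \/ In x m1') -> evolves s ads s' m'.
Proof.
intros (f1 & e1 & v1 & n1) (f2 & e2 & v2 & n2) hi ho.
split; [lia|]; split; [|split].
- intros x hx hn i.
  assert (hx1 : allocated s1 x) by (unfold allocated in *; lia).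
  assert (hn1 : ~ In x m1).
  { intros h; apply hi, n1 in h; unfold allocated in hx; destruct h; [auto|lia]. }
  destruct (e1 x hx hn i); destruct (e2 x hx1 hn1 i); split; congruence.
- auto.
- intros x hx; destruct (ho x hx) as [h|h]; auto.
  destruct (n2 x h) as [h'|h']; [auto|right; lia].
Qed.

Lemma same_mem_evolves (s s' : state) (ads : list nat) :
  same_mem s s' -> evolves s ads s' ads.
Proof.
intros (h1 & h2 & h3); split; [lia|]; split; [|split; auto].
- intros x _ _ i; rewrite h1, h2; auto.
- intros x p; unfold node, allocated; rewrite h1, h2, h3; auto.
Qed.

Lemma seg_same (s s' : state) (es : list edge) (a z : nat) (ads : list nat) :
  same_mem s s' -> seg s a es z ads -> seg s' a es z ads.
Proof.
intros h hs; eapply seg_evolves; [eauto|apply (same_mem_evolves s s' []); auto|].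
cbn; tauto.
Qed.

Lemma node_same (s s' : state) (x kind : nat) (p : point) :
  same_mem s s' -> node s x kind p -> node s' x kind p.
Proof. intros (h1 & h2 & h3); unfold node, allocated; rewrite h1, h2, h3; auto. Qed.

Lemma evolves_same_l (s s1 s' : state) (ads ads' : list nat) :
  same_mem s s1 -> evolves s1 ads s' ads' -> evolves s ads s' ads'.
Proof.
intros h h'; eapply evolves_trans; [apply same_mem_evolves; eauto|eauto|auto|auto].
Qed.

Lemma evolves_same_r (s s1 s' : state) (ads ads' : list nat) :
  evolves s ads s1 ads' -> same_mem s1 s' -> evolves s ads s' ads'.
Proof.
intros h h'; eapply evolves_trans; [eauto|apply (same_mem_evolves s1 s' []); auto
  |cbn; tauto|auto].
Qed.

(** Nodes of [m'] are either old nodes of [m] or fresh; neither kind can occur in the allocated list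
    [l]. *)
Lemma evolves_NoDup (s s' : state) (l m m' : list nat) :
  NoDup (l ++ m) -> (forall x, In x l -> allocated s x) ->
  evolves s m s' m' -> NoDup m' -> NoDup (l ++ m').
Proof.
intros hn hl (_ & _ & _ & hg) hm.
apply NoDup_app; auto; [eapply NoDup_app_remove_r; eauto|].
intros x hx hx'; destruct (hg x hx') as [h|h].
- revert hn hx h; clear; induction l as [|y l IH]; cbn; [tauto|].
  intros hn; inversion hn as [|? ? h1 h2]; subst.
  intros [->|h] h'; [apply h1, in_or_app; auto|auto].
- specialize (hl x hx); unfold allocated in hl; lia.
Qed.

Lemma stores_points_evolves (s s' : state) (ads ads' : list nat) :
  evolves s ads s' ads' -> forall l h g,
  stores_points s h l g -> (forall x, In x g -> ~ In x ads) -> stores_points s' h l g.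
Proof.
intros (hf & hm & _); induction l as [|x l IH]; intros h [|a g]; cbn; auto.
intros (-> & ha & h1 & h2 & h3) hd.
assert (ha' : allocated s' a) by (unfold allocated in *; lia).
assert (e := hm a ha (hd a (or_introl eq_refl))).
rewrite (proj1 (e 0%nat)), (proj2 (e 0%nat)), (proj2 (e 1%nat)).
repeat split; try apply ha'; auto.
Qed.

Lemma stores_items_evolves (s s' : state) (ads ads' : list nat) :
  evolves s ads s' ads' -> forall S h g,
  stores_items s h S g -> (forall x, In x g -> ~ In x ads) -> stores_items s' h S g.
Proof.
intros hev; induction S as [|it S IH]; intros h g; cbn; auto.
intros (g1 & g2 & -> & ha & h1 & h2 & h3 & h4 & h5 & h6 & h7 & h8) hd.
destruct hev as (hf & hm & hr).
assert (ha' : allocated s' h) by (unfold allocated in *; lia).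
assert (e := hm h ha (hd h (or_introl eq_refl))).
exists g1, g2; split; [auto|]; split; [auto|].
rewrite (proj1 (e 0%nat)), (proj1 (e 1%nat)), (proj1 (e 2%nat)), (proj1 (e 3%nat)).
rewrite (proj2 (e 0%nat)), (proj2 (e 1%nat)), (proj2 (e 2%nat)), (proj2 (e 3%nat)),
  (proj2 (e 4%nat)), (proj2 (e 5%nat)).
do 5 (split; [assumption|]); split; [exact h6|].
split; [eapply stores_points_evolves; [split; eauto|eauto|]|apply IH; auto];
  intros x hx; apply hd; right; apply in_or_app; auto.
Qed.

(** * Computing an appendix point *)

(** Input in the real registers 20-27 (four points), output in 28-29. *)
Definition appendix_code : cmd :=
  Seq (block [
    ROp OpSub 30 22 20; ROp OpSub 31 23 21;
    ROp OpSub 32 24 20; ROp OpSub 33 25 21;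
    ROp OpSub 34 26 20; ROp OpSub 35 27 21;
    ROp OpMul 36 30 30; ROp OpMul 37 31 31; ROp OpAdd 36 36 37;
    ROp OpMul 38 32 32; ROp OpMul 37 33 33; ROp OpAdd 38 38 37;
    ROp OpMul 39 34 34; ROp OpMul 37 35 35; ROp OpAdd 39 39 37;
    ROp OpMul 30 30 38; ROp OpMul 37 32 36; ROp OpSub 30 30 37; ROp OpAdd 30 34 30;
    ROp OpMul 31 31 38; ROp OpMul 37 33 36; ROp OpSub 31 31 37; ROp OpAdd 31 35 31;
    ROp OpMul 36 30 30; ROp OpMul 37 31 31; ROp OpAdd 36 36 37;
    RConst 37 0])
  (Seq (If (REq 36 37) (block [RConst 39 0]) (block [ROp OpDiv 39 39 36]))
  (block [
    ROp OpMul 28 39 30; ROp OpAdd 28 20 28;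
    ROp OpMul 29 39 31; ROp OpAdd 29 21 29])).

Definition same_but_rreg (s s' : state) : Prop :=
  same_mem s s' /\ wreg s' = wreg s.

Ltac low_rreg j :=
  do 28 (destruct j as [|j]; [reflexivity|]); exfalso; lia.

(** The test for a zero denominator keeps the machine division legal. In that case the code stores
    0, which is also the value of the real quotient by [Rinv_0], so the output is [appendix] for
    every input. *)
Lemma reach_appendix (s : state) (u c z p : point) :
  (rreg s 20, rreg s 21) = u -> (rreg s 22, rreg s 23) = c ->
  (rreg s 24, rreg s 25) = z -> (rreg s 26, rreg s 27) = p ->
  reach appendix_code s 50 (fun s' => same_but_rreg s s' /\
    (forall j, (j < 28)%nat -> rreg s' j = rreg s j) /\
    (rreg s' 28, rreg s' 29) = appendix u c z p).
Proof.
intros <- <- <- <-; unfold appendix_code.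
set (d := appendix_dir (rreg s 20, rreg s 21) (rreg s 22, rreg s 23)
            (rreg s 24, rreg s 25) (rreg s 26, rreg s 27)).
set (P := sub (rreg s 26, rreg s 27) (rreg s 20, rreg s 21)).
eapply (reach_seq _ _ _ 28 22) with (R := fun s' => same_but_rreg s s' /\
    (forall j, (j < 28)%nat -> rreg s' j = rreg s j) /\
    rreg s' 30 = fst d /\ rreg s' 31 = snd d /\
    rreg s' 36 = fst d * fst d + snd d * snd d /\
    rreg s' 37 = 0 /\ rreg s' 39 = fst P * fst P + snd P * snd P); [| |lia].
{ apply reach_block; [cbn; tauto| |cbn; lia].
  split; [repeat split|]. split; [intros j hj; low_rreg j|].
  repeat split. }
assert (Happ : appendix (rreg s 20, rreg s 21) (rreg s 22, rreg s 23)
            (rreg s 24, rreg s 25) (rreg s 26, rreg s 27) =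
  let t := (fst P * fst P + snd P * snd P) / (fst d * fst d + snd d * snd d) in
  (rreg s 20 + t * fst d, rreg s 21 + t * snd d)) by reflexivity.
rewrite Happ; clearbody d P; clear Happ.
intros s1 (m1 & r1 & e30 & e31 & e36 & e37 & e39).
eapply (reach_seq _ _ _ 5 10) with (R := fun s' => same_but_rreg s s' /\
    (forall j, (j < 28)%nat -> rreg s' j = rreg s j) /\
    rreg s' 30 = fst d /\ rreg s' 31 = snd d /\
    rreg s' 39 = (fst P * fst P + snd P * snd P) / (fst d * fst d + snd d * snd d));
  [| |lia].
{ apply (reach_if _ _ _ _ 4); [| |lia]; cbn [holds]; rewrite e36, e37; intros h0.
  - apply reach_block; [cbn; tauto| |cbn; lia].
    split; [exact m1|]. split.
    { intros j hj; rewrite <- r1 by auto; low_rreg j. }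
    split; [exact e30|]. split; [exact e31|].
    cbn; rewrite h0; unfold Rdiv; rewrite Rinv_0; ring.
  - apply reach_block; [cbn; rewrite e36; tauto| |cbn; lia].
    split; [exact m1|]. split.
    { intros j hj; rewrite <- r1 by auto; low_rreg j. }
    split; [exact e30|]. split; [exact e31|].
    cbn; rewrite e36, e39; auto. }
intros s2 (m2 & r2 & f30 & f31 & f39).
apply reach_block; [cbn; tauto| |cbn; lia].
split; [exact m2|]. split.
{ intros j hj; rewrite <- r2 by auto; low_rreg j. }
cbn; rewrite f39, f30, f31, !r2 by lia; auto.
Qed.

(** * Inserting one point *)

(** Word registers: 4 current vertex, 5 its next node, 6 next vertex, 7 current
    intersection point, 8 and 9 the constants 1 and 0, 10 and 11 new nodes,
    12 kind of node 5, 13 current item, 14 first node, 15 is 1 between two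
    pieces of one decomposed arc and 0 otherwise.  Real registers: 0-1 new
    point, 2-3 current vertex, 4-5 next vertex, 10-11 appendix point. *)
Definition insert_code : cmd :=
  Seq (block [WLoad 5 4 1; New 11; WStore 11 0 9; RStore 11 0 0; RStore 11 1 1])
  (Seq (If (WEq 12 8)
    (Seq (block [RLoad 10 5 0; RLoad 11 5 1;
       RMove 20 2; RMove 21 3; RMove 22 10; RMove 23 11;
       RMove 24 4; RMove 25 5; RMove 26 0; RMove 27 1])
    (Seq appendix_code
    (Seq (block [RMove 12 28; RMove 13 29;
       RMove 20 4; RMove 21 5; RMove 24 2; RMove 25 3])
    (Seq appendix_code
    (block [New 10; WStore 10 0 8; RStore 10 0 12; RStore 10 1 13; WStore 10 1 11;
       WStore 11 1 5; WStore 4 1 10; RStore 5 0 28; RStore 5 1 29])))))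
    (block [WStore 11 1 5; WStore 4 1 11]))
  (block [WMove 4 11])).

Definition kind_of (e : edge) : nat :=
  match app e with Some _ => 1%nat | None => 0%nat end.

Ltac updates :=
  unfold upd in *;
  repeat match goal with
  | |- context [Nat.eqb ?a ?b] =>
      destruct (Nat.eqb_spec a b); [try (exfalso; (lia || congruence)) |
                                    try (exfalso; (lia || congruence))]
  end.

(** On an arc the new vertex gets the address [y = free s] and the appendix point of the left part
    the address [S y]; the old appendix node [b] is recycled for the right part with new
    coordinates. No vertex is moved or overwritten, so the addresses held in other registers remain
    usable. *)
Lemma reach_insert (s : state) (e : edge) (a z : nat) (ads : list nat) (p : point) :
  wreg s 4 = a -> wreg s 6 = z -> wreg s 8 = 1%nat -> wreg s 9 = 0%nat ->
  wreg s 12 = kind_of e -> seg s a [e] z ads -> NoDup ads ->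
  (rreg s 0, rreg s 1) = p -> (rreg s 2, rreg s 3) = src e ->
  (rreg s 4, rreg s 5) = dst e ->
  reach insert_code s 200 (fun s' => exists ads1 ads2,
    seg s' a [left_part e p] (wreg s' 4) ads1 /\
    seg s' (wreg s' 4) [right_part e p] z ads2 /\
    NoDup (ads1 ++ ads2) /\ evolves s ads s' (ads1 ++ ads2) /\
    keeps_except [4; 5; 10; 11]%nat s s').
Proof.
intros w4 w6 w8 w9 w12 hseg hnd hp hu hz.
cbn in hseg; destruct hseg as [ha hseg].
assert (haa : allocated s a) by apply ha.
set (y := free s).
unfold insert_code.
set (l0 := [WLoad 5 4 1; New 11; WStore 11 0 9; RStore 11 0 0; RStore 11 1 1]%nat).
set (s1 := run_block l0 s).
eapply (reach_seq _ _ _ 6 194) with (R := fun s' => s' = s1); [| |lia].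
{ apply reach_block; [|reflexivity|cbn; lia].
  cbn; rewrite w4; unfold allocated in *; cbn; repeat split; lia. }
intros ? ->.
assert (f1 : free s1 = S y) by reflexivity.
assert (k1 : keeps_except [5; 11]%nat s s1).
{ intros j hj; cbn in hj; cbn; updates; tauto. }
assert (b1 : wreg s1 5 = wmem s a 1) by (cbn; rewrite w4; auto).
assert (y1 : wreg s1 11 = y) by reflexivity.
assert (m1 : forall x, (x < y)%nat -> mem_eq_at s s1 x).
{ intros x hx i; cbn; fold y; updates; auto. }
assert (n1 : node s1 y 0 p).
{ unfold node, allocated; rewrite f1. subst p; cbn; fold y; unfold upd; cbn.
  rewrite !Nat.eqb_refl; cbn. rewrite w9. unfold allocated in haa; repeat split; lia. }
assert (r1 : forall j, rreg s1 j = rreg s j) by reflexivity.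
clearbody s1. clear l0.
rewrite <- (k1 4%nat) in w4 by (cbn; lia).
rewrite <- (k1 6%nat) in w6 by (cbn; lia).
rewrite <- (k1 8%nat) in w8 by (cbn; lia).
rewrite <- (k1 12%nat) in w12 by (cbn; lia).
rewrite <- !r1 in hp, hu, hz.
assert (hay : (0 < a < y)%nat) by (unfold allocated in haa; fold y in haa; lia).
destruct e as [u [c|] v]; cbn [app src dst kind_of] in *; unfold kind_of in w12;
  cbn [app] in w12.
- destruct hseg as (hb & ads' & -> & hz' & ->).
  set (b := wmem s a 1) in *.
  assert (hby : (0 < b < y)%nat)
    by (destruct hb as [hb _]; unfold allocated in hb; fold y in hb; lia).
  assert (hab : a <> b) by (inversion hnd as [|? ? h _]; subst; cbn in h; lia).
  set (w1 := appendix u c v p). set (w2 := appendix v c u p).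
  assert (hb1 : node s1 b 1 c).
  { eapply node_eq; [exact hb|fold y; lia|apply m1; lia]. }
  eapply (reach_seq _ _ _ 180 10) with (R := fun s' =>
    wreg s' = (upd (wreg s1) 10 (S y)) /\ free s' = S (S y) /\
    (forall x i, wmem s' x i = upd (upd (upd (wmem s1) (S y) (upd (upd (wmem s1 (S y)) 0 1) 1 y))
         y (upd (wmem s1 y) 1 b)) a (upd (wmem s1 a) 1 (S y)) x i)%nat /\
    (forall x i, rmem s' x i = upd (upd (rmem s1) (S y) (upd (upd (rmem s1 (S y)) 0 (fst w1)) 1 (snd w1)))
         b (upd (upd (rmem s1 b) 0 (fst w2)) 1 (snd w2)) x i)%nat); [| |lia].
  { apply (reach_if _ _ _ _ 170); [intros _| |lia].
    2:{ cbn; rewrite w12, w8; tauto. }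
    eapply (reach_seq _ _ _ 11 150) with (R := fun s' => same_but_rreg s1 s' /\
      (forall j, (j < 6)%nat -> rreg s' j = rreg s j) /\
      (rreg s' 20, rreg s' 21) = u /\ (rreg s' 22, rreg s' 23) = c /\
      (rreg s' 24, rreg s' 25) = v /\ (rreg s' 26, rreg s' 27) = p); [| |lia].
    { apply reach_block; [|split; [repeat split|]|cbn; lia].
      - cbn; rewrite b1; unfold allocated; cbn; rewrite f1; repeat split; lia.
      - split.
        + intros j hj; rewrite <- r1; do 6 (destruct j; [reflexivity|]); lia.
        + destruct hb1 as (_ & _ & hb1 & hb2).
          cbn; rewrite b1, hb1, hb2; repeat split; auto; destruct c; auto. }
    intros s2 ([(mw2 & mr2 & mf2) w2'] & r2 & i1 & i2 & i3 & i4).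
    eapply (reach_seq _ _ _ 50 100) with (1 := reach_appendix s2 u c v p i1 i2 i3 i4);
      [|lia].
    intros s3 ([(mw3 & mr3 & mf3) w3'] & r3 & o3).
    eapply (reach_seq _ _ _ 10 90) with (R := fun s' => same_but_rreg s1 s' /\
      (rreg s' 12, rreg s' 13) = w1 /\
      (rreg s' 20, rreg s' 21) = v /\ (rreg s' 22, rreg s' 23) = c /\
      (rreg s' 24, rreg s' 25) = u /\ (rreg s' 26, rreg s' 27) = p); [| |lia].
    { apply reach_block; [cbn; tauto| |cbn; lia].
      split; [split; [repeat split|]; cbn; congruence|].
      split; [cbn; exact o3|]. cbn.
      rewrite (r3 2%nat), (r3 3%nat), (r3 4%nat), (r3 5%nat), (r3 22%nat), (r3 23%nat),
        (r3 26%nat), (r3 27%nat) by lia.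
      rewrite (r2 2%nat), (r2 3%nat), (r2 4%nat), (r2 5%nat), <- !r1 by lia; auto. }
    intros s4 ([(mw4 & mr4 & mf4) w4'] & o4 & i5 & i6 & i7 & i8).
    eapply (reach_seq _ _ _ 50 20) with (R := fun s' => same_but_rreg s1 s' /\
      (rreg s' 12, rreg s' 13) = w1 /\ (rreg s' 28, rreg s' 29) = w2); [| |lia].
    { eapply reach_mono; [apply (reach_appendix s4 v c u p i5 i6 i7 i8)|lia|].
      intros s5 ([(mw5 & mr5 & mf5) w5'] & r5 & o5).
      split; [split; [repeat split|]; congruence|].
      rewrite !r5 by lia; auto. }
    intros s5 ([(mw5 & mr5 & mf5) w5'] & o5 & o6).
    apply reach_block; [| |cbn; lia].
    - cbn; rewrite mf5, w5', f1; unfold upd; cbn; rewrite b1, w4, y1.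
      unfold allocated; cbn; rewrite ?mf5, ?f1; repeat split; lia.
    - rewrite <- o5, <- o6. 
      cbn; rewrite mw5, mr5, mf5, w5', f1.
      split; [auto|]; split; [auto|].
      rewrite !b1, !w4, !y1, !w8.
      split; intros x i; unfold upd; cbn;
        repeat match goal with
        | |- context [Nat.eqb ?a ?b] => destruct (Nat.eqb_spec a b); subst; cbn
        end; try reflexivity; try lia. }
  intros s2 (w2' & f2 & mw & mr).
  apply reach_block; [cbn; tauto| |cbn; lia].
  set (s3 := run_block [WMove 4 11]%nat s2).
  assert (e4 : wreg s3 4 = y) by (cbn; rewrite w2'; cbn; auto).
  assert (k3 : keeps_except [4; 5; 10; 11]%nat s s3).
  { intros j hj; cbn in hj; rewrite <- k1 by (cbn; lia).
    cbn; rewrite w2'; cbn; updates; tauto. }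
  assert (f3 : free s3 = S (S y)) by (cbn; auto).
  assert (mw3 : forall x i, wmem s3 x i = wmem s2 x i) by reflexivity.
  assert (mr3 : forall x i, rmem s3 x i = rmem s2 x i) by reflexivity.
  clearbody s3. rewrite e4.
  assert (ea1 : wmem s3 a 1 = S y) by (rewrite mw3, mw; updates; auto).
  assert (ey1 : wmem s3 y 1 = b) by (rewrite mw3, mw; updates; auto).
  assert (eq1 : wmem s3 (S y) 1 = y) by (rewrite mw3, mw; updates; auto).
  assert (eb1 : wmem s3 b 1 = wmem s b 1).
  { rewrite mw3, mw; rewrite <- (proj1 (m1 b (proj2 hby) 1%nat)); updates; auto. }
  assert (na : node s3 a 0 u).
  { destruct ha as (_ & h1 & h2 & h3); destruct (m1 a (proj2 hay) 0%nat) as [h4 h5].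
    destruct (m1 a (proj2 hay) 1%nat) as [_ h6].
    unfold node, allocated; rewrite f3, !mw3, !mr3, mw, !mr.
    split; [lia|]; updates; repeat split; congruence. }
  assert (ny : node s3 y 0 p).
  { destruct n1 as (_ & h1 & h2 & h3).
    unfold node, allocated; rewrite f3, !mw3, !mr3, mw, !mr.
    split; [lia|]; updates; repeat split; congruence. }
  assert (nq : node s3 (S y) 1 w1).
  { unfold node, allocated; rewrite f3, !mw3, !mr3, mw, !mr.
    split; [lia|]; updates; repeat split; congruence. }
  assert (nb : node s3 b 1 w2).
  { destruct hb1 as (_ & h1 & h2 & h3).
    unfold node, allocated; rewrite f3, !mw3, !mr3, mw, !mr.
    split; [lia|]; updates; repeat split; congruence. }
  assert (other : forall x, (x < y)%nat -> x <> a -> x <> b -> mem_eq_at s s3 x).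
  { intros x hx na' nb' i; destruct (m1 x hx i) as [<- <-].
    rewrite mw3, mr3, mw, mr; updates; auto. }
  exists [a; S y], [y; b].
  split.
  { cbn; fold w1; rewrite ea1, eq1; split; [auto|]; split; [auto|].
    exists []; auto. }
  split.
  { cbn; fold w2; rewrite ey1; split; [auto|]; split; [auto|].
    exists []; split; auto; split; auto; rewrite eb1; auto. }
  split.
  { repeat constructor; cbn; lia. }
  split; [|auto]. split; [fold y; lia|]. split; [|split].
  + intros x hx hn; cbn in hn; unfold allocated in hx; fold y in hx.
    apply other; lia.
  + intros x q hq.
    destruct (Nat.eq_dec x a) as [->|h1].
    { assert (q = u) as ->; [|auto].
      destruct ha as (_ & _ & h2 & h3), hq as (_ & _ & h4 & h5).
      destruct q, u; cbn in *; f_equal; congruence. }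
    (* The overwritten node [b] has kind 1 and therefore is not a vertex. *)
    destruct (Nat.eq_dec x b) as [->|h2].
    { exfalso; destruct hq as (_ & h3 & _), hb as (_ & h4 & _); congruence. }
    eapply node_eq; [eauto|fold y; lia|]. apply other; auto.
    destruct hq as [h3 _]; unfold allocated in h3; fold y in h3; lia.
  + intros x; cbn; fold y; lia.
- destruct hseg as (ads' & -> & hz' & ->).
  eapply (reach_seq _ _ _ 180 10) with (R := fun s' =>
    wreg s' = wreg s1 /\ free s' = S y /\
    (forall x i, wmem s' x i = upd (upd (wmem s1) y (upd (wmem s1 y) 1 z))
         a (upd (wmem s1 a) 1 y) x i)%nat /\
    (forall x i, rmem s' x i = rmem s1 x i)); [| |lia].
  { apply (reach_if _ _ _ _ 170); [|intros _|lia].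
    { cbn; rewrite w12, w8; discriminate. }
    apply reach_block; [| |cbn; lia].
    - cbn; unfold allocated; cbn; rewrite f1, y1, w4; repeat split; lia.
    - cbn; rewrite !b1, !w4, !y1. rewrite hz'. repeat split; auto.
      intros x i; updates; auto; subst; auto. }
  intros s2 (w2' & f2 & mw & mr).
  apply reach_block; [cbn; tauto| |cbn; lia].
  set (s3 := run_block [WMove 4 11]%nat s2).
  assert (e4 : wreg s3 4 = y) by (cbn; rewrite w2'; cbn; auto).
  assert (k3 : keeps_except [4; 5; 10; 11]%nat s s3).
  { intros j hj; cbn in hj; rewrite <- k1 by (cbn; lia).
    cbn; rewrite w2'; cbn; updates; tauto. }
  assert (f3 : free s3 = S y) by (cbn; auto).
  assert (mw3 : forall x i, wmem s3 x i = wmem s2 x i) by reflexivity.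
  assert (mr3 : forall x i, rmem s3 x i = rmem s2 x i) by reflexivity.
  clearbody s3. rewrite e4.
  assert (ea1 : wmem s3 a 1 = y) by (rewrite mw3, mw; updates; auto).
  assert (ey1 : wmem s3 y 1 = z) by (rewrite mw3, mw; updates; auto).
  assert (na : node s3 a 0 u).
  { destruct ha as (_ & h1 & h2 & h3); destruct (m1 a (proj2 hay) 0%nat) as [h4 h5].
    destruct (m1 a (proj2 hay) 1%nat) as [_ h6].
    unfold node, allocated; rewrite f3, !mw3, !mr3, mw, !mr.
    split; [lia|]; updates; repeat split; congruence. }
  assert (ny : node s3 y 0 p).
  { destruct n1 as (_ & h1 & h2 & h3).
    unfold node, allocated; rewrite f3, !mw3, !mr3, mw, !mr.
    split; [lia|]; updates; repeat split; congruence. }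
  assert (other : forall x, (x < y)%nat -> x <> a -> mem_eq_at s s3 x).
  { intros x hx na' i; destruct (m1 x hx i) as [<- <-].
    rewrite mw3, mr3, mw, mr; updates; auto. }
  exists [a], [y].
  split.
  { cbn; rewrite ea1; split; [auto|]. exists []; auto. }
  split.
  { cbn; rewrite ey1; split; [auto|]. exists []; auto. }
  split.
  { repeat constructor; cbn; lia. }
  split; [|auto]. split; [fold y; lia|]. split; [|split].
  + intros x hx hn; cbn in hn; unfold allocated in hx; fold y in hx.
    apply other; lia.
  + intros x q hq.
    destruct (Nat.eq_dec x a) as [->|h1].
    { assert (q = u) as ->; [|auto].
      destruct ha as (_ & _ & h2 & h3), hq as (_ & _ & h4 & h5).
      destruct q, u; cbn in *; f_equal; congruence. }
    eapply node_eq; [eauto|fold y; lia|]. apply other; auto.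
    destruct hq as [h3 _]; unfold allocated in h3; fold y in h3; lia.
  + intros x; cbn; fold y; lia.
Qed.

(** * Processing the items *)

(** Uses the real registers 16 and 17. *)
Definition dist2_code (u v w : nat) : list instr :=
  [ROp OpSub 16 u v; ROp OpSub 17 (S u) (S v);
   ROp OpMul 16 16 16; ROp OpMul 17 17 17; ROp OpAdd w 16 17]%nat.

(** The product of the squared distances to the two ends vanishes exactly when the point is one of
    them, so a single real comparison decides whether to insert. The ends are reloaded in every
    round because the current vertex moves. *)
Definition points_code : cmd :=
  While (TNot (WEq 7 9))
    (Seq (block ([RLoad 0 7 0; RLoad 1 7 1; RLoad 2 4 0; RLoad 3 4 1;
                  RLoad 4 6 0; RLoad 5 6 1] ++
                 dist2_code 0 2 6 ++ dist2_code 0 4 7 ++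
                 [ROp OpMul 18 6 7; RConst 9 0]))
    (Seq (If (REq 18 9) Skip insert_code)
         (block [WLoad 7 7 0]))).

Lemma point_eta (x y : R) (p : point) : x = fst p -> y = snd p -> (x, y) = p.
Proof. destruct p; cbn; congruence. Qed.

Lemma keeps_trans (b1 b2 b : list nat) (s s1 s2 : state) :
  keeps_except b1 s s1 -> keeps_except b2 s1 s2 -> incl b1 b -> incl b2 b ->
  keeps_except b s s2.
Proof.
intros h1 h2 i1 i2 j hj.
rewrite h2, h1; auto.
Qed.

Lemma NoDup_app_disjoint {T : Type} (l m : list T) :
  NoDup (l ++ m) -> forall x, In x l -> ~ In x m.
Proof.
induction l as [|y l IH]; cbn; [tauto|]; intros hn.
inversion hn as [|? ? h1 h2]; subst.
intros x [->|h] h'; [apply h1, in_or_app; auto|apply (IH h2 x h h')].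
Qed.

Lemma kind_right_part (e : edge) (p : point) : kind_of (right_part e p) = kind_of e.
Proof. unfold kind_of, right_part; cbn; destruct (app e); auto. Qed.

Ltac inclusion := intros ? ?; cbn in *; tauto.

Lemma reach_points (pts : list point) :
  forall (s : state) (e : edge) (a z : nat) (ads pads : list nat),
  wreg s 4 = a -> wreg s 6 = z -> wreg s 8 = 1%nat -> wreg s 9 = 0%nat ->
  wreg s 12 = kind_of e -> seg s a [e] z ads -> NoDup ads -> node s z 0 (dst e) ->
  stores_points s (wreg s 7) pts pads -> (forall x, In x pads -> ~ In x ads) ->
  reach points_code s (1 + 260 * length pts) (fun s' => exists ads1 ads2,
    seg s' a (fst (cut e pts)) (wreg s' 4) ads1 /\
    seg s' (wreg s' 4) [snd (cut e pts)] z ads2 /\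
    NoDup (ads1 ++ ads2) /\ evolves s ads s' (ads1 ++ ads2) /\
    keeps_except [4; 5; 7; 10; 11]%nat s s').
Proof.
induction pts as [|p pts IH]; intros s e a z ads pads w4 w6 w8 w9 w12 hseg hnd hz hpts hdis.
- apply reach_while_end; [| |cbn; lia].
  + cbn; destruct pads; cbn in hpts; [|tauto]; rewrite w9; tauto.
  + exists [], ads; cbn [cut fst snd seg List.app]; rewrite w4.
    split; [auto|]; split; [auto|]; split; [auto|].
    split; [apply same_mem_evolves; repeat split|intros j _; auto].
- destruct pads as [|q pads]; cbn in hpts; [tauto|].
  destruct hpts as (hq & aq & hp1 & hp2 & hpts).
  assert (hu : node s a 0 (src e)) by apply hseg.
  assert (hq0 : (0 < q)%nat) by apply aq.
  pose (body := reach_while_step (TNot (WEq 7 9))).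
  (* After a round, [d] is the finished part, empty or one edge, and [e'] is the edge still open, of
     the same kind as [e] and leading to the same node. *)
  eapply body with (n1 := 258%nat) (n2 := (1 + 260 * length pts)%nat)
    (R := fun s' => exists e' b l1 l2 d,
       seg s' a d b l1 /\ seg s' b [e'] z l2 /\ NoDup (l1 ++ l2) /\
       evolves s ads s' (l1 ++ l2) /\ wreg s' 4 = b /\
       keeps_except [4; 5; 7; 10; 11]%nat s s' /\
       node s' z 0 (dst e') /\ kind_of e' = kind_of e /\
       stores_points s' (wreg s' 7) pts pads /\
       d ++ fst (cut e' pts) = fst (cut e (p :: pts)) /\
       snd (cut e' pts) = snd (cut e (p :: pts))); clear body.
  + cbn; rewrite w9, hq; lia.
  + eapply (reach_seq _ _ _ 20 236) with (R := fun s' => same_mem s s' /\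
      wreg s' = wreg s /\ (rreg s' 0, rreg s' 1) = p /\
      (rreg s' 2, rreg s' 3) = src e /\ (rreg s' 4, rreg s' 5) = dst e /\
      rreg s' 18 = dist2 p (src e) * dist2 p (dst e) /\ rreg s' 9 = 0); [| |lia].
    { apply reach_block; [| |cbn; lia].
      - destruct hu as [hu _], hz as [hz _]; unfold allocated in *.
        cbn; unfold allocated; cbn; rewrite hq, w4, w6; repeat split; lia.
      - destruct hu as (_ & _ & hu1 & hu2), hz as (_ & _ & hz1 & hz2).
        split; [repeat split|]; split; [reflexivity|].
        cbn; rewrite hq, w4, w6, hp1, hp2, hu1, hu2, hz1, hz2.
        repeat split; apply point_eta; auto. }
    intros s1 (m1 & wr1 & r0 & r2 & r4 & r18 & r9).
    eapply (reach_seq _ _ _ 230 4) with (R := fun s' => exists e' b l1 l2 d,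
       seg s' a d b l1 /\ seg s' b [e'] z l2 /\ NoDup (l1 ++ l2) /\
       evolves s ads s' (l1 ++ l2) /\ wreg s' 4 = b /\
       keeps_except [4; 5; 10; 11]%nat s s' /\
       node s' z 0 (dst e') /\ kind_of e' = kind_of e /\
       d ++ fst (cut e' pts) = fst (cut e (p :: pts)) /\
       snd (cut e' pts) = snd (cut e (p :: pts))); [| |lia].
    { apply (reach_if _ _ _ _ 220); [| |lia]; cbn [holds]; rewrite r18, r9; intros h0.
      - apply reach_skip; [|lia].
        exists e, a, [], ads, [].
        split; [cbn; auto|]; split; [eapply seg_same; eauto|]; split; [auto|].
        split; [apply same_mem_evolves; auto|]; split; [rewrite wr1; auto|].
        split; [intros j _; rewrite wr1; auto|].
        split; [eapply node_same; eauto|]; split; [auto|].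
        assert (p = src e \/ p = dst e) as h.
        { apply Rmult_integral in h0; rewrite !dist2_eq0 in h0; auto. }
        cbn [cut List.app]; destruct (point_dec p (src e)); [auto|].
        destruct (point_dec p (dst e)); [auto|tauto].
      - eapply reach_mono; [eapply (reach_insert s1 e a z ads p); rewrite ?wr1; auto;
          eapply seg_same; eauto|lia|].
        intros s2 (l1 & l2 & h1 & h2 & h3 & h4 & h5).
        assert (hev := evolves_same_l _ _ _ _ _ m1 h4).
        exists (right_part e p), (wreg s2 4), l1, l2, [left_part e p].
        split; [auto|]; split; [auto|]; split; [auto|].
        split; [auto|]; split; [auto|].
        split; [intros j hj; rewrite h5, wr1; auto|].
        split; [apply hev; auto|]; split; [apply kind_right_part|].
        cbn [cut]. destruct (point_dec p (src e)) as [h|h].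
        { exfalso; apply h0; rewrite (proj2 (dist2_eq0 _ _) h); ring. }
        destruct (point_dec p (dst e)) as [h'|h'].
        { exfalso; apply h0; rewrite (proj2 (dist2_eq0 _ _) h'); ring. }
        auto. }
    intros s2 (e' & b & l1 & l2 & d & c1 & c2 & c3 & c4 & c5 & c6 & c7 & c8 & c9 & c10).
    assert (aq2 : allocated s2 q) by (destruct c4 as [hf _]; unfold allocated in *; lia).
    assert (eq2 : mem_eq_at s s2 q).
    { apply c4; auto; apply hdis; cbn; auto. }
    assert (h7 : wreg s2 7 = q) by (rewrite c6; auto; cbn; lia).
    apply reach_block; [cbn; rewrite h7; auto| |cbn; lia].
    set (s3 := run_block [WLoad 7 7 0]%nat s2).
    assert (m3 : same_mem s2 s3) by (repeat split).
    exists e', b, l1, l2, d.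
    split; [eapply seg_same; eauto|]; split; [eapply seg_same; eauto|].
    split; [auto|]; split; [eapply evolves_same_r; eauto|].
    split; [cbn; auto|]; split.
    { intros j hj; rewrite <- c6 by (cbn in *; tauto); cbn; unfold upd.
      destruct (Nat.eqb_spec j 7); auto; subst; cbn in hj; tauto. }
    split; [eapply node_same; eauto|]; split; [auto|].
    split; [|auto].
    replace (wreg s3 7) with (wmem s q 0).
    { eapply stores_points_evolves; [eapply evolves_same_r; eauto| |].
      - exact hpts.
      - intros x hx; apply hdis; cbn; auto. }
    cbn; rewrite h7; symmetry; apply eq2.
  + intros s' (e' & b & l1 & l2 & d & c1 & c2 & c3 & c4 & c5 & c6 & c7 & c8 & c9 & c10 & c11).
    (* The nodes of the point list were allocated in [s], whereas inserted nodes are fresh, so the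
       two cannot collide. *)
    assert (hdis' : forall x, In x pads -> ~ In x l2).
    { intros x hx h. destruct c4 as (_ & _ & _ & hg).
      destruct (hg x) as [h'|h']; [apply in_or_app; auto|revert h'; apply hdis; cbn; auto|].
      assert (hx' : allocated s x).
      { revert hpts hx; clear; generalize (wmem s q 0).
        revert pads; induction pts as [|p pts IH]; intros [|q' pads] h; cbn; try tauto.
        intros (-> & ha & _ & _ & hr) [->|hx]; eauto. }
      unfold allocated in hx'; lia. }
    eapply reach_mono; [eapply (IH s' e' b z l2 pads); auto|lia|].
    * rewrite c6; auto; cbn; lia.
    * rewrite c6; auto; cbn; lia.
    * rewrite c6; auto; cbn; lia.
    * rewrite c6, c8; auto; cbn; lia.
    * eapply NoDup_app_remove_l; eauto.
    * intros s2 (m1 & m2 & d1 & d2 & d3 & d4 & d5).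
      exists (l1 ++ m1), m2; rewrite <- c10, <- c11.
      split.
      { apply seg_app; exists b, l1, m1; split; auto; split; auto.
        eapply seg_evolves; eauto; apply NoDup_app_disjoint; auto. }
      split; [auto|]. rewrite <- app_assoc.
      split.
      { eapply evolves_NoDup; eauto; eapply seg_allocated; eauto. }
      split; [|eapply keeps_trans; eauto; inclusion].
      eapply evolves_trans; [exact c4|exact d4| |].
      { intros x hx; apply in_or_app; auto. }
      { intros x hx; apply in_app_or in hx; destruct hx; auto.
        left; apply in_or_app; auto. }
  + cbn [length]; lia.
Qed.

(** * Treating one item *)

Definition locate_code : cmd :=
  Seq (block [WLoad 5 4 1; WLoad 12 5 0])
      (If (WEq 12 8) (block [WLoad 6 5 1]) (block [WMove 6 5])).

(** The kind of the node after a vertex separates arcs from segments: on a segment that node is the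
    target vertex, whose kind is 0. *)
Lemma reach_locate (s : state) (e : edge) (a z : nat) (ads : list nat) :
  wreg s 4 = a -> wreg s 8 = 1%nat -> seg s a [e] z ads -> node s z 0 (dst e) ->
  reach locate_code s 6 (fun s' => same_mem s s' /\ rreg s' = rreg s /\
    keeps_except [5; 6; 12]%nat s s' /\ wreg s' 6 = z /\ wreg s' 12 = kind_of e).
Proof.
intros w4 w8 [ha hseg] hz; unfold kind_of.
assert (hb : allocated s (wmem s a 1) /\
  wmem s (wmem s a 1) 0 = match app e with Some _ => 1%nat | None => 0%nat end /\
  match app e with Some _ => wmem s (wmem s a 1) 1 | None => wmem s a 1 end = z).
{ destruct (app e).
  - destruct hseg as (hb & ads' & -> & hd & _); destruct hb as (h1 & h2 & _); auto.
  - destruct hseg as (ads' & -> & hd & _); rewrite hd; destruct hz as (h1 & h2 & _); auto. }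
destruct hb as (hb1 & hb2 & hb3).
eapply (reach_seq _ _ _ 3 3) with (R := fun s' => same_mem s s' /\ rreg s' = rreg s /\
  keeps_except [5; 12]%nat s s' /\ wreg s' 5 = wmem s a 1 /\
  wreg s' 12 = match app e with Some _ => 1%nat | None => 0%nat end); [| |lia].
{ apply reach_block; [| |cbn; lia].
  - cbn; rewrite w4; split; [apply ha|auto].
  - split; [repeat split|]; split; [auto|]; cbn; rewrite w4.
    split; [|auto]. intros j hj; cbn in *; updates; tauto. }
intros s1 ((m1 & m2 & m3) & r1 & k1 & w5 & w12).
apply (reach_if _ _ _ _ 2); [| |lia]; cbn [holds]; rewrite w12, (k1 8%nat), w8 by (cbn; lia);
  intros h; (apply reach_block; [| |cbn; lia]).
- cbn; unfold allocated in *; rewrite w5, m3; auto.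
- split; [repeat split; auto|]; split; [auto|]; split.
  { intros j hj; rewrite <- k1 by (cbn in *; tauto); cbn in *; updates; tauto. }
  split; [|exact w12]. cbn; rewrite w5, m1.
  destruct (app e); [auto|discriminate].
- cbn; auto.
- split; [repeat split; auto|]; split; [auto|]; split.
  { intros j hj; rewrite <- k1 by (cbn in *; tauto); cbn in *; updates; tauto. }
  split; [|exact w12]. cbn; rewrite w5.
  destruct (app e); [tauto|auto].
Qed.

Definition process_code : cmd :=
  Seq (block [WLoad 7 13 3])
  (Seq points_code
  (Seq (block ([RLoad 0 13 2; RLoad 1 13 3; RLoad 2 6 0; RLoad 3 6 1] ++
               dist2_code 0 2 6 ++ [RConst 9 0]))
  (Seq (If (REq 6 9) (block [WMove 4 6; WConst 15 0]) (block [WConst 15 1]))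
       (block [WLoad 13 13 0])))).

(** Between two pieces of one arc the outcome of the source test is overwritten by 0, a forced
    match: the piece may start on the centre line, while the current vertex is the last one
    inserted. *)
Definition item_code : cmd :=
  Seq locate_code
  (Seq (block ([RLoad 0 13 0; RLoad 1 13 1; RLoad 2 4 0; RLoad 3 4 1] ++
               dist2_code 0 2 6 ++ [RConst 9 0]))
  (Seq (If (WEq 15 8) (block [RConst 6 0]) Skip)
       (If (REq 6 9) process_code (block [WMove 4 6])))).

Definition scratch : list nat := [4; 5; 6; 7; 10; 11; 12; 13; 15]%nat.

Lemma stores_points_allocated (s : state) (l : list point) :
  forall h g, stores_points s h l g -> forall x, In x g -> allocated s x.
Proof.
induction l as [|p l IH]; intros h [|q g]; cbn; try tauto.
intros (-> & ha & _ & _ & hr) x [->|hx]; eauto.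
Qed.

Lemma stores_items_allocated (s : state) (S : list item) :
  forall h g, stores_items s h S g -> forall x, In x g -> allocated s x.
Proof.
induction S as [|it S IH]; intros h g; cbn.
- intros [-> _]; cbn; tauto.
- intros (g1 & g2 & -> & ha & _ & _ & _ & _ & _ & _ & h1 & h2) x [<-|hx]; auto.
  apply in_app_or in hx; destruct hx; [eapply stores_points_allocated|]; eauto.
Qed.

(** [y] is the start of the open part. It is named apart from register 4, which has advanced to [z]
    if the item ends the edge. *)
Lemma reach_item (s : state) (e : edge) (a z : nat) (ads : list nat)
    (it : item) (S : list item) (g : list nat) :
  wreg s 4 = a -> wreg s 8 = 1%nat -> wreg s 9 = 0%nat ->
  wreg s 15 = 1%nat \/ wreg s 15 = 0%nat /\ src (item_edge it) = src e ->
  seg s a [e] z ads -> NoDup ads -> node s z 0 (dst e) ->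
  stores_items s (wreg s 13) (it :: S) g -> (forall x, In x g -> ~ In x ads) ->
  reach item_code s (90 + 260 * length (item_points it)) (fun s' =>
    exists ads1 ads2 y g',
    seg s' a (fst (cut e (item_points it))) y ads1 /\
    seg s' y [snd (cut e (item_points it))] z ads2 /\
    NoDup (ads1 ++ ads2) /\ evolves s ads s' (ads1 ++ ads2) /\
    keeps_except scratch s s' /\
    (dst (item_edge it) = dst e -> wreg s' 4 = z /\ wreg s' 15 = 0%nat) /\
    (dst (item_edge it) <> dst e -> wreg s' 4 = y /\ wreg s' 15 = 1%nat) /\
    stores_items s' (wreg s' 13) S g' /\ incl g' g).
Proof.
intros w4 w8 w9 w15 hseg hnd hz hit hdis.
assert (hit' := hit). cbn [stores_items] in hit'.
destruct hit' as (g1 & g2 & -> & hi & _ & i0 & i1 & i2 & i3 & _ & hpts & hrest).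
set (i := wreg s 13) in *.
assert (hu : node s a 0 (src e)) by apply hseg.
eapply (reach_seq _ _ _ 6 (84 + 260 * length (item_points it)))
  with (1 := reach_locate s e a z ads w4 w8 hseg hz); [|lia].
intros s1 (m1 & r1 & k1 & w6 & w12).
eapply (reach_seq _ _ _ 15 (69 + 260 * length (item_points it)))
  with (R := fun s' => same_mem s s' /\
    keeps_except [5; 6; 12]%nat s s' /\ wreg s' 6 = z /\ wreg s' 12 = kind_of e /\
    rreg s' 6 = dist2 (src (item_edge it)) (src e) /\ rreg s' 9 = 0); [| |lia].
{ destruct m1 as (mw & mr & mf).
  apply reach_block; [| |cbn; lia].
  - destruct hu as [hu _]; unfold allocated in *.
    cbn; unfold allocated; cbn; rewrite !(k1 13%nat), !(k1 4%nat), w4, mf by (cbn; lia).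
    fold i; repeat split; lia.
  - destruct hu as (_ & _ & hu1 & hu2).
    split; [repeat split; cbn; auto|]; split; [exact k1|].
    cbn; rewrite !(k1 13%nat), !(k1 4%nat), w4, mr by (cbn; lia).
    fold i; rewrite i0, i1, hu1, hu2; auto. }
intros s2 (m2 & k2 & w6' & w12' & r6 & r9).
eapply (reach_seq _ _ _ 4 (65 + 260 * length (item_points it)))
  with (R := fun s' => same_mem s s' /\
    keeps_except [5; 6; 12]%nat s s' /\ wreg s' 6 = z /\ wreg s' 12 = kind_of e /\
    rreg s' 6 = 0 /\ rreg s' 9 = 0); [| |lia].
{ apply (reach_if _ _ _ _ 3); [| |lia]; cbn [holds];
    rewrite (k2 15%nat), (k2 8%nat), w8 by (cbn; lia); intros h.
  - apply reach_block; [cbn; tauto| |cbn; lia]. repeat split; auto; apply m2.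
  - apply reach_skip; [|lia]. destruct w15 as [h'|[_ h']]; [contradiction|].
    rewrite (proj2 (dist2_eq0 _ _) h') in r6; auto 10. }
clear s1 m1 r1 k1 w6 w12 s2 m2 k2 w6' w12' r6 r9.
intros s1 (m1 & k1 & w6 & w12 & r6 & r9).
apply (reach_if _ _ _ _ (64 + 260 * length (item_points it))); [intros _| |lia].
2:{ cbn; rewrite r6, r9; tauto. }
unfold process_code.
eapply (reach_seq _ _ _ 2 (62 + 260 * length (item_points it)))
  with (R := fun s' => same_mem s s' /\
    keeps_except [5; 6; 7; 12]%nat s s' /\ wreg s' 6 = z /\ wreg s' 12 = kind_of e /\
    wreg s' 7 = wmem s i 3); [| |lia].
{ destruct m1 as (mw & mr & mf). apply reach_block; [| |cbn; lia].
  - cbn; unfold allocated in *; rewrite (k1 13%nat), mf by (cbn; lia); auto.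
  - split; [repeat split; auto|]; split.
    { intros j hj; rewrite <- k1 by (cbn in *; tauto); cbn in *; updates; tauto. }
    split; [auto|]; split; [auto|].
    cbn; rewrite (k1 13%nat), mw by (cbn; lia); auto. }
clear s1 m1 k1 w6 w12 r6 r9.
intros s1 (m1 & k1 & w6 & w12 & w7).
eapply (reach_seq _ _ _ (1 + 260 * length (item_points it)) 61)
  with (R := fun s' => exists ads1 ads2,
    seg s' a (fst (cut e (item_points it))) (wreg s' 4) ads1 /\
    seg s' (wreg s' 4) [snd (cut e (item_points it))] z ads2 /\
    NoDup (ads1 ++ ads2) /\ evolves s ads s' (ads1 ++ ads2) /\
    keeps_except [4; 5; 6; 7; 10; 11; 12]%nat s s' /\ wreg s' 6 = z); [| |lia].
{ eapply reach_mono; [apply (reach_points (item_points it) s1 e a z ads g1)|lia|]; auto.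
  - rewrite (k1 4%nat) by (cbn; lia); auto.
  - rewrite (k1 8%nat) by (cbn; lia); auto.
  - rewrite (k1 9%nat) by (cbn; lia); auto.
  - eapply seg_same; eauto.
  - eapply node_same; eauto.
  - rewrite w7; eapply stores_points_evolves;
      [apply (same_mem_evolves _ _ []); eauto|eauto|cbn; tauto].
  - intros x hx; apply hdis; right; apply in_or_app; auto.
  - intros s2 (l1 & l2 & c1 & c2 & c3 & c4 & c5).
    exists l1, l2; split; [auto|]; split; [auto|]; split; [auto|].
    split; [eapply evolves_same_l; eauto|].
    split; [eapply keeps_trans; eauto; inclusion|].
    rewrite c5; auto; cbn; lia. }
clear s1 m1 k1 w6 w12 w7.
intros s1 (l1 & l2 & c1 & c2 & c3 & c4 & k1 & w6).
assert (w13 : wreg s1 13 = i) by (apply k1; cbn; lia).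
assert (hi1 : allocated s1 i) by (destruct c4 as [hf _]; unfold allocated in *; lia).
assert (mi : mem_eq_at s s1 i).
{ apply c4; auto; apply hdis; cbn; auto. }
assert (hz1 : node s1 z 0 (dst e)) by (apply c4; auto).
set (y := wreg s1 4) in *.
eapply (reach_seq _ _ _ 15 46)
  with (R := fun s' => same_mem s1 s' /\ wreg s' = wreg s1 /\
    rreg s' 6 = dist2 (dst (item_edge it)) (dst e) /\ rreg s' 9 = 0); [| |lia].
{ apply reach_block; [| |cbn; lia].
  - destruct hz1 as [hz1 _]; cbn; rewrite w13, w6; unfold allocated in *; cbn.
    repeat split; lia.
  - destruct hz1 as (_ & _ & hz1 & hz2).
    split; [repeat split; auto|]; split; [auto|].
    cbn; rewrite w13, w6, hz1, hz2, (proj2 (mi 2%nat)), (proj2 (mi 3%nat)), i2, i3; auto. }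
intros s2 (m2 & wr2 & r6 & r9).
eapply (reach_seq _ _ _ 5 41)
  with (R := fun s' => same_mem s1 s' /\ keeps_except [4; 15]%nat s1 s' /\
    (dst (item_edge it) = dst e -> wreg s' 4 = z /\ wreg s' 15 = 0%nat) /\
    (dst (item_edge it) <> dst e -> wreg s' 4 = y /\ wreg s' 15 = 1%nat)); [| |lia].
{ apply (reach_if _ _ _ _ 4); [| |lia]; cbn [holds]; rewrite r6, r9, dist2_eq0; intros h;
    (apply reach_block; [cbn; tauto| |cbn; lia]).
  - split; [repeat split; apply m2|]; split.
    { intros j hj; rewrite <- wr2; cbn in *; updates; tauto. }
    split; [|contradiction]. intros _; cbn; rewrite wr2; auto.
  - split; [repeat split; apply m2|]; split.
    { intros j hj; rewrite <- wr2; cbn in *; updates; tauto. }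
    split; [contradiction|]. intros _; cbn; rewrite wr2; auto. }
clear s2 m2 wr2 r6 r9.
intros s2 (m2 & k2 & d1 & d2).
assert (w13' : wreg s2 13 = i) by (rewrite k2; auto; cbn; lia).
apply reach_block; [| |cbn; lia].
{ cbn; rewrite w13'; destruct m2 as (_ & _ & mf); unfold allocated in *.
  rewrite mf; auto. }
set (s3 := run_block [WLoad 13 13 0]%nat s2).
assert (m3 : same_mem s1 s3) by (destruct m2 as (? & ? & ?); repeat split; auto).
assert (hev : evolves s ads s3 (l1 ++ l2)) by (eapply evolves_same_r; eauto).
exists l1, l2, y, g2.
split; [eapply seg_same; eauto|]; split; [eapply seg_same; eauto|].
split; [auto|]; split; [auto|]. split.
{ assert (k3 : keeps_except [13]%nat s2 s3)
    by (intros j hj; cbn in *; updates; tauto).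
  eapply keeps_trans; [exact k1| |inclusion|]. 
  - eapply (keeps_trans _ _ [4; 13; 15]%nat); [exact k2|exact k3|inclusion|inclusion].
  - inclusion. }
split; [exact d1|]; split; [exact d2|]; split.
- replace (wreg s3 13) with (wmem s i 0).
  { eapply stores_items_evolves; eauto.
    intros x hx; apply hdis; right; apply in_or_app; auto. }
  cbn; rewrite w13'; destruct m2 as (mw & _); rewrite mw; symmetry; apply mi.
- intros x hx; right; apply in_or_app; auto.
Qed.

Lemma reach_skip_edge (s : state) (e : edge) (a z : nat) (ads : list nat)
    (it : item) (S : list item) (g : list nat) :
  wreg s 4 = a -> wreg s 8 = 1%nat -> wreg s 15 = 0%nat ->
  src (item_edge it) <> src e ->
  seg s a [e] z ads -> node s z 0 (dst e) ->
  stores_items s (wreg s 13) (it :: S) g ->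
  reach item_code s 90 (fun s' => same_mem s s' /\ wreg s' 4 = z /\
    keeps_except [4; 5; 6; 12]%nat s s').
Proof.
intros w4 w8 w15 hne hseg hz hit.
cbn [stores_items] in hit.
destruct hit as (g1 & g2 & -> & hi & _ & i0 & i1 & _).
set (i := wreg s 13) in *.
assert (hu : node s a 0 (src e)) by apply hseg.
eapply (reach_seq _ _ _ 6 84)
  with (1 := reach_locate s e a z ads w4 w8 hseg hz); [|lia].
intros s1 (m1 & r1 & k1 & w6 & w12).
eapply (reach_seq _ _ _ 15 69)
  with (R := fun s' => same_mem s s' /\
    keeps_except [5; 6; 12]%nat s s' /\ wreg s' 6 = z /\
    rreg s' 6 = dist2 (src (item_edge it)) (src e) /\ rreg s' 9 = 0); [| |lia].
{ destruct m1 as (mw & mr & mf).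
  apply reach_block; [| |cbn; lia].
  - destruct hu as [hu _]; unfold allocated in *.
    cbn; unfold allocated; cbn; rewrite !(k1 13%nat), !(k1 4%nat), w4, mf by (cbn; lia).
    fold i; repeat split; lia.
  - destruct hu as (_ & _ & hu1 & hu2).
    split; [repeat split; cbn; auto|]; split; [exact k1|].
    cbn; rewrite !(k1 13%nat), !(k1 4%nat), w4, mr by (cbn; lia).
    fold i; rewrite i0, i1, hu1, hu2; auto. }
intros s2 (m2 & k2 & w6' & r6 & r9).
eapply (reach_seq _ _ _ 4 65)
  with (R := fun s' => s' = s2); [| |lia].
{ apply (reach_if _ _ _ _ 3); [| |lia]; cbn [holds];
    rewrite (k2 15%nat), (k2 8%nat), w8, w15 by (cbn; lia); intros h; [discriminate|].
  apply reach_skip; auto; lia. }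
intros ? ->.
apply (reach_if _ _ _ _ 64); [|intros _|lia].
{ cbn; rewrite r6, r9, dist2_eq0; tauto. }
apply reach_block; [cbn; tauto| |cbn; lia].
split; [repeat split; apply m2|]; split; [cbn; auto|].
intros j hj; rewrite <- k2 by (cbn in *; tauto); cbn in *; updates; tauto.
Qed.

Definition items_code : cmd := While (TNot (WEq 13 9)) item_code.

Lemma cut_app (pts pts' : list point) :
  forall e, fst (cut e (pts ++ pts')) =
      fst (cut e pts) ++ fst (cut (snd (cut e pts)) pts') /\
    snd (cut e (pts ++ pts')) = snd (cut (snd (cut e pts)) pts').
Proof.
induction pts as [|p pts IH]; intros e; cbn; [auto|].
destruct (point_dec p (src e)); [auto|].
destruct (point_dec p (dst e)); [auto|].
destruct (IH (right_part e p)) as [h1 h2]; cbn; rewrite h1, h2; auto.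
Qed.

Lemma cut_all_app (e : edge) (pts pts' : list point) :
  cut_all e (pts ++ pts') = fst (cut e pts) ++ cut_all (snd (cut e pts)) pts'.
Proof.
unfold cut_all; destruct (cut_app pts pts' e) as [-> ->].
rewrite app_assoc; auto.
Qed.

Lemma dst_cut (pts : list point) : forall e, dst (snd (cut e pts)) = dst e.
Proof.
induction pts as [|p pts IH]; intros e; cbn; [auto|].
destruct (point_dec p (src e)); [auto|].
destruct (point_dec p (dst e)); [auto|].
cbn; rewrite IH; auto.
Qed.

Lemma weight_cons (it : item) (S : list item) :
  weight (it :: S) = (1 + length (item_points it) + weight S)%nat.
Proof. reflexivity. Qed.

Lemma evolves_disjoint (s s' : state) (ads ads' g : list nat) :
  evolves s ads s' ads' -> (forall x, In x g -> allocated s x) ->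
  (forall x, In x g -> ~ In x ads) -> forall x, In x g -> ~ In x ads'.
Proof.
intros (_ & _ & _ & hg) ha hd x hx h.
destruct (hg x h) as [h'|h']; [eapply hd; eauto|].
specialize (ha x hx); unfold allocated in ha; lia.
Qed.

(** All edges share one loop, so the items of one edge use up some of its iterations and the rest is
    a continuation: [hQ] assumes a bound for the loop from the state reached. An item with p points
    costs at most 1 + 90 + 260 p, which is below 300 (1 + p). *)
Lemma reach_edge_items (its : list item) :
  forall (s : state) (e : edge) (a z : nat) (ads : list nat) (S : list item) (g : list nat),
  ends_at (dst e) its ->
  wreg s 4 = a -> wreg s 8 = 1%nat -> wreg s 9 = 0%nat ->
  wreg s 15 = 1%nat \/ wreg s 15 = 0%nat /\ starts_at (src e) its ->
  seg s a [e] z ads -> NoDup ads -> node s z 0 (dst e) ->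
  stores_items s (wreg s 13) (its ++ S) g -> (forall x, In x g -> ~ In x ads) ->
  forall (n : nat) (Q : state -> Prop),
  (forall s' ads' g',
     seg s' a (cut_all e (concat (map item_points its))) z ads' -> NoDup ads' ->
     evolves s ads s' ads' -> keeps_except scratch s s' ->
     wreg s' 4 = z -> wreg s' 15 = 0%nat ->
     stores_items s' (wreg s' 13) S g' -> incl g' g -> reach items_code s' n Q) ->
  reach items_code s (n + 300 * weight its) Q.
Proof.
induction its as [|it its IH];
  intros s e a z ads S g hend w4 w8 w9 w15 hseg hnd hz hit hdis n Q hQ;
  [cbn in hend; tauto|].
assert (hi : allocated s (wreg s 13))
  by (cbn in hit; destruct hit as (? & ? & _ & hi & _); exact hi).
rewrite weight_cons.
eapply reach_while_step with (n2 := (n + 300 * weight its)%nat);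
  [|apply (reach_item s e a z ads it (its ++ S) g); auto| |].
{ cbn; rewrite w9; intros h; rewrite h in hi; unfold allocated in hi; lia. }
{ intros s' (l1 & l2 & y & g' & c1 & c2 & c3 & c4 & c5 & c6 & c7 & c8 & c9).
  destruct hend as [[-> hd]|(hne & hd & hend)].
  - destruct (c6 hd) as [v4 v15].
    eapply reach_mono; [apply (hQ s' (l1 ++ l2) g'); auto|lia|auto].
    cbn [map concat]; rewrite app_nil_r; unfold cut_all.
    apply seg_app; exists y, l1, l2; auto.
  - destruct (c7 hd) as [v4 v15].
    set (e' := snd (cut e (item_points it))) in *.
    assert (ed : dst e' = dst e) by apply dst_cut.
    eapply (IH s' e' y z l2 S g'); auto.
    + rewrite ed; auto.
    + rewrite c5; auto; cbn; lia.
    + rewrite c5; auto; cbn; lia.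
    + eapply NoDup_app_remove_l; eauto.
    + rewrite ed; apply c4; auto.
    + intros x hx h. eapply (evolves_disjoint _ _ _ _ _ c4); [|exact hdis|apply (c9 x hx)|].
      * eapply stores_items_allocated; eauto.
      * apply in_or_app; auto.
    + intros s2 m2 g2 d1 d2 d3 d4 d5 d6 d7 d8.
      apply (hQ s2 (l1 ++ m2) g2); auto.
      * cbn [map concat]; rewrite cut_all_app; apply seg_app.
        exists y, l1, m2; split; auto; split; auto.
        eapply seg_evolves; eauto; apply NoDup_app_disjoint; auto.
      * eapply evolves_NoDup; eauto; eapply seg_allocated; eauto.
      * eapply evolves_trans; [exact c4|exact d3| |].
        { intros x hx; apply in_or_app; auto. }
        { intros x hx; apply in_app_or in hx; destruct hx; auto.
          left; apply in_or_app; auto. }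
      * eapply keeps_trans; eauto; inclusion.
      * eapply incl_tran; eauto. }
lia.
Qed.

(** * The item loop on a list of groups *)

Definition singles (es : list edge) : list (list edge) := map (fun e => [e]) es.

Lemma aligned_no_items (es : list edge) (S : list item) (G : list (list edge)) :
  aligned es S G -> S = [] -> G = singles es.
Proof.
induction 1 as [|e es S G _ _ IH|e es its S G h _ _ _]; intros hS; cbn; auto.
- rewrite IH; auto.
- destruct its; [cbn in h; tauto|discriminate].
Qed.

(** A refinement of [seg] that records in [bs] the node at which each group of
    edges starts. *)
Fixpoint gseg (s : state) (a : nat) (G : list (list edge)) (bs : list nat) (z : nat)
    (ads : list nat) : Prop :=
  match G, bs with
  | [], [] => a = z /\ ads = []
  | g :: G', b :: bs' => a = b /\
      exists y l1 l2, ads = l1 ++ l2 /\ seg s a g y l1 /\ gseg s y G' bs' z l2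
  | _, _ => False
  end.

Lemma gseg_seg (s : state) (z : nat) (G : list (list edge)) :
  forall a bs ads, gseg s a G bs z ads -> seg s a (concat G) z ads.
Proof.
induction G as [|g G IH]; intros a [|b bs] ads; cbn; try tauto.
intros (_ & y & l1 & l2 & -> & h1 & h2).
apply seg_app; exists y, l1, l2; eauto.
Qed.

Lemma gseg_allocated (s : state) (a z : nat) (G : list (list edge)) (bs ads : list nat) :
  gseg s a G bs z ads -> forall x, In x ads -> allocated s x.
Proof. intros h; eapply seg_allocated, gseg_seg; eauto. Qed.

Lemma gseg_evolves (s s' : state) (z : nat) (l l' : list nat) (G : list (list edge)) :
  evolves s l s' l' -> forall a bs ads,
  gseg s a G bs z ads -> (forall x, In x ads -> ~ In x l) -> gseg s' a G bs z ads.
Proof.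
intros hev; induction G as [|g G IH]; intros a [|b bs] ads; cbn; auto.
intros (-> & y & l1 & l2 & -> & h1 & h2) hd; split; auto.
exists y, l1, l2; split; auto.
split; [eapply seg_evolves; eauto|apply IH; auto];
  intros x hx; apply hd, in_or_app; auto.
Qed.

Lemma gseg_same (s s' : state) (a z : nat) (G : list (list edge)) (bs ads : list nat) :
  same_mem s s' -> gseg s a G bs z ads -> gseg s' a G bs z ads.
Proof.
intros h hs; eapply gseg_evolves; [apply (same_mem_evolves s s' []); auto|eauto|].
cbn; tauto.
Qed.

Lemma seg_gseg (s : state) (z : nat) (es : list edge) :
  forall a ads, seg s a es z ads ->
  exists bs, length bs = length es /\ gseg s a (singles es) bs z ads.
Proof.
induction es as [|e es IH]; intros a ads h.
- exists []; auto.
- apply (seg_app s [e] es) in h; destruct h as (y & l1 & l2 & -> & h1 & h2).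
  destruct (IH y l2 h2) as (bs & hl & h3).
  exists (a :: bs); cbn [length singles map gseg]; split; [lia|]; split; auto.
  exists y, l1, l2; auto.
Qed.

Lemma gseg_app (s : state) (z : nat) (G2 : list (list edge)) (bs2 : list nat)
    (G1 : list (list edge)) :
  forall a bs1 ads, length bs1 = length G1 ->
  gseg s a (G1 ++ G2) (bs1 ++ bs2) z ads <->
  exists y l1 l2, ads = l1 ++ l2 /\ gseg s a G1 bs1 y l1 /\ gseg s y G2 bs2 z l2.
Proof.
induction G1 as [|g G1 IH]; intros a [|b bs1] ads hl; cbn in hl; try discriminate.
- cbn; split.
  + intros h; exists a, [], ads; auto.
  + intros (y & l1 & l2 & -> & [-> ->] & h); auto.
- injection hl as hl; cbn; split.
  + intros (-> & y & l1 & l2 & -> & h1 & h2); apply IH in h2; auto.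
    destruct h2 as (w & m1 & m2 & -> & h2 & h3).
    exists w, (l1 ++ m1), m2; split; [rewrite app_assoc; auto|]; split; auto.
    split; auto; exists y, l1, m1; auto.
  + intros (w & m1 & m2 & -> & (-> & y & l1 & l2 & -> & h1 & h2) & h3).
    split; auto; exists y, l1, (l2 ++ m2); split; [rewrite app_assoc; auto|].
    split; auto; apply IH; auto; exists w, l2, m2; auto.
Qed.

Lemma seg_cons (s : state) (e : edge) (es : list edge) (a z : nat) (ads : list nat)
    (zp : point) :
  seg s a (e :: es) z ads -> node s z 0 zp -> edge_chain (src e) (e :: es) zp ->
  exists y l1 l2, ads = l1 ++ l2 /\ seg s a [e] y l1 /\ seg s y es z l2 /\
    node s y 0 (dst e) /\ edge_chain (dst e) es zp.
Proof.
intros h hz [_ hc]; apply (seg_app s [e] es z a ads) in h.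
destruct h as (y & l1 & l2 & -> & h1 & h2).
exists y, l1, l2; split; [auto|]; split; [auto|]; split; [auto|]; split; [|auto].
destruct es as [|f es]; cbn in hc, h2.
- destruct h2 as [-> _]; subst; auto.
- destruct hc as [<- _]; apply h2.
Qed.

Lemma gseg_cons (s : state) (e : edge) (es : list edge) (a z : nat) (bs ads : list nat)
    (ap zp : point) :
  gseg s a (singles (e :: es)) bs z ads -> node s z 0 zp -> edge_chain ap (e :: es) zp ->
  exists bs' y l1 l2, bs = a :: bs' /\ ads = l1 ++ l2 /\ seg s a [e] y l1 /\
    gseg s y (singles es) bs' z l2 /\ node s y 0 (dst e) /\ edge_chain (dst e) es zp.
Proof.
destruct bs as [|b bs]; [cbn; tauto|].
intros (<- & y & l1 & l2 & -> & h1 & h2) hz [_ hc].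
exists bs, y, l1, l2; split; [auto|]; split; [auto|]; split; [auto|]; split; [auto|].
split; [|auto]. apply gseg_seg in h2.
destruct es as [|f es]; cbn in hc, h2.
- destruct h2 as [-> _]; subst; auto.
- destruct hc as [<- _]; apply h2.
Qed.

(** The list [bs] is the same before and after: every group starts at the node where its edge
    started. This is what later identifies the first node of the rotated list. *)
Lemma reach_items (es : list edge) (S : list item) (G : list (list edge)) :
  aligned es S G ->
  forall (s : state) (a z : nat) (bs ads g : list nat) (ap zp : point),
  edge_chain ap es zp -> gseg s a (singles es) bs z ads -> NoDup ads -> node s z 0 zp ->
  wreg s 4 = a -> wreg s 8 = 1%nat -> wreg s 9 = 0%nat -> wreg s 15 = 0%nat ->
  stores_items s (wreg s 13) S g -> (forall x, In x g -> ~ In x ads) ->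
  reach items_code s (1 + 300 * weight S + 100 * length es) (fun s' => exists ads',
    gseg s' a G bs z ads' /\ NoDup ads' /\ evolves s ads s' ads' /\
    keeps_except scratch s s').
Proof.
induction 1 as [|e es S G hst hal IH|e es its S G hst hend hal IH];
  intros s a z bs ads g ap zp hch hseg hnd hz w4 w8 w9 w15 hit hdis.
- apply reach_while_end; [| |lia].
  + cbn in *; destruct hit as [_ h]; rewrite h, w9; tauto.
  + exists ads; split; [auto|]; split; [auto|].
    split; [apply same_mem_evolves; repeat split|intros j _; auto].
(* When the items are exhausted the loop stops although edges remain; these form groups of one
   edge. *)
- destruct S as [|it S].
  { apply reach_while_end; [| |lia].
    + cbn in *; destruct hit as [_ h]; rewrite h, w9; tauto.
    + exists ads; rewrite (aligned_no_items _ _ _ hal) by auto.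
      split; [auto|]; split; [auto|].
      split; [apply same_mem_evolves; repeat split|intros j _; auto]. }
  destruct (gseg_cons s e es a z bs ads ap zp hseg hz hch)
    as (bs' & y & l1 & l2 & -> & -> & h1 & h2 & h3 & h4).
  assert (hi : allocated s (wreg s 13))
    by (cbn in hit; destruct hit as (? & ? & _ & hi & _); exact hi).
  eapply reach_while_step
    with (n1 := 90%nat) (n2 := (1 + 300 * weight (it :: S) + 100 * length es)%nat);
    [|eapply (reach_skip_edge s e a y l1 it S g); eauto| |cbn [length]; lia].
  { cbn; rewrite w9; intros h; rewrite h in hi; unfold allocated in hi; lia. }
  intros s1 (m1 & v4 & k1).
  eapply reach_mono; [eapply (IH s1 y z bs' l2 g (dst e) zp); auto|lia|].
  + eapply gseg_same; eauto.
  + eapply NoDup_app_remove_l; eauto.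
  + eapply node_same; eauto.
  + rewrite k1; auto; cbn; lia.
  + rewrite k1; auto; cbn; lia.
  + rewrite k1; auto; cbn; lia.
  + rewrite k1 by (cbn; lia).
    eapply stores_items_evolves; [apply (same_mem_evolves _ _ []); eauto|eauto|cbn; tauto].
  + intros x hx h; apply (hdis x hx), in_or_app; auto.
  + intros s2 (l2' & d1 & d2 & d3 & d4).
    exists (l1 ++ l2'); split; [|split; [|split]].
    * split; [auto|]; exists y, l1, l2'; split; auto; split; auto.
      eapply seg_evolves; [eapply seg_same; eauto|exact d3|].
      apply NoDup_app_disjoint; auto.
    * eapply evolves_NoDup; [exact hnd| |eapply evolves_same_l; eauto|auto].
      eapply seg_allocated; eauto.
    * eapply evolves_trans; [apply (same_mem_evolves s s1 (l1 ++ l2)); auto|exact d3| |].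
      { intros x hx; apply in_or_app; auto. }
      { intros x hx; apply in_app_or in hx; destruct hx; auto.
        left; apply in_or_app; auto. }
    * eapply keeps_trans; eauto; inclusion.
- destruct (gseg_cons s e es a z bs ads ap zp hseg hz hch)
    as (bs' & y & l1 & l2 & -> & -> & h1 & h2 & h3 & h4).
  rewrite weight_app; cbn [length].
  eapply reach_mono with (n := ((1 + 300 * weight S + 100 * length es) + 300 * weight its)%nat);
    [|lia|intros s' h; exact h].
  assert (hdis1 : forall x, In x g -> ~ In x l1).
  { intros x hx h; apply (hdis x hx), in_or_app; auto. }
  assert (hdis2 : forall x, In x g -> ~ In x l2).
  { intros x hx h; apply (hdis x hx), in_or_app; auto. }
  eapply (reach_edge_items its s e a y l1 S g); auto.
  + eapply NoDup_app_remove_r; eauto.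
  + intros s1 l1' g' c1 c2 c3 c4 c5 c6 c7 c8.
    assert (hd12 : forall x, In x l2 -> ~ In x l1).
    { intros x h h'; revert x h' h; apply NoDup_app_disjoint; auto. }
    assert (a2 : forall x, In x l2 -> allocated s x) by (eapply gseg_allocated; eauto).
    assert (hd12' := evolves_disjoint _ _ _ _ _ c3 a2 hd12).
    eapply reach_mono; [eapply (IH s1 y z bs' l2 g' (dst e) zp); auto|lia|].
    * eapply gseg_evolves; eauto.
    * eapply NoDup_app_remove_l; eauto.
    * apply c3; auto.
    * rewrite c4; auto; cbn; lia.
    * rewrite c4; auto; cbn; lia.
    * intros s2 (l2' & d1 & d2 & d3 & d4).
      assert (n12 : NoDup (l1' ++ l2)).
      { apply NoDup_app; auto; [eapply NoDup_app_remove_l; eauto|].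
        intros x hx h; eapply hd12'; eauto. }
      exists (l1' ++ l2'); split; [|split; [|split]].
      -- split; [auto|]; exists y, l1', l2'; split; auto; split; auto.
         eapply seg_evolves; [eauto|exact d3|].
         apply NoDup_app_disjoint; auto.
      -- eapply evolves_NoDup; [exact n12| |eauto|auto].
         eapply seg_allocated; eauto.
      (* The change of [l1] is framed by the untouched [l2], so that it composes with the change of
         [l2]. *)
      -- assert (c3' : evolves s (l1 ++ l2) s1 (l1' ++ l2)).
         { destruct c3 as (e1 & e2 & e3 & e4); split; [auto|]; split; [|split; auto].
           - intros x hx h; apply e2; auto; intros h'; apply h, in_or_app; auto.
           - intros x hx; apply in_app_or in hx; destruct hx as [hx|hx].
             + destruct (e4 x hx); auto; left; apply in_or_app; auto.
             + left; apply in_or_app; auto. }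
         eapply evolves_trans; [exact c3'|exact d3| |].
         { intros x hx; apply in_or_app; auto. }
         { intros x hx; apply in_app_or in hx; destruct hx; auto.
           left; apply in_or_app; auto. }
      -- eapply keeps_trans; eauto; inclusion.
Qed.

(** The stored list and the item list may begin at different vertices. The edges [xs] in front of
    the first item fail the source test and are passed without a change of memory; the loop then
    continues from [z]. *)
Lemma reach_sync (it : item) (S : list item) (xs : list edge) :
  forall (s : state) (a z : nat) (ads g : list nat) (ap zp : point),
  edge_chain ap xs zp -> seg s a xs z ads -> node s z 0 zp ->
  (forall e, In e xs -> src (item_edge it) <> src e) ->
  wreg s 4 = a -> wreg s 8 = 1%nat -> wreg s 9 = 0%nat -> wreg s 15 = 0%nat ->
  stores_items s (wreg s 13) (it :: S) g ->
  forall (n : nat) (Q : state -> Prop),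
  (forall s', same_mem s s' -> wreg s' 4 = z ->
     keeps_except [4; 5; 6; 12]%nat s s' -> reach items_code s' n Q) ->
  reach items_code s (n + 100 * length xs) Q.
Proof.
induction xs as [|e xs IH];
  intros s a z ads g ap zp hch hseg hz hne w4 w8 w9 w15 hit n Q hQ.
- cbn in hseg; destruct hseg as [-> _].
  eapply reach_mono; [apply hQ|lia|auto]; auto; [repeat split|intros j _; auto].
- assert (hch' : edge_chain (src e) (e :: xs) zp) by (split; [auto|apply hch]).
  destruct (seg_cons s e xs a z ads zp hseg hz hch')
    as (y & l1 & l2 & -> & h1 & h2 & h3 & h4).
  assert (hi : allocated s (wreg s 13))
    by (cbn in hit; destruct hit as (? & ? & _ & hi & _); exact hi).
  eapply reach_while_step
    with (n1 := 90%nat) (n2 := (n + 100 * length xs)%nat);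
    [|eapply (reach_skip_edge s e a y l1 it S g); eauto| |cbn [length]; lia].
  { cbn; rewrite w9; intros h; rewrite h in hi; unfold allocated in hi; lia. }
  { apply hne; cbn; auto. }
  intros s1 (m1 & v4 & k1).
  eapply (IH s1 y z l2 g (dst e) zp); auto.
  + eapply seg_same; eauto.
  + eapply node_same; eauto.
  + intros f hf; apply hne; cbn; auto.
  + rewrite k1; auto; cbn; lia.
  + rewrite k1; auto; cbn; lia.
  + rewrite k1; auto; cbn; lia.
  + rewrite k1 by (cbn; lia).
    eapply stores_items_evolves; [apply (same_mem_evolves _ _ []); eauto|eauto|cbn; tauto].
  + intros s2 m2 v4' k2; apply hQ; auto.
    * destruct m1 as (? & ? & ?), m2 as (? & ? & ?); repeat split; congruence.
    * eapply keeps_trans; eauto; inclusion.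
Qed.

(** * Circular lists and backward links *)

(** Inverse to [edges] on closed chains, where targets are determined by the next source. *)
Definition polygon_of (es : list edge) : polygon := map (fun e => (src e, app e)) es.

Lemma edges_until_chain (z : point) (P : polygon) :
  edge_chain (match P with [] => z | (v, _) :: _ => v end) (edges_until z P) z.
Proof.
induction P as [|[v c] P IH]; cbn; auto.
Qed.

Lemma edges_chain (P : polygon) (v : point) (c : option point) (P' : polygon) :
  P = (v, c) :: P' -> edge_chain v (edges P) v.
Proof. intros ->; exact (edges_until_chain v ((v, c) :: P')). Qed.

Lemma polygon_of_edges (P : polygon) : polygon_of (edges P) = P.
Proof.
assert (h : forall z P, polygon_of (edges_until z P) = P).
{ intros z Q; induction Q as [|[v c] Q IH]; cbn; auto.
  unfold polygon_of in IH; rewrite IH; auto. }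
destruct P as [|[v c] P]; [auto|apply h].
Qed.

Lemma edges_polygon_of (es : list edge) (v : point) :
  edge_chain v es v -> edges (polygon_of es) = es.
Proof.
assert (h : forall es u z, edge_chain u es z -> edges_until z (polygon_of es) = es).
{ clear; induction es as [|e es IH]; intros u z; cbn; auto.
  intros [_ hc]; f_equal; [|eapply IH; eauto].
  destruct e as [a c b]; cbn in *; f_equal.
  destruct es as [|f es]; cbn in *; [auto|destruct hc as [-> _]; auto]. }
intros hc; destruct es as [|e es]; [auto|].
change (edges (polygon_of (e :: es)))
  with (edges_until (src e) (polygon_of (e :: es))).
assert (src e = v) by apply hc; subst; eapply h; eauto.
Qed.

Lemma length_edges (P : polygon) : length (edges P) = length P.
Proof.
rewrite <- (polygon_of_edges P) at 2; unfold polygon_of; rewrite length_map; auto.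
Qed.

Lemma src_edges (P : polygon) : map src (edges P) = map fst P.
Proof.
rewrite <- (polygon_of_edges P) at 2; unfold polygon_of; rewrite map_map; auto.
Qed.

Fixpoint consecutive (R : nat -> nat -> Prop) (ads : list nat) (z : nat) : Prop :=
  match ads with
  | [] => True
  | x :: r => R x (hd z r) /\ consecutive R r z
  end.

Lemma consecutive_nth (R : nat -> nat -> Prop) (z : nat) (ads : list nat) :
  consecutive R ads z <->
  forall i, (i < length ads)%nat -> R (nth i ads 0%nat) (nth (S i) (ads ++ [z]) 0%nat).
Proof.
induction ads as [|x r IH]; cbn [consecutive length]; [split; intros; [lia|auto]|].
rewrite IH; split.
- intros [h1 h2] [|i] hi; cbn; [destruct r; auto|apply h2; lia].
- intros h; split; [specialize (h 0%nat); destruct r; cbn in *; apply h; lia|].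
  intros i hi; apply (h (S i)); lia.
Qed.

Lemma nth_cyclic (ads : list nat) (i : nat) :
  (i < length ads)%nat ->
  nth (Nat.modulo (S i) (length ads)) ads 0%nat = nth (S i) (ads ++ [hd 0%nat ads]) 0%nat.
Proof.
intros hi; destruct (Nat.eq_dec (S i) (length ads)) as [h|h].
- rewrite <- h, Nat.Div0.mod_same, app_nth2 by lia.
  rewrite h, Nat.sub_diag; destruct ads; auto.
- rewrite Nat.mod_small, app_nth1 by lia; auto.
Qed.

Lemma Forall2_of_nth {A B : Type} (R : A -> B -> Prop) (a0 : A) (b0 : B) (l : list A) :
  forall l', Forall2 R l l' <-> length l = length l' /\
    forall i, (i < length l')%nat -> R (nth i l a0) (nth i l' b0).
Proof.
induction l as [|x l IH]; intros [|y l']; cbn [length].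
- split; [split; [auto|intros; lia]|constructor].
- split; [inversion 1|intros [h _]; discriminate].
- split; [inversion 1|intros [h _]; discriminate].
- split.
  + inversion 1 as [|? ? ? ? h1 h2]; subst; apply IH in h2; destruct h2 as [h2 h3].
    split; [lia|]; intros [|i] hi; cbn; auto; apply h3; lia.
  + intros [h1 h2]; constructor; [apply (h2 0%nat); lia|].
    apply IH; split; [lia|]; intros i hi; apply (h2 (S i)); lia.
Qed.

Definition node_at (s : state) (x : nat) (kp : nat * point) : Prop :=
  node s x (fst kp) (snd kp).

(** Separates contents, forward links and starting node, which [stores_polygon] states index by
    index while [seg] interleaves them. *)
Lemma seg_nodes (s : state) (z : nat) (es : list edge) :
  forall a ads, seg s a es z ads <->
  Forall2 (node_at s) ads (nodes (polygon_of es)) /\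
  consecutive (fun x y => wmem s x 1 = y) ads z /\ a = hd z ads.
Proof.
induction es as [|e es IH]; intros a ads.
- cbn; split.
  + intros [-> ->]; cbn; auto.
  + intros (h & _ & ->); inversion h; subst; auto.
- change (nodes (polygon_of (e :: es))) with
    ((0%nat, src e) :: match app e with Some c => [(1%nat, c)] | None => [] end
       ++ nodes (polygon_of es)).
  cbn [seg]; cbv zeta; destruct (app e) as [c|]; cbn [List.app].
  + split.
    * intros (h1 & h2 & ads' & -> & h3); apply IH in h3; destruct h3 as (h3 & h4 & h5).
      split; [constructor; [exact h1|constructor; [exact h2|exact h3]]|].
      cbn; repeat split; auto.
    * intros (h1 & h2 & ->).
      inversion h1 as [|x ? l ? n1 h1']; subst; inversion h1' as [|y ? l' ? n2 h1'']; subst.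
      cbn in *; destruct h2 as (e1 & e2 & h2).
      split; [exact n1|]; rewrite e1; split; [exact n2|].
      exists l'; split; auto; rewrite e2; apply IH; auto.
  + split.
    * intros (h1 & ads' & -> & h3); apply IH in h3; destruct h3 as (h3 & h4 & h5).
      split; [constructor; [exact h1|exact h3]|]. cbn; repeat split; auto.
    * intros (h1 & h2 & ->).
      inversion h1 as [|x ? l ? n1 h1']; subst.
      cbn in *; destruct h2 as (e1 & h2).
      split; [exact n1|]. exists l; split; auto; rewrite e1; apply IH; auto.
Qed.

Lemma stores_polygon_seg (s : state) (h : nat) (P : polygon) (ads : list nat) :
  P <> [] ->
  stores_polygon s h P ads <->
  seg s h (edges P) h ads /\ NoDup ads /\
  consecutive (fun x y => wmem s y 2 = x) ads h.
Proof.
intros hP.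
rewrite seg_nodes, polygon_of_edges, !consecutive_nth,
  (@Forall2_of_nth nat (nat * point) _ 0%nat (0%nat, (0, 0))).
unfold stores_polygon; cbv zeta; split.
- intros (hl & hnd & hh & hi).
  assert (hc : forall i, (i < length ads)%nat ->
    nth (Nat.modulo (S i) (length (nodes P))) ads 0%nat = nth (S i) (ads ++ [h]) 0%nat).
  { intros i h'; rewrite <- hl, nth_cyclic, hh; auto. }
  split; [split; [split; [exact hl|]|split]|split; [auto|]].
  + intros i h'; destruct (hi i h') as (i1 & i2 & i3 & i4 & _); repeat split; auto; apply i1.
  + intros i h'; rewrite <- hc by auto; rewrite hl in h'; apply hi; auto.
  + destruct ads as [|x ads]; [|cbn in *; auto].
    exfalso; destruct P as [|[? ?] ?]; [auto|discriminate].
  + intros i h'; rewrite <- hc by auto; rewrite hl in h'; apply hi; auto.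
- intros (((hl & hi) & hn & hh) & hnd & hp).
  assert (hh' : hd 0%nat ads = h).
  { destruct ads as [|x ads]; [|cbn in *; auto].
    exfalso; destruct P as [|[? ?] ?]; [auto|discriminate]. }
  split; [auto|]; split; [auto|]; split; [auto|].
  intros i h'; assert (h'' := h'); rewrite <- hl in h''.
  rewrite <- hl, nth_cyclic, hh' by auto.
  destruct (hi i h') as (i1 & i2 & i3 & i4); split; [auto|].
  split; [auto|]; split; [auto|]; split; [auto|]; split; [apply hn; auto|apply hp; auto].
Qed.

(** * Restoring the backward links *)

Definition back_link_code : list instr := [WLoad 5 4 1; WStore 5 2 4; WMove 4 5]%nat.

(** One step precedes the loop because the loop ends at the first node, where the round also
    begins. *)
Definition back_links_code : cmd :=
  Seq (block (WMove 4 14 :: back_link_code)%nat)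
      (While (TNot (WEq 4 14)) (block back_link_code)).

(** Only field 2 is written, so the forward links that steer the loop persist. The [tl] in the frame
    clause leaves out the node where the loop starts: its backward link was written just before and
    has to survive. *)
Lemma reach_back_links_loop (h : nat) (r : list nat) :
  forall s : state,
  consecutive (fun x y => wmem s x 1 = y) r h -> ~ In h r -> NoDup r ->
  (forall x, In x r -> allocated s x) -> allocated s h ->
  wreg s 4 = hd h r -> wreg s 14 = h ->
  reach (While (TNot (WEq 4 14)) (block back_link_code)) s (1 + 5 * length r)
    (fun s' => consecutive (fun x y => wmem s' y 2 = x) r h /\
      (forall x i, i <> 2%nat \/ ~ In x (tl (r ++ [h])) -> wmem s' x i = wmem s x i) /\
      rmem s' = rmem s /\ free s' = free s /\ keeps_except [4; 5]%nat s s').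
Proof.
induction r as [|x r IH]; intros s hc hh hnd hal hah w4 w14.
- apply reach_while_end; [cbn in *; rewrite w4, w14; tauto| |lia].
  cbn; repeat split; auto; intros j _; auto.
- cbn [consecutive hd] in *; destruct hc as [hx hc].
  assert (hy : allocated s (hd h r)).
  { destruct r; cbn in *; auto. }
  apply NoDup_cons_iff in hnd; destruct hnd as [hxr hnd'].
  set (y := hd h r) in *.
  set (s1 := run_block back_link_code s).
  assert (w5 : wmem s x 1 = y) by auto.
  eapply reach_while_step with (n1 := 4%nat) (n2 := (1 + 5 * length r)%nat)
    (R := fun s' => s' = s1); [| | |cbn [length]; lia].
  + cbn; rewrite w4, w14; intros e; apply hh; cbn; auto.
  + apply reach_block; [|reflexivity|cbn; lia].
    cbn; rewrite w4, w5. unfold allocated in *; cbn.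
    split; [apply hal; cbn; auto|]; auto.
  + intros ? ->.
    assert (m1 : forall u i, wmem s1 u i = if Nat.eqb u y then upd (wmem s y) 2%nat x i else wmem s u i).
    { intros u i; cbn; rewrite w4, w5; unfold upd at 1; destruct (Nat.eqb_spec u y); auto. }
    assert (v4 : wreg s1 4 = y) by (cbn; rewrite w4, w5; auto).
    assert (k1 : keeps_except [4; 5]%nat s s1).
    { intros j hj; cbn in *; updates; tauto. }
    assert (f1 : free s1 = free s) by reflexivity.
    assert (r1 : rmem s1 = rmem s) by reflexivity.
    clearbody s1.
    assert (v14 : wreg s1 14 = h) by (rewrite <- w14; apply k1; cbn; lia).
    eapply reach_mono; [apply (IH s1)|lia|]; auto.
    * revert hc; clear - m1; clearbody y; induction r as [|u r IH]; cbn; auto.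
      intros [h1 h2]; split; [|apply IH; auto].
      rewrite m1; destruct (Nat.eqb_spec u y); [subst; unfold upd; cbn|]; auto.
    * intros h'; apply hh; cbn; auto.
    * intros u hu; unfold allocated in *; rewrite f1; apply hal; cbn; auto.
    * unfold allocated in *; rewrite f1; auto.
    * intros s2 (p1 & p2 & p3 & p4 & p5).
      split.
      { split; [|auto]. rewrite p2, m1, Nat.eqb_refl; [reflexivity|].
        right; unfold y; destruct r as [|u r]; cbn; [tauto|].
        apply NoDup_cons_iff in hnd'; destruct hnd' as [hu _].
rewrite in_app_iff; cbn.
        intros [h1|[h1|[]]]; [auto|]. apply hh; cbn; auto. }
      split.
      { intros u i hu.
        assert (hu' : i <> 2%nat \/ u <> y /\ ~ In u (tl (r ++ [h]))).
        { destruct hu as [hu|hu]; [auto|right]. cbn in hu. unfold y.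
          destruct r; cbn in *; intuition. }
        rewrite p2 by tauto. rewrite m1.
        destruct (Nat.eqb_spec u y); auto; subst.
        unfold upd; destruct (Nat.eqb_spec i 2); auto; tauto. }
      split; [congruence|]; split; [congruence|].
      eapply keeps_trans; eauto; inclusion.
Qed.

Lemma reach_back_links (s : state) (h : nat) (es : list edge) (ads : list nat) :
  es <> [] -> seg s h es h ads -> NoDup ads -> wreg s 14 = h ->
  reach back_links_code s (10 + 5 * length ads) (fun s' =>
    seg s' h es h ads /\ consecutive (fun x y => wmem s' y 2 = x) ads h /\
    evolves s ads s' ads /\ keeps_except [4; 5]%nat s s').
Proof.
intros hne hseg hnd w14.
assert (hal := seg_allocated _ _ _ _ _ hseg).
assert (hseg' := hseg); apply seg_nodes in hseg'; destruct hseg' as (hf & hc & hh).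
destruct ads as [|x r].
{ exfalso; apply hne; destruct es; auto; inversion hf. }
cbn in hh; subst x. cbn [consecutive] in hc; destruct hc as [hx hc].
apply NoDup_cons_iff in hnd; destruct hnd as [hhr hnd'].
set (y := hd h r) in *.
assert (hy : allocated s y).
{ apply hal; unfold y; destruct r; cbn; auto. }
assert (hah : allocated s h) by (apply hal; cbn; auto).
unfold back_links_code. set (s1 := run_block (WMove 4 14 :: back_link_code)%nat s).
eapply (reach_seq _ _ _ 5 (1 + 5 * length r)) with (R := fun s' => s' = s1);
  [| |cbn [length]; lia].
{ apply reach_block; [|reflexivity|cbn; lia].
  cbn; rewrite w14, hx; unfold allocated in *; cbn; auto. }
intros ? ->.
assert (m1 : forall u i, wmem s1 u i = if Nat.eqb u y then upd (wmem s y) 2%nat h i else wmem s u i).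
{ intros u i; cbn; rewrite w14, hx; unfold upd at 1; destruct (Nat.eqb_spec u y); auto. }
assert (v4 : wreg s1 4 = y) by (cbn; rewrite w14, hx; auto).
assert (k1 : keeps_except [4; 5]%nat s s1).
{ intros j hj; cbn in *; updates; tauto. }
assert (f1 : free s1 = free s) by reflexivity.
assert (r1 : rmem s1 = rmem s) by reflexivity.
clearbody s1.
assert (v14 : wreg s1 14 = h) by (rewrite <- w14; apply k1; cbn; lia).
eapply reach_mono; [apply (reach_back_links_loop h r s1)|lia|]; auto.
- revert hc; clear - m1; clearbody y; induction r as [|u r IH]; cbn; auto.
  intros [h1 h2]; split; [|apply IH; auto].
  rewrite m1; destruct (Nat.eqb_spec u y); [subst; unfold upd; cbn|]; auto.
- intros u hu; unfold allocated in *; rewrite f1; apply hal; cbn; auto.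
- unfold allocated in *; rewrite f1; auto.
- intros s2 (p1 & p2 & p3 & p4 & p5).
  assert (mm : forall u i, i <> 2%nat \/ ~ In u (h :: r) -> wmem s2 u i = wmem s u i).
  { intros u i hu.
    assert (hu' : i <> 2%nat \/ u <> y /\ ~ In u (tl (r ++ [h]))).
    { destruct hu as [hu|hu]; [auto|right]. cbn in hu. unfold y.
      split; [destruct r; cbn in *; intuition|].
      destruct r; cbn in *; [tauto|]. rewrite in_app_iff; cbn; tauto. }
    rewrite p2 by tauto. rewrite m1.
    destruct (Nat.eqb_spec u y); auto; subst.
    unfold upd; destruct (Nat.eqb_spec i 2); auto; tauto. }
  assert (nn : forall u k q, node s u k q -> node s2 u k q).
  { intros u k q; unfold node, allocated; rewrite p3, p4, r1, f1, mm; auto. }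
  split; [|split; [|split]].
  + apply seg_nodes; split; [|split].
    * eapply Forall2_impl; [|exact hf]; intros u kp; apply nn.
    * split; [rewrite mm; auto|].
      assert (m2 : forall u, wmem s2 u 1 = wmem s u 1) by (intros; apply mm; auto).
      revert hc; clear - m2; induction r as [|u r IH]; cbn; auto.
      intros [h1 h2]; split; auto; rewrite m2; auto.
    * auto.
  + split; [|exact p1].
    rewrite p2, m1, Nat.eqb_refl; [reflexivity|].
    right; unfold y; destruct r as [|u r]; cbn; [tauto|].
    apply NoDup_cons_iff in hnd'; destruct hnd' as [hu _].
rewrite in_app_iff; cbn.
    intros [h1|[h1|[]]]; [auto|]. apply hhr; cbn; auto.
  + split; [lia|]; split; [|split; [intros u q; apply nn|auto]].
    intros u _ hu i; rewrite p3, r1, mm by auto; auto.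
  + eapply keeps_trans; eauto; inclusion.
Qed.

(** * The whole construction *)

(** Unrelated edges yield no item and leave the tag alone, so they can be moved from the front of a
    rotation to its end. *)
Lemma sequence_append_unrelated (P Q : polygon) (us : list edge) :
  Forall (fun e => ~ related P Q e) us ->
  forall t es S, sequence_items P Q t es S -> sequence_items P Q t (es ++ us) S.
Proof.
intros hu t es S; induction 1; cbn; try (econstructor; eauto; fail).
induction hu; constructor; auto.
Qed.

Lemma sequence_first_item (P Q : polygon) (t : nat) (es : list edge) (S : list item) :
  Forall valid_edge es -> sequence_items P Q t es S ->
  (S = [] /\ Forall (fun e => ~ related P Q e) es) \/
  (exists us e vs, es = us ++ e :: vs /\ Forall (fun e => ~ related P Q e) us /\
     sequence_items P Q t (e :: vs) S /\ starts_at (src e) S).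
Proof.
intros hv hs; induction hs as [t|t e es S h hs IH|t e es it S h1 h2 h3 hs IH
                  |t e es pieces its S h1 h2 h3 h4 hs IH].
- left; auto.
- inversion hv as [|? ? _ hv']; subst.
  destruct (IH hv') as [[-> h']|(us & f & vs & -> & h1 & h2 & h3)].
  + left; auto.
  + right; exists (e :: us), f, vs; auto.
- right; exists [], e, es; split; [auto|]; split; [auto|].
  split; [eapply seq_whole; eauto|]. cbn; destruct h3 as (-> & _); auto.
- right; exists [], e, es; split; [auto|]; split; [auto|].
  split; [eapply seq_decomposed; eauto|].
  destruct h3 as (l & _ & hd).
  destruct pieces as [|p pieces]; [destruct l; cbn in hd; tauto|].
  inversion h4 as [|? it ? its' hit hits]; subst; cbn.
  destruct hit as (-> & _).
  destruct l; cbn in hd; [destruct pieces; [|tauto]|]; apply hd.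
Qed.

(** The given rotation may begin with unrelated edges, whereas the program can only find the source
    of the first item. Moving these edges to the end makes both starting points agree. *)
Lemma sequence_list_rotation (P Q : polygon) (S : list item) :
  Forall valid_edge (edges P) -> edges P <> [] -> sequence_list P Q S ->
  exists xs e ys, edges P = xs ++ e :: ys /\
    sequence_items P Q 1 ((e :: ys) ++ xs) S /\
    (xs = [] \/ starts_at (src e) S).
Proof.
intros hv hne (xs & ys & hP & hs).
assert (hv' : Forall valid_edge (ys ++ xs)).
{ rewrite hP in hv; apply Forall_app in hv; apply Forall_app; tauto. }
destruct (sequence_first_item P Q 1 _ S hv' hs) as [[-> h]|(us & e & vs & he & hu & hs' & hst)].
- assert (h' : Forall (fun e => ~ related P Q e) (edges P)).
  { rewrite hP; apply Forall_app in h; apply Forall_app; tauto. }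
  destruct (edges P) as [|e es]; [tauto|].
  exists [], e, es; split; [auto|]; split; [|auto].
  rewrite app_nil_r; apply (sequence_append_unrelated P Q _ h' 1 [] []); constructor.
- apply (sequence_append_unrelated P Q us hu) in hs'.
  (* The first related edge lies in [ys], or in [xs] if all of [ys] is unrelated. *)
  destruct (app_eq_app _ _ _ _ he) as (l & [[-> h2]|[-> ->]]).
  + destruct l as [|f l].
    * cbn in h2; subst xs; exists [], e, (vs ++ us); cbn.
      rewrite app_nil_r in *; split; [exact hP|]; split; [exact hs'|auto].
    * cbn in h2; injection h2 as <- ->.
      exists (xs ++ us), e, l; split; [rewrite hP, app_assoc; auto|].
      split; [|auto]. cbn in *; rewrite app_assoc; auto.
  + exists l, e, (vs ++ ys); split; [rewrite hP, <- app_assoc; auto|].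
    split; [|auto]. cbn in *; rewrite <- app_assoc; auto.
Qed.

(** * Size of the refined list *)

Lemma length_cut_all (pts : list point) :
  forall e, (length (cut_all e pts) <= 1 + length pts)%nat.
Proof.
induction pts as [|p pts IH]; intros e; unfold cut_all in *; cbn; [lia|].
destruct (point_dec p (src e)); [specialize (IH e); lia|].
destruct (point_dec p (dst e)); [specialize (IH e); lia|].
specialize (IH (right_part e p)); cbn; lia.
Qed.

Lemma length_item_points (its : list item) :
  (length (concat (map item_points its)) <= weight its)%nat.
Proof.
induction its as [|it its IH]; [cbn; lia|].
rewrite weight_cons; cbn [map concat]; rewrite length_app; lia.
Qed.

(** Bounds the final round over the backward links, whose cost is linear in the size of the new
    list. *)
Lemma aligned_length (es : list edge) (S : list item) (G : list (list edge)) :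
  aligned es S G -> (length (concat G) <= length es + weight S)%nat.
Proof.
induction 1 as [|e es S G _ _ IH|e es its S G _ _ _ IH]; cbn [concat length].
- lia.
- rewrite length_app; cbn [length]; lia.
- rewrite length_app, weight_app.
  pose proof (length_cut_all (concat (map item_points its)) e).
  pose proof (length_item_points its); lia.
Qed.

Lemma seg_length (s : state) (z : nat) (es : list edge) :
  forall a ads, seg s a es z ads -> (length ads <= 2 * length es)%nat.
Proof.
induction es as [|e es IH]; intros a ads; cbn [seg].
- intros [_ ->]; cbn; lia.
- cbv zeta; destruct (app e).
  + intros (_ & _ & ads' & -> & h); apply IH in h; cbn [length]; lia.
  + intros (_ & ads' & -> & h); apply IH in h; cbn [length]; lia.
Qed.

Lemma NoDup_app_swap {T : Type} (l m : list T) : NoDup (l ++ m) -> NoDup (m ++ l).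
Proof. apply Permutation_NoDup, Permutation_app_comm. Qed.

Definition refine_code (h i : nat) : cmd :=
  Seq (block [WMove 14 h; WMove 13 i; WMove 4 14; WConst 8 1; WConst 9 0; WConst 15 0])
      (Seq items_code back_links_code).

(** With m edges the weight is at most 3k + 9m. The loop costs 300 per unit of weight and at most
    100 per edge in each of its two walks; the last round costs 5 for each of at most 2 (m + weight)
    nodes. This gives about 3000 m + 930 k, and since m is positive, 4000 also absorbs the additive
    constants. *)
Lemma reach_refine (P Q : polygon) (S : list item) (k h i : nat) (s : state)
    (f g : list nat) :
  (h < 4)%nat -> (i < 4)%nat -> circular_arc_polygon P -> sequence_list P Q S ->
  has_card (boundary_intersection P Q) k ->
  stores_polygon s (wreg s h) P f -> stores_items s (wreg s i) S g ->
  (forall x, In x g -> ~ In x f) ->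
  reach (refine_code h i) s (4000 * (length (edges P) + k)) (fun s' =>
    exists P' f', new_polygon P Q P' /\ stores_polygon s' (wreg s h) P' f' /\
      evolves s f s' f' /\ forall j, (j < 4)%nat -> wreg s' j = wreg s j).
Proof.
intros hh hi circ hseq hcard hpoly hits hdis.
assert (hP : P <> []) by (intros ->; destruct circ as [h2 _]; cbn in h2; lia).
assert (hE : edges P <> []).
{ intros h2; apply hP; apply length_zero_iff_nil; rewrite <- length_edges, h2; auto. }
assert (hval : Forall valid_edge (edges P)) by apply circ.
apply stores_polygon_seg in hpoly; auto; destruct hpoly as (hseg & hnd & _).
destruct (sequence_list_rotation P Q S hval hE hseq) as (xs & e & ys & hxy & hs & hst).
set (ys' := e :: ys) in *. set (es := ys' ++ xs) in *.
assert (hsrc : NoDup (map src (edges P))).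
{ rewrite src_edges; apply circ. }
assert (hin : incl es (edges P)).
{ intros x hx; rewrite hxy; apply in_or_app; apply in_app_or in hx; tauto. }
assert (hndes : NoDup (map src es)).
{ rewrite hxy, map_app in hsrc; unfold es; rewrite map_app.
  apply NoDup_app_swap; auto. }
destruct (sequence_aligned P Q circ 1 es S hs hin hndes)
  as (G & L & hal & href & hchG & hndL & hL & hw).
assert (hLk : (length L <= k)%nat).
{ destruct hcard as (l & l1 & l2 & <-); apply NoDup_incl_length; auto.
  intros x hx; apply l2; destruct (hL x hx) as (e' & he & [ho _] & hb); split; auto.
  exists e'; auto. }
assert (hle : length es = length (edges P)).
{ unfold es; rewrite hxy, !length_app; lia. }
assert (hm : (1 <= length (edges P))%nat) by (destruct (edges P); cbn; [tauto|lia]).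
assert (hch : exists v, edge_chain v (edges P) v).
{ destruct P as [|[v c] P']; [tauto|]; exists v; eapply edges_chain; eauto. }
destruct hch as [v hch]; rewrite hxy in hch; apply edge_chain_app in hch.
destruct hch as (c & hcx & hcy).
assert (ec : src e = c) by apply hcy.
assert (hchr : edge_chain c es c) by (apply edge_chain_app; exists v; auto).
rewrite hxy in hseg; apply seg_app in hseg.
destruct hseg as (y & f1 & f2 & -> & sx & sy).
assert (ny : node s y 0 c) by (rewrite <- ec; apply sy).
destruct (seg_gseg _ _ _ _ _ sx) as (bx & lx & gx).
destruct (seg_gseg _ _ _ _ _ sy) as (by' & ly & gy).
(* The circular list is read from the node [y] of [e] instead of its first node. *)
assert (grot : gseg s y (singles es) (by' ++ bx) y (f2 ++ f1)).
{ unfold es, singles; rewrite map_app; apply gseg_app.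
  { rewrite length_map; auto. }
  exists (wreg s h), f2, f1; auto. }
set (h0 := wreg s h) in *.
unfold refine_code.
eapply (reach_seq _ _ _ 7 (3993 * (length (edges P) + k)))
  with (R := fun s' => same_mem s s' /\ wreg s' 4 = h0 /\ wreg s' 14 = h0 /\
    wreg s' 13 = wreg s i /\ wreg s' 8 = 1%nat /\ wreg s' 9 = 0%nat /\
    wreg s' 15 = 0%nat /\ (forall j, (j < 4)%nat -> wreg s' j = wreg s j)); [| |lia].
{ apply reach_block; [cbn; tauto| |cbn; lia].
  split; [repeat split|]; split; [reflexivity|]; split; [reflexivity|].
  split; [cbn; updates; auto|].
  split; [reflexivity|]; split; [reflexivity|]; split; [reflexivity|].
  intros j hj; cbn; updates; auto. }
intros s1 (m1 & w4 & w14 & w13 & w8 & w9 & w15 & wl).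
assert (hits1 : stores_items s1 (wreg s1 13) S g).
{ rewrite w13; eapply stores_items_evolves;
    [apply (same_mem_evolves _ _ []); eauto|eauto|cbn; tauto]. }
set (cost := (1 + 300 * weight S + 100 * length es)%nat).
eapply (reach_seq _ _ _ (cost + 100 * length xs)
          (3993 * (length (edges P) + k) - (cost + 100 * length xs)))
  with (R := fun s' => exists ads',
    gseg s' y G (by' ++ bx) y ads' /\ NoDup ads' /\ evolves s (f2 ++ f1) s' ads' /\
    keeps_except scratch s1 s').
{ assert (loop : forall s2, same_mem s1 s2 -> wreg s2 4 = y ->
    keeps_except [4; 5; 6; 12]%nat s1 s2 ->
    reach items_code s2 cost (fun s' => exists ads',
      gseg s' y G (by' ++ bx) y ads' /\ NoDup ads' /\ evolves s (f2 ++ f1) s' ads' /\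
      keeps_except scratch s1 s')).
  { intros s2 m2 v4 k2.
    assert (m02 : same_mem s s2).
    { destruct m1 as (? & ? & ?), m2 as (? & ? & ?); repeat split; congruence. }
    eapply reach_mono;
      [apply (reach_items es S G hal s2 y y (by' ++ bx) (f2 ++ f1) g c c)| |]; auto.
    - eapply gseg_same; eauto.
    - apply NoDup_app_swap; auto.
    - eapply node_same; eauto.
    - rewrite k2; auto; cbn; lia.
    - rewrite k2; auto; cbn; lia.
    - rewrite k2; auto; cbn; lia.
    - rewrite k2 by (cbn; lia).
      eapply stores_items_evolves;
        [apply (same_mem_evolves s1 s2 []); auto|eauto|cbn; tauto].
    - intros x hx h2; apply (hdis x hx), in_or_app; apply in_app_or in h2; tauto.
    - intros s3 (ads' & d1 & d2 & d3 & d4).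
      exists ads'; split; [auto|]; split; [auto|].
      split; [eapply evolves_same_l; eauto|].
      eapply keeps_trans; eauto; inclusion. }
  destruct hst as [->|hst].
  - cbn in sx; destruct sx as [<- _].
    eapply reach_mono; [apply (loop s1); auto|lia|auto]; [repeat split|intros j _; auto].
  - destruct S as [|it S]; [cbn in hst; tauto|].
    eapply (reach_sync it S xs s1 h0 y f1 g v c); auto.
    + eapply seg_same; eauto.
    + eapply node_same; eauto.
    (* Vertices are distinct, so no edge before [e] has the source of the first item. *)
    + cbn in hst; rewrite hst; intros x hx heq.
      rewrite hxy, map_app in hsrc. cbn in hsrc.
      apply (NoDup_app_disjoint _ _ hsrc (src x)); [apply in_map; auto|].
      rewrite <- heq; cbn; auto. }
2:{ unfold cost; rewrite hle. rewrite hxy in *; rewrite !length_app in *; lia. }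
intros s2 (ads' & g2 & nd2 & ev2 & k2).
assert (hG : length G = length es) by (symmetry; eapply Forall2_length; eauto).
unfold es in href, hchG. apply Forall2_app_inv_l in href.
destruct href as (Gy & Gx & hry & hrx & ->).
assert (lGy : length by' = length Gy).
{ rewrite ly; eapply Forall2_length; eauto. }
assert (lGx : length Gx = length xs) by (symmetry; eapply Forall2_length; eauto).
apply gseg_app in g2; auto; destruct g2 as (w & a2 & a1 & -> & gy2 & gx2).
(* The unchanged list of starting nodes shows that the group of the first stored edge still begins
   at [h0]. *)
assert (hw0 : w = h0).
{ destruct xs as [|x0 xs].
  - destruct Gx; [|discriminate]. destruct bx; [|discriminate].
    cbn in gx2, sx; destruct gx2 as [-> _], sx as [-> _]; auto.
  - destruct Gx; [discriminate|]. destruct bx; [discriminate|].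
    cbn in gx2, gx; destruct gx2 as [-> _], gx as [-> _]; auto. }
subst w.
set (es' := concat Gx ++ concat Gy).
assert (seg2 : seg s2 h0 es' h0 (a1 ++ a2)).
{ apply seg_app; exists y, a1, a2; split; auto; split; eapply gseg_seg; eauto. }
assert (hch' : edge_chain v es' v).
{ apply Forall2_app_inv_l in hchG; destruct hchG as (Gy' & Gx' & cy & cx & eG).
  destruct (app_eq_app _ _ _ _ eG) as (l & hl).
  assert (l = []).
  { apply length_zero_iff_nil. pose proof (Forall2_length cy) as q1.
    pose proof (Forall2_length hry) as q2.
    destruct hl as [[q3 _]|[q3 _]]; apply (f_equal (@length _)) in q3;
      rewrite length_app in q3; lia. }
  subst l; rewrite !app_nil_r in hl; cbn in hl.
  assert (Gy' = Gy /\ Gx' = Gx) as [-> ->] by (destruct hl as [[? ?]|[? ?]]; auto).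
  apply edge_chain_app; exists c; split; eapply edge_chain_concat; eauto. }
(* An empty group would be a chain from [src e] to [dst e] without edges, although these points have
   different keys. *)
assert (hes' : es' <> []).
{ intros h2; assert (concat Gy = []) by (apply app_eq_nil in h2; tauto).
  inversion hry as [|? g0 ? ? hr0 _]; subst.
  assert (chain0 : edge_chain (src e) g0 (dst e)).
  { inversion hchG; auto. }
  cbn in H; apply app_eq_nil in H; destruct H as [-> _].
  cbn in chain0.
  destruct (valid_keyed e) as (M & kk & K & _).
  { rewrite Forall_forall in hval; apply hval, hin; cbn; auto. }
  destruct K as (_ & _ & _ & hlt & _); rewrite chain0 in hlt; lra. }
assert (nd2' : NoDup (a1 ++ a2)) by (apply NoDup_app_swap; auto).
eapply reach_mono;
  [apply (reach_back_links s2 h0 es' (a1 ++ a2)); auto|..].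
- rewrite k2; auto; cbn; lia.
- pose proof (seg_length _ _ _ _ _ seg2) as q1.
  pose proof (aligned_length _ _ _ hal) as q2.
  rewrite concat_app in q2; unfold es' in q1; rewrite !length_app in *.
  unfold cost. rewrite hxy in *; rewrite !length_app in *; lia.
- intros s3 (c1 & c2 & c3 & c4).
  exists (polygon_of es'), (a1 ++ a2).
  assert (ee : edges (polygon_of es') = es') by (eapply edges_polygon_of; eauto).
  split.
  { exists (Gx ++ Gy); rewrite hxy, ee, concat_app; split; auto.
    apply Forall2_app; auto. }
  split.
  { apply stores_polygon_seg; [|rewrite ee; auto].
    intros h2; apply hes'; rewrite <- ee, h2; auto. }
  split.
  { destruct ev2 as (e1 & e2 & e3 & e4).
    assert (ev2' : evolves s (f1 ++ f2) s2 (a1 ++ a2)).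
    { split; [auto|]; split; [|split; [auto|]].
      - intros x hx hn; apply e2; auto; rewrite in_app_iff in *; tauto.
      - intros x hx; specialize (e4 x); rewrite !in_app_iff in *; tauto. }
    eapply evolves_trans; [exact ev2'|exact c3|auto|auto]. }
  intros j hj; rewrite c4, k2, wl; auto; cbn; lia.
Qed.

Lemma NoDup_app_split {T : Type} (l m : list T) :
  NoDup (l ++ m) -> NoDup m /\ forall x, In x l -> ~ In x m.
Proof.
intros h; split; [eapply NoDup_app_remove_l; eauto|apply NoDup_app_disjoint; auto].
Qed.

Lemma has_card_iff {T : Type} (A B : T -> Prop) (n : nat) :
  (forall x, A x <-> B x) -> has_card A n -> has_card B n.
Proof.
intros h (l & l1 & l2 & l3); exists l; split; [auto|]; split; [|auto].
intros x; rewrite l2; auto.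
Qed.

Lemma stores_polygon_evolves (s s' : state) (h : nat) (P : polygon)
    (f l l' : list nat) :
  stores_polygon s h P f -> evolves s l s' l' ->
  (forall x, In x f -> ~ In x l) -> stores_polygon s' h P f.
Proof.
intros (h1 & h2 & h3 & h4) (e1 & e2 & _) hd.
split; [auto|]; split; [auto|]; split; [auto|].
cbv zeta in *; intros i hi.
assert (alloc : forall j, (j < length (nodes P))%nat -> allocated s (nth j f 0%nat))
  by (intros j hj; apply h4; auto).
assert (same : forall j, (j < length (nodes P))%nat -> mem_eq_at s s' (nth j f 0%nat)).
{ intros j hj; apply e2; [auto|]. apply hd, nth_In; lia. }
assert (hi' : (Nat.modulo (S i) (length (nodes P)) < length (nodes P))%nat)
  by (apply Nat.mod_upper_bound; lia).
assert (si := same i hi). assert (si' := same _ hi'). assert (ai := alloc i hi).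
rewrite (proj1 (si 0%nat)), (proj1 (si 1%nat)), (proj2 (si 0%nat)), (proj2 (si 1%nat)),
  (proj1 (si' 2%nat)).
destruct (h4 i hi) as (_ & h5); split; [unfold allocated in *; lia|exact h5].
Qed.

(* One program and one constant serve all inputs. *)
Theorem theorem5 :
  exists (p : cmd) (K : nat),
  forall (P1 P2 : polygon) (S1 S2 : list item) (m n l k : nat) (s : state),
    circular_arc_polygon P1 ->
    circular_arc_polygon P2 ->
    length (edges P1) = m ->
    length (edges P2) = n ->
    has_card (related_edge P1 P2) l ->
    has_card (boundary_intersection P1 P2) k ->
    sequence_list P1 P2 S1 ->
    sequence_list P2 P1 S2 ->
    initial_state s P1 P2 S1 S2 ->
    exists (P1' P2' : polygon) (t : nat) (s' : state),
      new_polygon P1 P2 P1' /\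
      new_polygon P2 P1 P2' /\
      exec p s t s' /\
      final_state s' P1' P2' /\
      (t <= K * (m + n + l + k))%nat.
Proof.
(* The two runs cost 4000 (m + k) and 4000 (n + k); counting k twice accounts for the factor 2. *)
exists (Seq (refine_code 0 2) (refine_code 1 3)), (2 * 4000)%nat.
intros P1 P2 S1 S2 m n l k s C1 C2 hm hn _ hk hs1 hs2
  (f1 & f2 & g1 & g2 & p1 & p2 & i1 & i2 & hnd).
apply NoDup_app_split in hnd; destruct hnd as [hnd d1].
apply NoDup_app_split in hnd; destruct hnd as [hnd d2].
apply NoDup_app_split in hnd; destruct hnd as [_ d3].
assert (hk' : has_card (boundary_intersection P2 P1) k).
{ eapply has_card_iff; [|exact hk]; intros x; unfold boundary_intersection; tauto. }
assert (run : reach (Seq (refine_code 0 2) (refine_code 1 3)) s (2 * 4000 * (m + n + l + k))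
  (fun s' => exists P1' P2', new_polygon P1 P2 P1' /\ new_polygon P2 P1 P2' /\
     final_state s' P1' P2')).
{ eapply reach_seq with (1 := reach_refine P1 P2 S1 k 0 2 s f1 g1 _ _ C1 hs1 hk p1 i1 _)
    (n2 := (4000 * (length (edges P2) + k))%nat); [|lia].
  (* The first run changes only nodes of [f1] and fresh ones, so the second polygon and its items
     are intact when the second run begins. *)
  intros s1 (P1' & f1' & q1 & q2 & q3 & q4).
  assert (f2d : forall x, In x f2 -> ~ In x f1)
    by (intros x h h'; apply (d1 x h'), in_or_app; auto).
  assert (f2a : forall x, In x f2 -> allocated s x).
  { intros x hx; destruct (In_nth _ _ 0%nat hx) as (j & hj & <-).
    destruct p2 as (h1 & _ & _ & h4); apply h4; lia. }
  eapply reach_mono; [eapply (reach_refine P2 P1 S2 k 1 3 s1 f2 g2); auto|lia|].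
  - rewrite q4 by lia; eapply stores_polygon_evolves; eauto.
  - rewrite q4 by lia; eapply stores_items_evolves; eauto.
    intros x h h'; apply (d1 x h'); rewrite !in_app_iff; auto.
  - intros x h h'; apply (d2 x h'); rewrite !in_app_iff; auto.
  - intros s2 (P2' & f2' & r1 & r2 & r3 & r4).
    assert (f1a : forall x, In x f1' -> allocated s1 x).
    { intros x hx; destruct (In_nth _ _ 0%nat hx) as (j & hj & <-).
      destruct q2 as (h1 & _ & _ & h4); apply h4; lia. }
    assert (f1d : forall x, In x f1' -> ~ In x f2).
    { intros x h h'; eapply (evolves_disjoint _ _ _ _ f2 q3); eauto. }
    exists P1', P2'; split; [auto|]; split; [auto|].
    exists f1', f2'; rewrite !r4, q4 by lia. split; [|split].
    + eapply stores_polygon_evolves; eauto.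
    + auto.
    + apply NoDup_app; [apply q2|apply r2|].
      eapply evolves_disjoint; eauto. }
destruct run as (t & s' & he & ht & P1' & P2' & h1 & h2 & h3).
exists P1', P2', t, s'; auto.
Unshelve.
- lia.
- lia.
- intros x h h'; apply (d1 x h'); rewrite !in_app_iff; auto.
Qed.
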